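(* Assume that $\theta=-8$. Then $\lambda_*=+\infty$. That is, the unique eigenvalue exchange solution $\chi_\lambda$ for small $\lambda$ can be extended to a smooth branch of eigenvalue exchange solutions $$(0,+\infty)\to\mathcal H^{ee},\quad\lambda\mapsto\chi_\lambda,$$ with $\nu(\lambda)>0$ for all $\lambda>0$. Moreover, there exists $\lambda_c>0$ such that $$\mu(\lambda)>0\ \ \forall\lambda\in(0,\lambda_c),\qquad\mu(\lambda_c)=0,\qquad\mu'(\lambda_c)<0.$$ In fact $\mu'(\lambda)<0$ for all $\lambda>0$, and $\lim_{\lambda\to+\infty}\mu(\lambda)<0$.
   Context: Fix a parameter $\theta<1$ and set $q_+=\frac{1+\sqrt{1-\theta}}{6}$ (so $q_+=2/3$ when $\theta=-8$). A triple $(q_1,q_2,q_3)$ of real functions on $[-1,1]$ is identified with the symmetric traceless matrix-valued map $$Q(x)=\begin{pmatrix}-2q_1(x)&0&0\\0&q_1(x)-q_2(x)&q_3(x)\\0&q_3(x)&q_1(x)+q_2(x)\end{pmatrix}.$$ With $|Q|^2=\mathrm{tr}(Q^2)$, let $$f(Q)=\frac{\theta}{6}|Q|^2-\frac23\mathrm{tr}(Q^3)+\frac18|Q|^4+c(\theta)=\frac{\theta}{3}(3q_1^2+q_2^2+q_3^2)+4q_1(q_1^2-q_2^2-q_3^2)+\frac12(3q_1^2+q_2^2+q_3^2)^2+c(\theta),$$ where the constant $c(\theta)$ is chosen so that $\min f=0$. Let $\mathcal H$ be the affine space of $Q=(q_1,q_2,q_3)\in H^1(-1,1)^3$ with $q_1(\pm1)=q_+$,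 $q_2(-1)=3q_+$, $q_2(1)=-3q_+$, $q_3(\pm1)=0$. For $\lambda>0$ the energy on $\mathcal H$ is $$E_\lambda(Q)=\int_{-1}^1\left(\frac{1}{2\lambda^2}|Q'|^2+f(Q)\right)dx,$$ and a critical point is a $Q\in\mathcal H$ with $DE_\lambda(Q)=0$ in $H^{-1}(-1,1)^3$. $\mathcal H^{ee}=\{Q\in\mathcal H: q_3\equiv0\}$; its elements are written $(q_1,q_2)$, and critical points of $E_\lambda$ in $\mathcal H^{ee}$ are called eigenvalue exchange solutions. Smooth means $C^\infty$. For a critical point $\chi_\lambda=(q_1,q_2)\in\mathcal H^{ee}$ of $E_\lambda$, the second variation splits as $D^2E_\lambda(\chi_\lambda)[(h_1,h_2,h_3)]=\Phi_\lambda[h_1,h_2]+\Psi_\lambda[h_3]$ for $h_i\in H^1_0(-1,1)$, with $$\Phi_\lambda[h_1,h_2]=\int_{-1}^1\Big\{\tfrac{6(h_1')^2+2(h_2')^2}{\lambda^2}+6\left(\tfrac\theta3+2q_1+9q_1^2+q_2^2\right)h_1^2+2\left(\tfrac\theta3-4q_1+3q_1^2+3q_2^2\right)h_2^2+8q_2(3q_1-2)h_1h_2\Big\}dx,$$ $$\Psi_\lambda[h]=\int_{-1}^1\Big\{\tfrac{2(h')^2}{\lambda^2}+2\left(\tfrac\theta3-4q_1+3q_1^2+q_2^2\right)h^2\Big\}dx.$$ Define $$\nu(\lambda)=\inf_{(h_1,h_2)\in H^1_0(-1,1)^2\setminus\{0\}}\frac{\Phi_\lambda[h_1,h_2]}{\int(h_1^2+h_2^2)},\qquad\mu(\lambda)=\inf_{h\in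 H^1_0(-1,1)\setminus\{0\}}\frac{\Psi_\lambda[h]}{\int h^2}.$$ The branch: there is $\lambda_0>0$ such that for each $\lambda\in(0,\lambda_0)$, $E_\lambda$ has a unique critical point $\chi_\lambda$ in $\mathcal H$, and $\chi_\lambda\in\mathcal H^{ee}$. The map $\lambda\mapsto\chi_\lambda$ extends uniquely to a smooth map $(0,\lambda_* )\to\mathcal H^{ee}$ of critical points, where $\lambda_*\in[\lambda_0,+\infty]$ is determined by: $\nu(\lambda)>0$ for all $\lambda\in(0,\lambda_* )$, and either $\lambda_*=+\infty$ or $\nu(\lambda)\to0$ as $\lambda\to\lambda_*^-$. The function $\mu$ is evaluated along this branch and is smooth on $(0,\lambda_* )$. *)

(* Defs.v *)
From mathcomp Require Import all_boot all_order all_algebra.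
From mathcomp Require Import all_classical all_reals all_analysis.
From mathcomp Require Import ring.
Set Implicit Arguments.
Unset Strict Implicit.
Unset Printing Implicit Defensive.
Import Order.TTheory GRing.Theory Num.Theory.
Import numFieldNormedType.Exports.
Local Open Scope classical_set_scope.
Local Open Scope ring_scope.

(* A function on [-1, 1] is a total function R -> R whose values outside
   [-1, 1] are irrelevant: nothing below depends on them. *)

Definition itg (R : realType) (f : R -> R) : R :=
  \int[@lebesgue_measure R]_(x in `[-1, 1]) f x.

Definition square_integrable (R : realType) (g : R -> R) : Prop :=
  measurable_fun (`[-1, 1] : set R) g /\
  (@lebesgue_measure R).-integrable `[-1, 1] (fun x => (g x ^+ 2)%:E).

(* In dimension one, the elements of H^1(-1, 1), taken with their continuous
   representatives on [-1, 1], are the primitives of L^2 functions. *)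
Definition weak_derivative (R : realType) (f g : R -> R) : Prop :=
  square_integrable g /\
  forall x : R, -1 <= x <= 1 ->
    f x = f (-1) + \int[@lebesgue_measure R]_(t in `[-1, x]) g t.

Definition H1 (R : realType) (f : R -> R) : Prop :=
  exists g : R -> R, weak_derivative f g.

Definition H10 (R : realType) (f : R -> R) : Prop :=
  [/\ H1 f, f (-1) = 0 & f 1 = 0].

(* The weak derivative is unique up to a negligible subset of [-1, 1]; it is
   only used under the integral sign. *)
Definition wder (R : realType) (f : R -> R) : R -> R :=
  xget (fun=> 0) [set g | weak_derivative f g].

Definition H1norm (R : realType) (f : R -> R) : R :=
  Num.sqrt (itg (fun x => f x ^+ 2) + itg (fun x => wder f x ^+ 2)).

(* Triples (q1, q2, q3), with the pointwise vector space structure that the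
   library provides on pairs and functions. *)
Definition triple (R : realType) : Type := ((R -> R) * (R -> R) * (R -> R))%type.

Definition q1 (R : realType) (Q : triple R) : R -> R := Q.1.1.
Definition q2 (R : realType) (Q : triple R) : R -> R := Q.1.2.
Definition q3 (R : realType) (Q : triple R) : R -> R := Q.2.

Definition H1_3 (R : realType) (Q : triple R) : Prop :=
  [/\ H1 (q1 Q), H1 (q2 Q) & H1 (q3 Q)].

Definition H10_3 (R : realType) (Q : triple R) : Prop :=
  [/\ H10 (q1 Q), H10 (q2 Q) & H10 (q3 Q)].

Definition H1norm3 (R : realType) (Q : triple R) : R :=
  Num.sqrt (H1norm (q1 Q) ^+ 2 + H1norm (q2 Q) ^+ 2 + H1norm (q3 Q) ^+ 2).

Definition same_on (R : realType) (P Q : triple R) : Prop :=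
  forall x : R, -1 <= x <= 1 ->
    [/\ q1 P x = q1 Q x, q2 P x = q2 Q x & q3 P x = q3 Q x].

Definition Qmx (R : realType) (a b c : R) : 'M[R]_3 :=
  \matrix_(i, j) nth 0 (nth [::] [:: [:: - 2 * a; 0; 0];
                                     [:: 0; a - b; c];
                                     [:: 0; c; a + b]] i) j.

Definition normsq (R : realType) (M : 'M[R]_3) : R := \tr (M *m M).

Definition potential0 (R : realType) (theta : R) (M : 'M[R]_3) : R :=
  theta / 6 * normsq M - 2 / 3 * \tr (M *m M *m M) + 1 / 8 * normsq M ^+ 2.

(* The constant c(theta) for which the minimum of the potential is 0. *)
Definition ctheta (R : realType) (theta : R) : R :=
  - inf [set y | exists a b c : R, y = potential0 theta (Qmx a b c)].

Definition potential (R : realType) (theta : R) (M : 'M[R]_3) : R :=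
  potential0 theta M + ctheta theta.

Lemma normsqE (R : realType) (a b c : R) :
  normsq (Qmx a b c) = 2 * (3 * a ^+ 2 + b ^+ 2 + c ^+ 2).
Proof.
by rewrite /normsq /mxtrace !big_ord_recl big_ord0 !mxE !big_ord_recl !big_ord0
  !mxE /=; ring.
Qed.

Lemma potentialE (R : realType) (theta a b c : R) :
  potential theta (Qmx a b c) =
  theta / 3 * (3 * a ^+ 2 + b ^+ 2 + c ^+ 2)
  + 4 * a * (a ^+ 2 - b ^+ 2 - c ^+ 2)
  + 1 / 2 * (3 * a ^+ 2 + b ^+ 2 + c ^+ 2) ^+ 2 + ctheta theta.
Proof.
rewrite /potential /potential0 normsqE; congr (_ + _).
rewrite /mxtrace; do ! rewrite ?big_ord_recl ?big_ord0 ?mxE /=.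
by field.
Qed.

Definition qplus (R : realType) (theta : R) : R :=
  (1 + Num.sqrt (1 - theta)) / 6.

(* The affine space H. *)
Definition admissible (R : realType) (theta : R) (Q : triple R) : Prop :=
  [/\ H1_3 Q,
      q1 Q (-1) = qplus theta /\ q1 Q 1 = qplus theta,
      q2 Q (-1) = 3 * qplus theta /\ q2 Q 1 = - 3 * qplus theta
    & q3 Q (-1) = 0 /\ q3 Q 1 = 0].

(* The subspace H^ee. *)
Definition admissible_ee (R : realType) (theta : R) (Q : triple R) : Prop :=
  admissible theta Q /\ forall x : R, -1 <= x <= 1 -> q3 Q x = 0.

Definition energy (R : realType) (theta lambda : R) (Q : triple R) : R :=
  itg (fun x =>
    1 / (2 * lambda ^+ 2)
      * normsq (Qmx (wder (q1 Q) x) (wder (q2 Q) x) (wder (q3 Q) x))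
    + potential theta (Qmx (q1 Q x) (q2 Q x) (q3 Q x))).

(* DE_lambda(Q) = 0: the Frechet differential of the energy at Q, in the
   directions of H^1_0(-1, 1)^3, exists and is the zero functional. *)
Definition critical (R : realType) (theta lambda : R) (Q : triple R) : Prop :=
  admissible theta Q /\
  forall eps : R, 0 < eps -> exists2 delta : R, 0 < delta &
    forall h : triple R, H10_3 h -> H1norm3 h <= delta ->
      `|energy theta lambda (Q + h) - energy theta lambda Q|
        <= eps * H1norm3 h.

(* The second variation at chi in the directions (h1, h2, 0). The coefficient
   kappa of q1 * h1 ^+ 2 is 4 in the second variation of the energy, since the
   cubic term 4 * q1 ^+ 3 of the potential has second derivative
   24 * q1 = 6 * (4 * q1). It is left as a parameter because the formula for
   Phi also circulates with the coefficient 2. *)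
Definition Phi (R : realType) (kappa theta lambda : R) (chi : triple R)
    (h1 h2 : R -> R) : R :=
  itg (fun x =>
    (6 * wder h1 x ^+ 2 + 2 * wder h2 x ^+ 2) / lambda ^+ 2
    + 6 * (theta / 3 + kappa * q1 chi x + 9 * q1 chi x ^+ 2 + q2 chi x ^+ 2)
        * h1 x ^+ 2
    + 2 * (theta / 3 - 4 * q1 chi x + 3 * q1 chi x ^+ 2 + 3 * q2 chi x ^+ 2)
        * h2 x ^+ 2
    + 8 * q2 chi x * (3 * q1 chi x - 2) * h1 x * h2 x).

Definition Psi (R : realType) (theta lambda : R) (chi : triple R)
    (h : R -> R) : R :=
  itg (fun x =>
    2 * wder h x ^+ 2 / lambda ^+ 2
    + 2 * (theta / 3 - 4 * q1 chi x + 3 * q1 chi x ^+ 2 + q2 chi x ^+ 2)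
        * h x ^+ 2).

Definition nu (R : realType) (kappa theta lambda : R) (chi : triple R) : R :=
  inf [set y | exists h1 h2 : R -> R,
    [/\ H10 h1, H10 h2,
        exists2 x : R, -1 <= x <= 1 & (h1 x != 0) || (h2 x != 0)
      & y = Phi kappa theta lambda chi h1 h2
            / itg (fun x => h1 x ^+ 2 + h2 x ^+ 2)]].

Definition mu (R : realType) (theta lambda : R) (chi : triple R) : R :=
  inf [set y | exists h : R -> R,
    [/\ H10 h, exists2 x : R, -1 <= x <= 1 & h x != 0
      & y = Psi theta lambda chi h / itg (fun x => h x ^+ 2)]].

(* C^infinity curves in H^1(-1, 1)^3 parametrized by an open set A; D k is the
   k-th derivative with respect to the parameter, for the H^1 norm. *)
Definition smooth_curve (R : realType) (A : set R) (chi : R -> triple R) : Prop :=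
  exists D : nat -> R -> triple R, D 0%N = chi /\
    forall (k : nat) (lambda : R), A lambda ->
      H1_3 (D k lambda) /\
      H1norm3 (t^-1 *: (D k (lambda + t) - D k lambda) - D k.+1 lambda)
        @[t --> (0 : R)^'] --> (0 : R).

(* The branch of eigenvalue exchange solutions: chi lambda is the unique
   critical point for lambda < lambda0, and lambdas is the maximal value
   lambda_* in [lambda0, +oo]. *)
Definition is_branch (R : realType) (kappa theta lambda0 : R)
    (lambdas : \bar R) (chi : R -> triple R) : Prop :=
  [/\ 0 < lambda0 /\ (lambda0%:E <= lambdas)%E,
      (forall lambda : R, 0 < lambda < lambda0 ->
        forall Q : triple R, critical theta lambda Q -> same_on Q (chi lambda)),
      smooth_curve [set lambda | 0 < lambda /\ (lambda%:E < lambdas)%E] chi,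
      (forall lambda : R, 0 < lambda -> (lambda%:E < lambdas)%E ->
        [/\ admissible_ee theta (chi lambda), critical theta lambda (chi lambda)
          & 0 < nu kappa theta lambda (chi lambda)])
    & lambdas = +oo%E \/
      exists2 l : R, lambdas = l%:E &
        nu kappa theta lambda (chi lambda) @[lambda --> l^'-] --> (0 : R)].

(* Main.v *)
Require Import Defs.
From mathcomp Require Import all_boot all_order all_algebra.
From mathcomp Require Import all_classical all_reals all_analysis.
From mathcomp Require Import measurable_realfun.
From mathcomp Require Import ring lra.
Set Implicit Arguments.
Unset Strict Implicit.
Unset Printing Implicit Defensive.
Import Order.TTheory GRing.Theory Num.Theory.
Import numFieldNormedType.Exports.
Local Open Scope classical_set_scope.
Local Open Scope ring_scope.

(** For theta = -8 the first component of an eigenvalue exchange solution can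
be the constant 2/3 = q_+, and then the coupling terms drop out: the branch is
(2/3, q, 0), where q'' = l^2 q (q^2 - 4), q (-1) = 2, q (1) = -2. This equation
has the first integral q'^2 = l^2 (P (q) + C) with P (q) = (4 - q^2)^2 / 2, so q
is obtained by inverting a primitive of (P + C)^(-1/2), and C is fixed by the
length of the interval. Inverting the length as a function of C makes C, and
then q, differentiable in l; all the functions that appear on differentiating
lie in an algebra stable under both derivations (smooth_fun), which gives a
smooth curve in H^1 defined for every l > 0 (chi_smooth).

The second variation in the directions (h1, h2) is diagonal along this branch.
Its h2 part is positive because the linearised equation has the positive
solution - q' (jacobi_lower_bound); this bounds nu below by a positive quantity
that does not increase with l (nu_lower_bound, coer_anti). The same coercivity
leaves no other critical point of H^ee near chi. For small l the critical
point is unique, since the Dirichlet energy dominates the non-convexity of the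
potential (small_unique). Hence any branch coincides with chi by continuation
(branch_eq_chi), and nu cannot tend to 0 at a finite end point
(branch_infinite).

It remains to study mu l = 2 E / l^2, where E is the lowest Dirichlet eigenvalue
of - d^2/dx^2 + U with U = l^2 (q^2 - 4). The ground state phi is found by
shooting (ground_state), and comparing the Rayleigh quotients of two ground
states shows that E' = int U_l phi^2 / int phi^2, where U_l is the parameter
derivative (ground_increment, dv_elow). The rescaling part of U_l is handled by
Pohozaev's identity and contributes a negative multiple of phi' (1)^2; the other
part is q times an odd increasing function of q, multiplied by dC/dl < 0. So mu
decreases strictly (delow_lt). It is positive for small l by the Poincare
inequality, and the test function 4 - q^2 makes it negative for large l
(elow_neg): when C is small, the energy 2 l^2 int (C h - q^2 h^2) of h = 4 - q^2
is negative, because q^2 h^2 contributes at least a constant over l while C l^2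
stays bounded. *)

(** * One-variable calculus *)

Definition dv (R : realType) (f : R -> R) (x d : R) : Prop :=
  is_derive x (1 : R) f d.

Section OneVariableCalculus.
Context {R : realType}.
Implicit Types (f g : R -> R) (x y a b c d K del : R).

(** Remainders in the parameter are always bounded quadratically below; this
is how they become derivatives. *)
Lemma dv_quad f x d K del : 0 < del ->
  (forall t, `|t| < del -> `|f (x + t) - f x - t * d| <= K * t ^+ 2) ->
  dv f x d.
Proof.
move=> del0 H.
have K0 : 0 <= K.
  have := H (del / 2); rewrite gtr0_norm ?divr_gt0// ltr_pdivrMr// ltr_pMr//.
  rewrite ltr1n => /(_ isT) /(le_trans (normr_ge0 _)).
  by rewrite pmulr_lge0// exprn_gt0// divr_gt0.
have L : h^-1 *: (f (h *: 1 + x) - f x) @[h --> 0^'] --> d.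
  apply/cvgrPdist_le => e e0; near=> h.
  have h0 : h != 0 by near: h; exact: nbhs_dnbhs_neq.
  have hd : `|h| < del by near: h; exact: dnbhs0_lt.
  have hK : `|h| <= e / (K + 1).
    by near: h; apply: dnbhs0_le; rewrite divr_gt0// ltr_wpDl.
  rewrite [h *: 1](_ : _ = h); last exact: mulr1.
  have -> : d - h^-1 *: (f (h + x) - f x) = - (h^-1 * (f (x + h) - f x - h * d)).
    by rewrite addrC /GRing.scale/= addrC [h + x]addrC; field.
  rewrite normrN normrM normfV ler_pdivrMl ?normr_gt0//.
  apply: (le_trans (H _ hd)).
  have -> : h ^+ 2 = `|h| * `|h| by rewrite -normrM -expr2 ger0_norm ?sqr_ge0.
  rewrite [`|h| * e]mulrC mulrA.
  apply: ler_wpM2r => //.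
  have K1 : 0 < K + 1 by rewrite ltr_wpDl.
  apply: (@le_trans _ _ ((K + 1) * `|h|)); first by rewrite ler_wpM2r// lerDl.
  by rewrite mulrC -ler_pdivlMr.
split; first by apply/cvg_ex; exists d.
by apply/cvg_lim => //; exact: Rhausdorff.
Unshelve. all: by end_near. Qed.

Lemma dv_cont f x d : dv f x d -> {for x, continuous f}.
Proof. by case=> df _; apply/differentiable_continuous/derivable1_diffP. Qed.

Lemma dv_eq f x d d' : dv f x d -> d = d' -> dv f x d'.
Proof. by move=> ? <-. Qed.

Lemma dv_ext f g x d : (forall y, f y = g y) -> dv f x d -> dv g x d.
Proof. by move=> /funext ->. Qed.

Lemma dv_cst c x : dv (fun=> c) x 0.
Proof. exact: is_derive_cst. Qed.

Lemma dv_id x : dv (fun y => y) x 1.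
Proof. exact: is_derive_id. Qed.

Lemma dvD f g x a b : dv f x a -> dv g x b -> dv (fun y => f y + g y) x (a + b).
Proof. by move=> ? ?; exact: is_deriveD. Qed.

Lemma dvN f x a : dv f x a -> dv (fun y => - f y) x (- a).
Proof. by move=> ?; exact: is_deriveN. Qed.

Lemma dvB f g x a b : dv f x a -> dv g x b -> dv (fun y => f y - g y) x (a - b).
Proof. by move=> ? ?; exact: is_deriveB. Qed.

Lemma dvM f g x a b :
  dv f x a -> dv g x b -> dv (fun y => f y * g y) x (a * g x + f x * b).
Proof.
move=> ? ?; apply: (@dv_eq _ _ (f x *: b + g x *: a)); first exact: is_deriveM.
by rewrite addrC [g x *: _]mulrC.
Qed.

Lemma dvZ c f x a : dv f x a -> dv (fun y => c * f y) x (c * a).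
Proof. by move=> ?; exact: is_deriveZ. Qed.

Lemma dvX n f x a :
  dv f x a -> dv (fun y => f y ^+ n.+1) x (n.+1%:R * f x ^+ n * a).
Proof.
by move=> fa; have := is_deriveX n.+1 fa; rewrite exprfctE.
Qed.

Lemma dvV f x a : f x != 0 -> dv f x a ->
  dv (fun y => (f y)^-1) x (- a / f x ^+ 2).
Proof.
move=> f0 ?; apply: (@dv_eq _ _ (- f x ^- 2 *: a)); first exact: is_deriveV.
by rewrite /GRing.scale/= mulrC mulrN mulNr.
Qed.

Lemma dv_comp f g x a b :
  dv f (g x) a -> dv g x b -> dv (fun y => f (g y)) x (a * b).
Proof. by move=> ? ?; exact: is_derive1_comp. Qed.

Lemma dv_continuous f g : (forall x, dv f x (g x)) -> continuous f.
Proof. by move=> H x; exact: (dv_cont (H x)). Qed.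

Lemma continuousD' f g : continuous f -> continuous g ->
  continuous (fun y => f y + g y).
Proof. by move=> cf cg x; apply: cvgD; [exact: cf|exact: cg]. Qed.

Lemma continuousN' f : continuous f -> continuous (fun y => - f y).
Proof. by move=> cf x; apply: cvgN; exact: cf. Qed.

Lemma continuousB' f g : continuous f -> continuous g ->
  continuous (fun y => f y - g y).
Proof. by move=> cf cg x; apply: cvgB; [exact: cf|exact: cg]. Qed.

Lemma continuousM' f g : continuous f -> continuous g ->
  continuous (fun y => f y * g y).
Proof. by move=> cf cg x; apply: cvgM; [exact: cf|exact: cg]. Qed.

Lemma continuousX' n f : continuous f -> continuous (fun y => f y ^+ n).
Proof.
by move=> cf x; apply: (@continuous_comp _ _ _ f (fun z => z ^+ n));
  [exact: cf|exact: exprn_continuous].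
Qed.

Lemma continuous_cst' c : continuous (fun _ : R => c).
Proof. by move=> x; exact: cvg_cst. Qed.

Lemma continuous_id' : continuous (fun x : R => x).
Proof. by move=> x; exact: cvg_id. Qed.

Lemma continuous_comp' f g : continuous f -> continuous g ->
  continuous (fun y => f (g y)).
Proof. by move=> cf cg x; apply: continuous_comp; [exact: cg|exact: cf]. Qed.

End OneVariableCalculus.

(** Continuity of an expression follows its syntax; the leaves are the
continuous functions of the context. *)
Ltac cts := lazymatch goal with
  | |- continuous (fun _ => ?cc) => exact: continuous_cst'
  | |- continuous (fun x => x) => exact: continuous_id'
  | |- continuous (fun x => @?ff x + @?gg x) =>
      refine (@continuousD' _ ff gg _ _); cts
  | |- continuous (fun x => - @?ff x) => refine (@continuousN' _ ff _); cts
  | |- continuous (fun x => @?ff x * @?gg x) =>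
      refine (@continuousM' _ ff gg _ _); cts
  | |- continuous (fun x => @?ff x ^+ ?nn) => refine (@continuousX' _ nn ff _); cts
  | _ => try eassumption
  end.

Section Primitives.
Context {R : realType}.
Implicit Types (f g : R -> R) (x y a b c d K del : R).

Lemma cont_within f a b : continuous f -> {within `[a, b], continuous f}.
Proof. by move=> cf; apply: continuous_subspaceT. Qed.


Lemma mvt f g a b : a <= b -> {within `[a, b], continuous f} ->
  (forall x, a < x < b -> dv f x (g x)) ->
  exists2 c, a <= c <= b & f b - f a = g c * (b - a).
Proof.
move=> ab cf fg; have [|c] := @MVT_segment R f g a b ab _ cf.
  by move=> x; rewrite in_itv /=; exact: fg.
by rewrite in_itv /= => cab ->; exists c.
Qed.

Lemma dv0_eq f a b : a <= b -> {within `[a, b], continuous f} ->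
  (forall x, a < x < b -> dv f x 0) -> f b = f a.
Proof.
move=> ab cf f0; have [c _] := @mvt f (fun=> 0) a b ab cf f0.
by rewrite mul0r => /eqP; rewrite subr_eq0 => /eqP.
Qed.

Lemma dv_ge0_le f g a b : a <= b -> {within `[a, b], continuous f} ->
  (forall x, a < x < b -> dv f x (g x)) ->
  (forall x, a <= x <= b -> 0 <= g x) -> f a <= f b.
Proof.
move=> ab cf fg g0; have [c cab] := mvt ab cf fg.
by move=> /eqP; rewrite subr_eq => /eqP ->; rewrite lerDr mulr_ge0 ?subr_ge0 ?g0.
Qed.

Lemma primitive_exists f : continuous f ->
  exists F, F 0 = 0 /\ forall x, dv F x (f x).
Proof.
move=> cf.
pose G b x := \int[@lebesgue_measure R]_(t in `[- b, x]) f t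
  - \int[@lebesgue_measure R]_(t in `[- b, 0]) f t.
have dG b x : `|x| < b -> dv (G b) x (f x).
  rewrite ltr_norml => /andP[bx xb].
  have intf : (@lebesgue_measure R).-integrable `[- b, b] (EFin \o f).
    apply: continuous_compact_integrable; first exact: segment_compact.
    exact: cont_within.
  have [df f1] := continuous_FTC1_closed xb intf bx (cf x).
  rewrite -[f x]subr0; apply: dvB; last exact: dv_cst.
  by apply: DeriveDef; [exact: df|rewrite -derive1E; exact: f1].
have G0 b : G b 0 = 0 by rewrite /G subrr.
have GG b b' x : 0 < b -> `|x| < b -> b <= b' -> G b x = G b' x.
  move=> b0 xb bb'.
  have dd y : `|y| < b -> dv (fun z => G b z - G b' z) y 0.
    move=> yb; rewrite -(subrr (f y)); apply: dvB; first exact: dG.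
    by apply: dG; exact: lt_le_trans bb'.
  have wc u v : `|u| < b -> `|v| < b ->
      {within `[u, v], continuous (fun z => G b z - G b' z)}.
    move=> ub vb; apply: continuous_in_subspaceT => y.
    rewrite inE /= in_itv /= => /andP[uy yv].
    by apply: dv_cont; apply: dd; move: ub vb; rewrite !ltr_norml; lra.
  have z0 : `|0 : R| < b by rewrite normr0.
  apply/eqP; rewrite -subr_eq0 -(subrr (G b 0)) [X in _ == _ - X](_ : _ = G b' 0);
    last by rewrite !G0.
  apply/eqP; have [x0|x0] := leP 0 x.
    apply: (dv0_eq x0 (wc _ _ z0 xb)) => y yb; apply: dd.
    by move: xb; rewrite !ltr_norml; lra.
  apply/esym/(dv0_eq (ltW x0) (wc _ _ xb z0)) => y yb; apply: dd.
  by move: xb; rewrite !ltr_norml; lra.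
exists (fun x => G (`|x| + 1) x); split => [|x]; first exact: G0.
have {}dG : dv (G (`|x| + 2)) x (f x) by apply: dG; rewrite ltrDl.
apply: near_eq_is_derive dG.
near=> y; apply/esym/GG.
- by rewrite ltr_wpDl.
- by rewrite ltrDl.
- have : `|x - y| <= 1 by near: y; apply: cvgr_dist_le.
  by have := lerB_dist y x; rewrite distrC; lra.
Unshelve. all: by end_near. Qed.

(** The primitive vanishing at 0 of a continuous function. Oriented integrals
are differences of its values, so that estimates on them come from the mean
value theorem rather than from measure theory. *)
Definition prim f : R -> R :=
  xget (fun=> 0) [set F : R -> R | F 0 = 0 /\ forall x, dv F x (f x)].

Lemma primP f : continuous f -> prim f 0 = 0 /\ forall x, dv (prim f) x (f x).
Proof.
move=> /primitive_exists[F HF]; rewrite /prim; case: xgetP => [y _ //|].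
by move=> /(_ F).
Qed.

Lemma prim0 f : continuous f -> prim f 0 = 0.
Proof. by case/primP. Qed.

Lemma dv_prim f x : continuous f -> dv (prim f) x (f x).
Proof. by case/primP. Qed.

Lemma continuous_prim f : continuous f -> continuous (prim f).
Proof. by move=> cf; apply: dv_continuous => x; exact: dv_prim. Qed.

Lemma primE f F a b : continuous f -> a <= b -> {within `[a, b], continuous F} ->
  (forall x, a < x < b -> dv F x (f x)) -> prim f b - prim f a = F b - F a.
Proof.
move=> cf ab cF dF.
have cp : {within `[a, b], continuous (prim f)}.
  exact/cont_within/continuous_prim.
have cw : {within `[a, b], continuous (fun x => prim f x - F x)}.
  by move=> x; apply: cvgB; [exact: cp|exact: cF].
have : prim f b - F b = prim f a - F a.
  apply: (dv0_eq ab cw) => x xab; rewrite -(subrr (f x)).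
  by apply: dvB; [exact: dv_prim|exact: dF].
by move=> /eqP; rewrite subr_eq => /eqP ->; ring.
Qed.

Lemma primEg f F a b : continuous f -> (forall x, dv F x (f x)) ->
  prim f b - prim f a = F b - F a.
Proof.
move=> cf dF; have cF a' b' : {within `[a', b'], continuous F}.
  exact/cont_within/(dv_continuous dF).
have [ab|/ltW ab] := leP a b; first exact: primE.
by apply: oppr_inj; rewrite !opprB; exact: primE.
Qed.

Lemma prim_ge0 f a b : continuous f -> a <= b ->
  (forall x, a <= x <= b -> 0 <= f x) -> prim f a <= prim f b.
Proof.
move=> cf ab f0; apply: (dv_ge0_le ab _ _ f0); first exact/cont_within/continuous_prim.
by move=> x _; exact: dv_prim.
Qed.

Lemma primD f g x : continuous f -> continuous g ->
  prim (fun y => f y + g y) x = prim f x + prim g x.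
Proof.
move=> cf cg; have cfg : continuous (fun y => f y + g y) by cts.
have := @primEg (fun y => f y + g y) (fun y => prim f y + prim g y) 0 x cfg.
rewrite !prim0// addr0 !subr0; apply=> y.
by apply: dvD; exact: dv_prim.
Qed.

Lemma primZ c f x : continuous f -> prim (fun y => c * f y) x = c * prim f x.
Proof.
move=> cf; have ccf : continuous (fun y => c * f y) by cts.
have := @primEg (fun y => c * f y) (fun y => c * prim f y) 0 x ccf.
rewrite !prim0// mulr0 !subr0; apply=> y.
by apply: dvZ; exact: dv_prim.
Qed.

Lemma primN f x : continuous f -> prim (fun y => - f y) x = - prim f x.
Proof.
move=> cf; rewrite -mulN1r -primZ//; congr (prim _ x).
by apply/funext => y; rewrite mulN1r.
Qed.

Lemma primB f g x : continuous f -> continuous g ->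
  prim (fun y => f y - g y) x = prim f x - prim g x.
Proof. by move=> cf cg; rewrite primD ?primN//; exact: continuousN'. Qed.

Lemma prim_cst c x : prim (fun=> c) x = c * x.
Proof.
have := @primEg (fun=> c) (fun y => c * y) 0 x.
rewrite prim0; last by cts.
rewrite mulr0 !subr0; apply => [|y]; first by cts.
rewrite -[X in dv _ _ X]mulr1; by apply: dvZ; exact: dv_id.
Qed.

Lemma prim_le f g a b : continuous f -> continuous g -> a <= b ->
  (forall x, a <= x <= b -> f x <= g x) ->
  prim f b - prim f a <= prim g b - prim g a.
Proof.
move=> cf cg ab fg; rewrite -subr_ge0.
have -> : prim g b - prim g a - (prim f b - prim f a) =
  prim (fun y => g y - f y) b - prim (fun y => g y - f y) a.
  by rewrite !primB//; ring.
rewrite subr_ge0; apply: prim_ge0 => //; first exact: continuousB'.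
by move=> x xab; rewrite subr_ge0 fg.
Qed.

Lemma prim_le_cst f M a b : continuous f -> a <= b ->
  (forall x, a <= x <= b -> `|f x| <= M) ->
  `|prim f b - prim f a| <= M * (b - a).
Proof.
move=> cf ab fM.
rewrite ler_norml; apply/andP; split.
  have -> : - (M * (b - a)) = prim (fun=> - M) b - prim (fun=> - M) a.
    by rewrite !prim_cst; ring.
  by apply: prim_le => // [|x /fM]; [cts|rewrite ler_norml => /andP[]].
have -> : M * (b - a) = prim (fun=> M) b - prim (fun=> M) a.
  by rewrite !prim_cst; ring.
by apply: prim_le => // [|x /fM]; [cts|rewrite ler_norml => /andP[]].
Qed.

Lemma continuous_pos_near f c : continuous f -> 0 < f c ->
  exists2 d : R, 0 < d & forall x, `|x - c| <= d -> f c / 2 <= f x.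
Proof.
move=> cf fc; have := cf c => /cvgrPdist_le /(_ (f c / 2)).
rewrite divr_gt0// => /(_ isT) /nbhs_normP[d /= d0 H].
exists (d / 2); first by rewrite divr_gt0.
move=> x xc; have : `|f c - f x| <= f c / 2.
  by apply: H; rewrite /= distrC (le_lt_trans xc)// ltr_pdivrMr// ltr_pMr// ltr1n.
by rewrite ler_norml; lra.
Qed.

(** A continuous nonnegative function that is positive somewhere is bounded
below by a positive constant on a subinterval. *)
Lemma prim_gt0 f a b c : continuous f -> a < b -> a <= c <= b ->
  (forall x, a <= x <= b -> 0 <= f x) -> 0 < f c -> prim f a < prim f b.
Proof.
move=> cf ab /andP[ac cb] f0 fc; have [d d0 fd] := continuous_pos_near cf fc.
pose u := Num.max a (c - d); pose v := Num.min b (c + d).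
have au : a <= u by rewrite le_max lexx.
have vb : v <= b by rewrite ge_min lexx.
have cu : c - d <= u by rewrite le_max lexx orbT.
have vc : v <= c + d by rewrite ge_min lexx orbT.
have uc : u <= c by rewrite ge_max ac; lra.
have cv : c <= v by rewrite le_min cb; lra.
have uv : u < v.
  by rewrite gt_max !lt_min ab; apply/andP; split; apply/andP; split; lra.
have h1 : prim f a <= prim f u.
  by apply: prim_ge0 => // x xx; apply: f0; lra.
have h2 : prim f v <= prim f b.
  by apply: prim_ge0 => // x xx; apply: f0; lra.
have h3 : f c / 2 * (v - u) <= prim f v - prim f u.
  have -> : f c / 2 * (v - u) = prim (fun=> f c / 2) v - prim (fun=> f c / 2) u.
    by rewrite !prim_cst; ring.
  apply: prim_le => //; [exact: continuous_cst'|exact: ltW|].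
  by move=> x xx; apply: fd; rewrite ler_norml; lra.
have : 0 < f c / 2 * (v - u) by rewrite mulr_gt0 ?divr_gt0 ?subr_gt0.
lra.
Qed.

Lemma continuous_integrable f a b : continuous f ->
  (@lebesgue_measure R).-integrable `[a, b] (EFin \o f).
Proof.
move=> cf; apply: continuous_compact_integrable; first exact: segment_compact.
exact: cont_within.
Qed.

Lemma Rintegral_prim f a b : continuous f -> a <= b ->
  \int[@lebesgue_measure R]_(t in `[a, b]) f t = prim f b - prim f a.
Proof.
move=> cf; rewrite le_eqVlt => /predU1P[->|ab].
  by rewrite subrr set_itv1 Rintegral_set1.
rewrite /Rintegral (@continuous_FTC2 _ f (prim f))//; first exact: cont_within.
  have cp := continuous_prim cf.
  split; [by move=> x _; have [] := dv_prim x cf| |].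
    exact/cvg_at_right_filter/cp.
  exact/cvg_at_left_filter/cp.
by move=> x _; rewrite derive1E; have [] := dv_prim x cf.
Qed.

Lemma itg_prim f g : continuous g -> (forall x, -1 <= x <= 1 -> f x = g x) ->
  itg f = prim g 1 - prim g (-1).
Proof.
move=> cg fg; have le11 : (-1 : R) <= 1 by lra.
rewrite /itg -(Rintegral_prim cg le11).
by apply: eq_Rintegral => x; rewrite inE /= in_itv /=; exact: fg.
Qed.

Lemma continuous_bounded f a b : a <= b -> continuous f ->
  exists2 M : R, 0 <= M & forall x, a <= x <= b -> `|f x| <= M.
Proof.
move=> ab cf; have cn : {within `[a, b], continuous (fun x => `|f x|)}.
  by apply: cont_within => x; apply: cvg_norm; exact: cf.
have [c _ H] := EVT_max ab cn; by exists `|f c|.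
Qed.

Lemma continuous_lbound f a b : a <= b -> continuous f ->
  (forall x, a <= x <= b -> 0 < f x) ->
  exists2 m : R, 0 < m & forall x, a <= x <= b -> m <= f x.
Proof.
move=> ab cf f0; have [c cab H] := EVT_min ab (cont_within cf (a:=a) (b:=b)).
exists (f c); first by apply: f0; move: cab; rewrite in_itv.
by move=> x xab; apply: H; rewrite in_itv.
Qed.

End Primitives.

(** * Integration on [-1, 1] *)

Section SquareIntegrable.
Context {R : realType}.
Notation mu := (@lebesgue_measure R).
Notation I11 := (`[-1, 1]%classic : set R).
Implicit Types (f g h : R -> R) (x y a b c K M : R).

Definition itgb f : Prop := mu.-integrable I11 (EFin \o f).

Lemma measurable_I11 : measurable I11.
Proof. exact: measurable_itv. Qed.
Hint Resolve measurable_I11 : core.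

Lemma itgb_meas f : itgb f -> measurable_fun I11 f.
Proof. by move=> /measurable_int/measurable_EFinP. Qed.

Lemma itgb_dom f g : measurable_fun I11 f -> itgb g ->
  (forall x, -1 <= x <= 1 -> `|f x| <= g x) -> itgb f.
Proof.
move=> mf ig fg; apply: (@le_integrable _ _ _ mu I11 _ _ (EFin \o g)) => //.
  exact/measurable_EFinP.
move=> x /=; rewrite in_itv /= => x11; rewrite lee_fin.
by rewrite (le_trans (fg x x11)) ?ler_norm.
Qed.

Lemma itgb_ext f g : (forall x, -1 <= x <= 1 -> f x = g x) -> itgb f -> itgb g.
Proof.
move=> fg; apply: eq_integrable => // x; rewrite inE /= in_itv /= => x11.
by rewrite /= fg.
Qed.

Lemma itgbD f g : itgb f -> itgb g -> itgb (fun x => f x + g x).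
Proof. by move=> ? ?; exact: (@integrableD _ _ _ mu I11 _ (EFin \o f) (EFin \o g)). Qed.

Lemma itgbB f g : itgb f -> itgb g -> itgb (fun x => f x - g x).
Proof. by move=> ? ?; exact: (@integrableB _ _ _ mu I11 _ (EFin \o f) (EFin \o g)). Qed.

Lemma itgbZ c f : itgb f -> itgb (fun x => c * f x).
Proof. by move=> ?; exact: (@integrableZl _ _ _ mu I11 _ c (EFin \o f)). Qed.

Lemma itgb_cont f : continuous f -> itgb f.
Proof. exact: continuous_integrable. Qed.

Lemma meas_cont f : continuous f -> measurable_fun I11 f.
Proof. by move=> /itgb_cont /itgb_meas. Qed.

Lemma measM f g : measurable_fun I11 f -> measurable_fun I11 g ->
  measurable_fun I11 (fun x => f x * g x).
Proof. by move=> ? ?; exact: measurable_funM. Qed.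

Lemma itgD f g : itgb f -> itgb g -> itg (fun x => f x + g x) = itg f + itg g.
Proof. by move=> ? ?; exact: RintegralD. Qed.

Lemma itgB f g : itgb f -> itgb g -> itg (fun x => f x - g x) = itg f - itg g.
Proof. by move=> ? ?; exact: RintegralB. Qed.

Lemma itgZ c f : itgb f -> itg (fun x => c * f x) = c * itg f.
Proof. by move=> ?; exact: RintegralZl. Qed.

Lemma itg_le f g : itgb f -> itgb g ->
  (forall x, -1 <= x <= 1 -> f x <= g x) -> itg f <= itg g.
Proof.
move=> ? ? fg; apply: le_Rintegral => // x; rewrite /= in_itv; exact: fg.
Qed.

Lemma itg_ext f g : (forall x, -1 <= x <= 1 -> f x = g x) -> itg f = itg g.
Proof.
by move=> fg; apply: eq_Rintegral => x; rewrite inE /= in_itv; exact: fg.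
Qed.

Lemma itg_ge0 f : (forall x, -1 <= x <= 1 -> 0 <= f x) -> 0 <= itg f.
Proof.
by move=> f0; apply: Rintegral_ge0 => x; rewrite /= in_itv; exact: f0.
Qed.

Lemma itg_cst c : itg (fun=> c) = c * 2.
Proof.
rewrite (@itg_prim _ _ (fun=> c))//; last exact: continuous_cst'.
by rewrite !prim_cst; ring.
Qed.

Lemma L2_meas g : square_integrable g -> measurable_fun I11 g.
Proof. by case. Qed.

Lemma L2_sq g : square_integrable g -> itgb (fun x => g x ^+ 2).
Proof. by case. Qed.

Lemma L2_mul f g : square_integrable f -> square_integrable g ->
  itgb (fun x => f x * g x).
Proof.
move=> [mf f2] [mg g2]; apply: (itgb_dom (measM mf mg) (itgbD f2 g2)) => x _.
have h1 : 0 <= (f x + g x) ^+ 2 by exact: sqr_ge0.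
have h2 : 0 <= (f x - g x) ^+ 2 by exact: sqr_ge0.
have h3 : 0 <= f x ^+ 2 by exact: sqr_ge0.
have h4 : 0 <= g x ^+ 2 by exact: sqr_ge0.
by rewrite ler_norml; nra.
Qed.

Lemma L2_cont f : continuous f -> square_integrable f.
Proof.
move=> cf; split; first exact: meas_cont.
by apply: itgb_cont; exact: continuousX'.
Qed.

Lemma L2_int g : square_integrable g -> itgb g.
Proof.
move=> g2; have c1 : square_integrable (fun _ : R => 1).
  by apply: L2_cont; exact: continuous_cst'.
by apply: itgb_ext (L2_mul c1 g2) => x _; rewrite mul1r.
Qed.

Lemma L2_ext f g : (forall x, f x = g x) -> square_integrable f -> square_integrable g.
Proof. by move=> /funext ->. Qed.

Lemma L2D f g : square_integrable f -> square_integrable g ->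
  square_integrable (fun x => f x + g x).
Proof.
move=> f2 g2; split.
  by apply: itgb_meas; apply: itgbD; exact: L2_int.
have := itgbD (itgbD (L2_sq f2) (L2_sq g2)) (itgbZ 2 (L2_mul f2 g2)).
by apply: itgb_ext => x _; ring.
Qed.

Lemma L2Z c g : square_integrable g -> square_integrable (fun x => c * g x).
Proof.
move=> g2; split; first by apply: itgb_meas; apply: itgbZ; exact: L2_int.
have := itgbZ (c ^+ 2) (L2_sq g2).
by apply: itgb_ext => x _; ring.
Qed.

Lemma L2_cmul f g : continuous f -> square_integrable g ->
  square_integrable (fun x => f x * g x).
Proof.
move=> cf g2; split; first by apply: measM; [exact: meas_cont|exact: L2_meas].
have le11 : (-1 : R) <= 1 by lra.
have [M M0 HM] := continuous_bounded le11 cf.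
apply: (itgb_dom _ (itgbZ (M ^+ 2) (L2_sq g2))).
  apply: (@measurable_funX _ _ _ _ (fun x => f x * g x)).
  by apply: measM; [exact: meas_cont|exact: L2_meas].
move=> x x11; rewrite ger0_norm ?sqr_ge0// exprMn ler_wpM2r ?sqr_ge0//.
by rewrite -[f x ^+ 2]ger0_norm ?sqr_ge0// normrX lerXn2r ?nnegrE// HM.
Qed.

End SquareIntegrable.

(** * Sobolev functions on [-1, 1] *)

Section WeakDerivative.
Context {R : realType}.
Notation mu := (@lebesgue_measure R).
Notation I11 := (`[-1, 1]%classic : set R).
Implicit Types (f g h : R -> R) (x y a b c u v K M : R).

Lemma itgb_sub f u v : itgb f -> -1 <= u -> v <= 1 ->
  mu.-integrable `[u, v] (EFin \o f).
Proof.
move=> If u1 v1; apply: integrableS If => //.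
by move=> x /=; rewrite !in_itv /=; lra.
Qed.

Lemma Rint_split f u v : itgb f -> -1 <= u <= v -> v <= 1 ->
  \int[mu]_(t in `[-1, v]) f t =
  \int[mu]_(t in `[-1, u]) f t + \int[mu]_(t in `[u, v]) f t.
Proof.
move=> If /andP[u1 uv] v1.
have Iv : mu.-integrable `[-1, v] (EFin \o f) by exact: itgb_sub.
have := @Rintegral_itvB _ f (BLeft (-1)) (BRight v) u Iv.
rewrite !bnd_simp u1 => /(_ isT uv) h.
rewrite -Rintegral_itv_obnd_cbnd -?h; first by ring.
apply: integrableS Iv => // x /=; rewrite !in_itv /=; lra.
Qed.

Lemma wd_diff f g x y : weak_derivative f g -> -1 <= x <= y -> y <= 1 ->
  f y - f x = \int[mu]_(t in `[x, y]) g t.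
Proof.
move=> [g2 fg] /andP[x1 xy] y1.
rewrite (fg y); last lra.
rewrite (fg x); last lra.
rewrite (@Rint_split g x y); [ring|exact: L2_int|lra|lra].
Qed.

Lemma cauchy_schwarz_itv g u v : square_integrable g -> -1 <= u <= v -> v <= 1 ->
  (\int[mu]_(t in `[u, v]) g t) ^+ 2 <=
  (v - u) * \int[mu]_(t in `[u, v]) (g t ^+ 2).
Proof.
move=> g2 /andP[u1]; rewrite le_eqVlt => /predU1P[->|uv] v1.
  by rewrite set_itv1 !Rintegral_set1 expr0n subrr mul0r.
have muv : measurable (`[u, v]%classic : set R) by [].
have Ig : mu.-integrable `[u, v] (EFin \o g).
  by apply: itgb_sub => //; exact: L2_int.
have Ig2 : mu.-integrable `[u, v] (EFin \o (fun t => g t ^+ 2)).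
  by apply: itgb_sub => //; exact: L2_sq.
have Ic k : mu.-integrable `[u, v] (EFin \o (fun=> k : R)).
  by apply: continuous_integrable; exact: continuous_cst'.
set m := \int[mu]_(t in _) g t; set s := \int[mu]_(t in _) _.
pose l := v - u; have l0 : 0 < l by rewrite subr_gt0.
(* the integral of the squared deviation from the mean is s - m^2 / l *)
have : 0 <= \int[mu]_(t in `[u, v]) (g t - m / l) ^+ 2.
  by apply: Rintegral_ge0 => t _; exact: sqr_ge0.
have -> : \int[mu]_(t in `[u, v]) (g t - m / l) ^+ 2 =
    \int[mu]_(t in `[u, v]) ((g t ^+ 2 - (2 * (m / l)) * g t) + (m / l) ^+ 2).
  by apply: eq_Rintegral => t _; ring.
have I1 : mu.-integrable `[u, v] (EFin \o (fun t => (2 * (m / l)) * g t)).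
  exact: (@integrableZl _ _ _ mu _ _ _ (EFin \o g)).
have I2 : mu.-integrable `[u, v]
    (EFin \o (fun t => g t ^+ 2 - (2 * (m / l)) * g t)).
  exact: (@integrableB _ _ _ mu _ muv (EFin \o (fun t => g t ^+ 2))
    (EFin \o (fun t => 2 * (m / l) * g t))).
rewrite RintegralD// RintegralB// RintegralZl// -/m -/s.
have -> : \int[mu]_(t in `[u, v]) ((m / l) ^+ 2) = (m / l) ^+ 2 * l.
  rewrite Rintegral_prim ?prim_cst; [|exact: continuous_cst'|exact: ltW].
  by rewrite /l; ring.
have -> : s - 2 * (m / l) * m + (m / l) ^+ 2 * l = s - m ^+ 2 / l.
  by field; rewrite gt_eqF.
by rewrite subr_ge0 ler_pdivrMr// mulrC.
Qed.

Lemma Rint_sub_le f u v : itgb f -> (forall t, -1 <= t <= 1 -> 0 <= f t) ->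
  -1 <= u <= v -> v <= 1 -> \int[mu]_(t in `[u, v]) f t <= itg f.
Proof.
move=> If f0 uv v1.
have h3 : 0 <= \int[mu]_(t in `[-1, u]) f t.
  by apply: Rintegral_ge0 => t; rewrite /= in_itv /= => tu; apply: f0; lra.
have h4 : 0 <= \int[mu]_(t in `[v, 1]) f t.
  by apply: Rintegral_ge0 => t; rewrite /= in_itv /= => tu; apply: f0; lra.
have h1 := Rint_split If uv v1.
have le11 : -1 <= v <= 1 by clear h1; lra.
have h2 := Rint_split If le11 (lexx 1).
by rewrite /itg h2 h1 addrAC lerDr addr_ge0.
Qed.

Lemma wd_holder f g x y : weak_derivative f g -> -1 <= x <= 1 -> -1 <= y <= 1 ->
  (f y - f x) ^+ 2 <= `|y - x| * itg (fun t => g t ^+ 2).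
Proof.
move=> fg; wlog xy : x y / x <= y => [hw x1 y1|x1 y1].
  have [xy|/ltW yx] := leP x y; first exact: hw.
  by rewrite -sqrrN opprB distrC; exact: hw.
have g2 : square_integrable g by case: fg.
rewrite (wd_diff fg); [|lra|lra].
apply: (le_trans (cauchy_schwarz_itv g2 _ _)); [lra|lra|].
rewrite ger0_norm ?subr_ge0// ler_wpM2l ?subr_ge0//.
by apply: Rint_sub_le; [exact: L2_sq|move=> *; exact: sqr_ge0|lra|lra].
Qed.

(** The retraction onto [-1, 1] turns functions known only there into
functions that are continuous on the whole line. *)
Definition clamp x : R := Num.max (-1) (Num.min x 1).

Lemma clamp_id x : -1 <= x <= 1 -> clamp x = x.
Proof. by move=> /andP[x1 x2]; rewrite /clamp min_l// max_r. Qed.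

Lemma clamp_in x : -1 <= clamp x <= 1.
Proof.
rewrite /clamp le_max lexx /= ge_max ge_min lexx orbT andbT.
by lra.
Qed.

Lemma clamp_lip x y : `|clamp y - clamp x| <= `|y - x|.
Proof.
wlog xy : x y / x <= y => [hw|].
  have [|/ltW] := leP x y; first exact: hw.
  by move=> /hw; rewrite distrC [leRHS]distrC.
rewrite [leRHS]ger0_norm ?subr_ge0// /clamp ler_norml.
rewrite !maxEle !minEle; do !case: ifPn; rewrite -?ltNge; lra.
Qed.

Lemma wd_clamp_continuous f g : weak_derivative f g ->
  continuous (fun x => f (clamp x)).
Proof.
move=> fg x; apply/cvgrPdist_le => e e0.
pose N := itg (fun t => g t ^+ 2).
have N0 : 0 <= N by apply: itg_ge0 => t _; exact: sqr_ge0.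
have N1 : 0 < N + 1 by lra.
near=> y.
have xy : `|x - y| <= e ^+ 2 / (N + 1).
  by near: y; apply: cvgr_dist_le => //; rewrite divr_gt0 ?exprn_gt0.
rewrite -ler_sqr ?nnegrE//; last exact: ltW.
rewrite -normrX ger0_norm ?sqr_ge0//.
have := wd_holder fg (clamp_in y) (clamp_in x).
move=> /le_trans; apply; rewrite -/N.
apply: (@le_trans _ _ (`|x - y| * (N + 1))).
  apply: ler_pM => //; first exact: clamp_lip.
  by rewrite lerDl.
by rewrite -ler_pdivlMr.
Unshelve. all: by end_near. Qed.

Lemma wd_bounded f g : weak_derivative f g ->
  exists2 M : R, 0 <= M & forall x, -1 <= x <= 1 -> `|f x| <= M.
Proof.
move=> /wd_clamp_continuous cf; have le11 : (-1 : R) <= 1 by lra.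
have [M M0 H] := continuous_bounded le11 cf; exists M => // x x11.
by have := H x x11; rewrite clamp_id.
Qed.

Lemma wd_meas f g : weak_derivative f g -> measurable_fun I11 f.
Proof.
move=> /wd_clamp_continuous /itgb_cont cf.
by apply: itgb_meas; apply: itgb_ext cf => x /clamp_id ->.
Qed.

Lemma wdL2 f g : weak_derivative f g -> square_integrable f.
Proof.
move=> fg; split; first exact: wd_meas fg.
have cf : continuous (fun x => f (clamp x) ^+ 2).
  by apply: continuousX'; exact: wd_clamp_continuous fg.
by apply: itgb_ext (itgb_cont cf) => x /clamp_id ->.
Qed.

Lemma wdD f1 g1 f2 g2 : weak_derivative f1 g1 -> weak_derivative f2 g2 ->
  weak_derivative (fun x => f1 x + f2 x) (fun x => g1 x + g2 x).
Proof.
move=> [L1 H1] [L2 H2]; split; first exact: L2D.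
move=> x x11; rewrite H1// H2// RintegralD//; first ring.
- by apply: itgb_sub; [exact: L2_int|lra|lra].
- by apply: itgb_sub; [exact: L2_int|lra|lra].
Qed.

Lemma wdZ c f g : weak_derivative f g ->
  weak_derivative (fun x => c * f x) (fun x => c * g x).
Proof.
move=> [L H]; split; first exact: L2Z.
move=> x x11; rewrite H// RintegralZl//; first ring.
by apply: itgb_sub; [exact: L2_int|lra|lra].
Qed.

Lemma wdB f1 g1 f2 g2 : weak_derivative f1 g1 -> weak_derivative f2 g2 ->
  weak_derivative (fun x => f1 x - f2 x) (fun x => g1 x - g2 x).
Proof.
move=> w1 w2; have := wdD w1 (wdZ (-1) w2).
by congr weak_derivative; apply/funext => x; rewrite mulN1r.
Qed.

Lemma wd_prim f g G : continuous G -> square_integrable g ->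
  (forall x, -1 <= x <= 1 -> g x = G x) ->
  (forall x, -1 <= x <= 1 -> f x - f (-1) = prim G x - prim G (-1)) ->
  weak_derivative f g.
Proof.
move=> cG Lg gG fG; split=> // x x11.
have -> : \int[mu]_(t in `[-1, x]) g t = \int[mu]_(t in `[-1, x]) G t.
  by apply: eq_Rintegral => t; rewrite inE /= in_itv /= => tx; apply: gG; lra.
by rewrite Rintegral_prim//; [rewrite -fG//; ring|lra].
Qed.

Lemma wd_dv f g : continuous g -> continuous f ->
  (forall x, -1 < x < 1 -> dv f x (g x)) -> weak_derivative f g.
Proof.
move=> cg cf fg; apply: (wd_prim cg) => //; first exact: L2_cont.
move=> x x11; apply/esym/primE => //; [lra|exact: cont_within|].
by move=> t tx; apply: fg; lra.
Qed.

(** Bisection: a bound of this form, applied to ever finer subdivisions, sums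
to (y - x) (G y - G x) / 2 ^ n. *)
Lemma superadditive_bound_cst (P G : R -> R) :
  (forall x y, -1 <= x <= y -> y <= 1 -> `|P y - P x| <= (y - x) * (G y - G x)) ->
  forall x, -1 <= x <= 1 -> P x = P (-1).
Proof.
move=> H.
have Hn n : forall x y, -1 <= x <= y -> y <= 1 ->
    `|P y - P x| <= (y - x) * (G y - G x) / 2 ^+ n.
  elim: n => [|n IH] x y xy y1; first by rewrite expr0 divr1 H.
  pose m := (x + y) / 2.
  have xm : -1 <= x <= m by rewrite /m; lra.
  have m1 : m <= 1 by rewrite /m; lra.
  have my : -1 <= m <= y by rewrite /m; lra.
  have := lerD (IH _ _ xm m1) (IH _ _ my y1).
  have -> : m - x = (y - x) / 2 by rewrite /m; field.
  have -> : y - m = (y - x) / 2 by rewrite /m; field.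
  have h : `|P y - P x| <= `|P m - P x| + `|P y - P m|.
    have -> : P y - P x = (P m - P x) + (P y - P m) by ring.
    exact: ler_normD.
  move=> /(le_trans h) /le_trans; apply; rewrite exprS le_eqVlt; apply/orP; left.
  by apply/eqP; field; rewrite expf_neq0.
move=> x x11; have xx : (-1 : R) <= -1 <= x by rewrite lexx; case/andP: x11.
set K := (x - -1) * (G x - G (-1)).
have HK n : `|P x - P (-1)| <= K / 2 ^+ n by apply: Hn => //; lra.
apply/eqP; rewrite -subr_eq0 -normr_le0; apply/ler_addgt0Pl => e e0.
rewrite addr0; have K0 : 0 <= K.
  by have := HK 0%N; rewrite expr0 divr1; apply: le_trans.
have [n Kn] : exists n : nat, K / e <= n%:R.
  by exists (Num.bound (K / e)); apply/ltW/archi_boundP/divr_ge0 => //; exact: ltW.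
apply: (le_trans (HK n)); rewrite ler_pdivrMr ?exprn_gt0//.
rewrite ler_pdivrMr// in Kn; rewrite (le_trans Kn)// mulrC ler_wpM2l ?ltW//.
by rewrite -natrX ltr_nat ltn_expl.
Qed.


(** The product rule. On a short interval the two sides differ by a product
of two increments, each controlled by the Cauchy-Schwarz inequality. *)
Lemma wdM f1 g1 f2 g2 : weak_derivative f1 g1 -> weak_derivative f2 g2 ->
  weak_derivative (fun x => f1 x * f2 x) (fun x => g1 x * f2 x + f1 x * g2 x).
Proof.
move=> w1 w2; have L1 : square_integrable g1 by case: w1.
have L2 : square_integrable g2 by case: w2.
have Lc g f g' : square_integrable g -> weak_derivative f g' ->
    square_integrable (fun x => f x * g x).
  move=> Lg wf; have := L2_cmul (wd_clamp_continuous wf) Lg.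
  case=> mf If; split.
    have : itgb (fun x => f x * g x) by exact: L2_mul (wdL2 wf) Lg.
    exact: itgb_meas.
  by apply: itgb_ext If => x /clamp_id ->.
have Ls : square_integrable (fun x => g1 x * f2 x + f1 x * g2 x).
  apply: L2D; last exact: Lc w1.
  by apply: L2_ext (Lc _ _ _ L1 w2) => x; rewrite mulrC.
split=> //.
pose S x := \int[mu]_(t in `[-1, x]) (g1 t * f2 t + f1 t * g2 t).
pose P x := f1 x * f2 x - S x.
suff PE x : -1 <= x <= 1 -> P x = P (-1).
  move=> x /PE; rewrite /P {2}/S set_itv1 Rintegral_set1 subr0 => <-.
  by rewrite /S; ring.
pose G x := \int[mu]_(t in `[-1, x]) (g1 t ^+ 2 + g2 t ^+ 2).
have Ig : itgb (fun t => g1 t ^+ 2 + g2 t ^+ 2) by apply: itgbD; exact: L2_sq.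
apply: (@superadditive_bound_cst P (fun x => 2 * G x)) => {}x y xy y1.
have GE : G y - G x = \int[mu]_(t in `[x, y]) (g1 t ^+ 2 + g2 t ^+ 2).
  by rewrite /G (Rint_split Ig xy y1); ring.
have [x1 xy'] : -1 <= x /\ x <= y by case/andP: xy.
have Isub f : itgb f -> mu.-integrable `[x, y] (EFin \o f).
  by move=> If; exact: itgb_sub.
have mxy : measurable (`[x, y]%classic : set R) by [].
have IZ c f : mu.-integrable `[x, y] (EFin \o f) ->
    mu.-integrable `[x, y] (EFin \o (fun t => c * f t)).
  by move=> If; exact: (@integrableZl _ _ _ mu _ mxy c (EFin \o f)).
have ID f f' : mu.-integrable `[x, y] (EFin \o f) ->
    mu.-integrable `[x, y] (EFin \o f') ->
    mu.-integrable `[x, y] (EFin \o (fun t => f t + f' t)).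
  by move=> If If'; exact: (@integrableD _ _ _ mu _ mxy (EFin \o f) (EFin \o f')).
have PP : P y - P x = \int[mu]_(t in `[x, y])
    (g1 t * (f2 y - f2 t) + (f1 x - f1 t) * g2 t).
  have SE : S y - S x = \int[mu]_(t in `[x, y]) (g1 t * f2 t + f1 t * g2 t).
    by rewrite /S (Rint_split (L2_int Ls) xy y1); ring.
  have -> : P y - P x = f2 y * (f1 y - f1 x) + f1 x * (f2 y - f2 x) - (S y - S x).
    by rewrite /P; ring.
  rewrite SE (wd_diff w1 xy y1) (wd_diff w2 xy y1).
  rewrite -RintegralZl//; last exact/Isub/L2_int.
  rewrite -RintegralZl//; last exact/Isub/L2_int.
  rewrite -RintegralD//; [|exact/IZ/Isub/L2_int|exact/IZ/Isub/L2_int].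
  rewrite -RintegralB//; [|by apply: ID; exact/IZ/Isub/L2_int|exact/Isub/L2_int].
  by apply: eq_Rintegral => t _; ring.
have Ic k : mu.-integrable `[x, y] (EFin \o (fun=> k : R)).
  by apply: continuous_integrable; exact: continuous_cst'.
pose N1 := \int[mu]_(t in `[x, y]) (g1 t ^+ 2).
pose N2 := \int[mu]_(t in `[x, y]) (g2 t ^+ 2).
have N1E : G y - G x = N1 + N2.
  by rewrite GE RintegralD//; exact/Isub/L2_sq.
have N10 : 0 <= N1 by apply: Rintegral_ge0 => t _; exact: sqr_ge0.
have N20 : 0 <= N2 by apply: Rintegral_ge0 => t _; exact: sqr_ge0.
rewrite -mulrBr PP N1E.
have Idiff : itgb (fun t => g1 t * (f2 y - f2 t) + (f1 x - f1 t) * g2 t).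
  have h1 := L2_int (L2Z (f2 y) L1); have h2 := L2_int (L2Z (f1 x) L2).
  have := itgbB (itgbD h1 h2) (L2_int Ls).
  by apply: itgb_ext => t _; ring.
apply: (le_trans (le_normr_Rintegral _ _)) => //; first exact: Isub.
have sq0 g t : 0 <= g t ^+ 2 by exact: sqr_ge0.
pose d := y - x.
have d0 : 0 <= d by rewrite subr_ge0.
(* both increments are at most the square root of d (N1 + N2) *)
pose s := Num.sqrt (d * (N1 + N2)).
have s2 : s ^+ 2 = d * (N1 + N2) by rewrite sqr_sqrtr// mulr_ge0// addr_ge0.
have s0 : 0 <= s by exact: sqrtr_ge0.
have Iabs g : square_integrable g -> mu.-integrable `[x, y] (EFin \o (fun t => `|g t|)).
  by move=> Lg; exact: integrable_norm (Isub _ (L2_int Lg)).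
have step f g N : weak_derivative f g -> square_integrable g ->
    N = \int[mu]_(t in `[x, y]) (g t ^+ 2) -> N <= N1 + N2 ->
    forall u v, x <= u <= v -> v <= y -> `|f v - f u| <= s.
  move=> wf Lg NE NN u v /andP[xu uv] vy.
  have u0 : -1 <= u by apply: le_trans xu; case/andP: xy.
  have v1 : v <= 1 by exact: le_trans y1.
  rewrite -ler_sqr ?nnegrE// -normrX ger0_norm ?sqr_ge0// s2.
  rewrite (wd_diff wf) ?u0//.
  apply: (le_trans (cauchy_schwarz_itv Lg _ v1)); first by rewrite u0.
  apply: ler_pM; [by rewrite subr_ge0| |exact: lerB|].
    by apply: Rintegral_ge0 => t _.
  apply: le_trans NN; rewrite NE.
  have xu' : -1 <= u <= v by rewrite u0.
  have a1 := Rint_split (L2_sq Lg) xu' (le_trans vy y1).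
  have xv' : -1 <= v <= y by rewrite vy (le_trans u0 uv).
  have a2 := Rint_split (L2_sq Lg) xv' y1.
  have xx' : -1 <= x <= u by rewrite xu andbT; case/andP: xy.
  have a3 : u <= 1 by exact: le_trans v1.
  have a4 := Rint_split (L2_sq Lg) xx' a3.
  have a5 := Rint_split (L2_sq Lg) xy y1.
  have a6 : 0 <= \int[mu]_(t in `[x, u]) (g t ^+ 2) by apply: Rintegral_ge0.
  have a7 : 0 <= \int[mu]_(t in `[v, y]) (g t ^+ 2) by apply: Rintegral_ge0.
  suff : \int[mu]_(t in `[x, y]) (g t ^+ 2) = \int[mu]_(t in `[x, u]) (g t ^+ 2)
    + \int[mu]_(t in `[u, v]) (g t ^+ 2) + \int[mu]_(t in `[v, y]) (g t ^+ 2).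
    by move=> ->; rewrite addrAC lerDr addr_ge0.
  by move: a2; rewrite a1 a4 a5 -!addrA => /addrI.
have T2 t : x <= t <= y -> `|f2 y - f2 t| <= s.
  by move=> xty; apply: (step f2 g2 N2) => //; rewrite lerDr.
have T1 t : x <= t <= y -> `|f1 x - f1 t| <= s.
  move=> /andP[xt ty]; rewrite distrC.
  by apply: (step f1 g1 N1) => //; rewrite ?lerDl// lexx xt.
pose M1 := \int[mu]_(t in `[x, y]) `|g1 t|.
pose M2 := \int[mu]_(t in `[x, y]) `|g2 t|.
apply: (@le_trans _ _ (s * M1 + s * M2)).
  have -> : s * M1 + s * M2 = \int[mu]_(t in `[x, y]) (s * `|g1 t| + s * `|g2 t|).
    rewrite RintegralD//; [|exact/IZ/Iabs|exact/IZ/Iabs].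
    by rewrite !RintegralZl//; exact: Iabs.
  apply: le_Rintegral => //.
  - exact: integrable_norm (Isub _ Idiff).
  - by apply: ID; exact/IZ/Iabs.
  move=> t; rewrite /= in_itv /= => txy; apply: (le_trans (ler_normD _ _)).
  rewrite !normrM; apply: lerD; last by rewrite ler_wpM2r// T1.
  by rewrite mulrC ler_wpM2r// T2.
have MS g : square_integrable g -> (\int[mu]_(t in `[x, y]) `|g t|) ^+ 2 <=
    d * \int[mu]_(t in `[x, y]) (g t ^+ 2).
  move=> Lg; have Lg' : square_integrable (fun t => `|g t|).
    split; first by apply: itgb_meas; exact: integrable_norm (L2_int Lg).
    by apply: itgb_ext (L2_sq Lg) => t _; rewrite -normrX ger0_norm ?sqr_ge0.
  have := cauchy_schwarz_itv Lg' xy y1; congr (_ <= _ * _).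
  by apply: eq_Rintegral => t _; rewrite -normrX ger0_norm ?sqr_ge0.
have M1s : M1 ^+ 2 <= d * N1 by exact: MS.
have M2s : M2 ^+ 2 <= d * N2 by exact: MS.
have -> : y - x = d by [].
have h1 : 0 <= (s - M1) ^+ 2 by exact: sqr_ge0.
have h2 : 0 <= (s - M2) ^+ 2 by exact: sqr_ge0.
have h3 : 0 <= d * N1 by exact: mulr_ge0.
have h4 : 0 <= d * N2 by exact: mulr_ge0.
move: (M1) (M2) (N1) (N2) M1s M2s s2 h1 h2 h3 h4 => m1 m2 n1 n2.
by clear; move=> *; nra.
Qed.

Lemma wdM_cont f g phi dphi : weak_derivative f g -> continuous phi ->
  continuous dphi -> (forall x, -1 < x < 1 -> dv phi x (dphi x)) ->
  weak_derivative (fun x => phi x * f x) (fun x => dphi x * f x + phi x * g x).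
Proof. by move=> wf cp cd dp; apply: wdM => //; exact: wd_dv. Qed.

Lemma m1_in : -1 <= (-1 : R) <= 1.
Proof. by rewrite lexx /=; lra. Qed.

Lemma itg_deriv f g : weak_derivative f g -> itg g = f 1 - f (-1).
Proof.
by move=> wf; rewrite /itg -(wd_diff wf m1_in).
Qed.

Lemma ae0_of_integrals k : itgb k ->
  (forall x, -1 <= x <= 1 -> \int[mu]_(t in `[-1, x]) k t = 0) ->
  {ae mu, forall x, I11 x -> k x = 0}.
Proof.
move=> Ik k0; pose K := k \_ I11.
have IK : mu.-integrable setT (EFin \o K).
  by move: Ik; rewrite /itgb integrable_mkcond//= restrict_EFin.
have F0 x : \int[mu]_(t in `]-oo, x]) K t = 0.
  rewrite -Rintegral_mkcondr.
  have [x1|x1] := ltP x (-1).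
    rewrite (_ : _ `&` _ = set0) ?Rintegral_set0//.
    by apply/seteqP; split => t //=; rewrite !in_itv /=; lra.
  have [x2|x2] := leP x 1.
    rewrite (_ : _ `&` _ = `[-1, x]%classic); first by apply: k0; lra.
    by apply/seteqP; split => t //=; rewrite !in_itv /=; lra.
  rewrite (_ : _ `&` _ = `[-1, 1]%classic); first by apply: k0; lra.
  by apply/seteqP; split => t //=; rewrite !in_itv /=; lra.
have H1 y : mu.-integrable `]-oo, y] (EFin \o K) by exact: integrableS IK.
have H2 : locally_integrable setT K.
  exact: (@integrable_locally _ k I11 measurable_I11 Ik).
have := FTC1Ny H1 H2; apply: filterS.
  exact: (ae_filter_ringOfSetsType mu).
move=> x [_ +] x11.
rewrite (_ : (fun x => \int[mu]_(t in `]-oo, x]) K t) = fun=> 0); last first.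
  exact/funext.
by rewrite derive1_cst /K patchE mem_set.
Qed.

(** The weak derivative chosen by wder may differ from a given one on a
negligible set; two representatives have the same primitive on every
subinterval. *)
Lemma wd_ae f g g' : weak_derivative f g -> weak_derivative f g' ->
  {ae mu, forall x, I11 x -> g x = g' x}.
Proof.
move=> w w'; have L : square_integrable g by case: w.
have L' : square_integrable g' by case: w'.
have Ik : itgb (fun x => g x - g' x) by apply: itgbB; exact: L2_int.
have H : {ae mu, forall x, I11 x -> g x - g' x = 0}.
  apply: ae0_of_integrals => // x x11.
  rewrite RintegralB//; [|by apply: itgb_sub; [exact: L2_int|lra|lra]..].
  have h : (-1 : R) <= -1 <= x by rewrite lexx; case/andP: x11.
  have x1 : x <= 1 by case/andP: x11.
  by rewrite -(wd_diff w h x1) -(wd_diff w' h x1) subrr.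
move: H; apply: filterS; first exact: (ae_filter_ringOfSetsType mu).
by move=> x H /H /eqP; rewrite subr_eq0 => /eqP.
Qed.

Lemma wder_wd f g : weak_derivative f g -> weak_derivative f (wder f).
Proof. by move=> w; apply: (@xgetPex _ (fun=> 0) [set g | weak_derivative f g]); exists g. Qed.

(** Integral functionals of the chosen weak derivatives can be computed with
any representatives, in particular with classical derivatives. *)
Lemma itg_wder3 (F : R -> R -> R -> R -> R) f1 g1 f2 g2 f3 g3 :
  weak_derivative f1 g1 -> weak_derivative f2 g2 -> weak_derivative f3 g3 ->
  itgb (fun x => F x (wder f1 x) (wder f2 x) (wder f3 x)) ->
  itgb (fun x => F x (g1 x) (g2 x) (g3 x)) ->
  itg (fun x => F x (wder f1 x) (wder f2 x) (wder f3 x)) =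
  itg (fun x => F x (g1 x) (g2 x) (g3 x)).
Proof.
move=> w1 w2 w3 I1 I2; congr fine; apply: ae_eq_integral => //.
- exact: measurable_int I1.
- exact: measurable_int I2.
move: (wd_ae (wder_wd w1) w1) (wd_ae (wder_wd w2) w2) (wd_ae (wder_wd w3) w3).
apply: filterS3; first exact: (ae_filter_ringOfSetsType mu).
move=> x h1 h2 h3 x11 /=.
by rewrite h1// h2// h3.
Qed.

Lemma wd_cst c : weak_derivative (fun=> c) (fun=> 0).
Proof.
apply: wd_dv; [exact: continuous_cst'|exact: continuous_cst'|].
by move=> x _; exact: dv_cst.
Qed.

Lemma itg_wder1 (F : R -> R -> R) f g : weak_derivative f g ->
  itgb (fun x => F x (wder f x)) -> itgb (fun x => F x (g x)) ->
  itg (fun x => F x (wder f x)) = itg (fun x => F x (g x)).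
Proof.
move=> w I1 I2; exact: (@itg_wder3 (fun x y _ _ => F x y) f g _ _ _ _ w
  (wd_cst 0) (wd_cst 0)).
Qed.

Lemma H1normE f g : weak_derivative f g ->
  H1norm f ^+ 2 = itg (fun x => f x ^+ 2) + itg (fun x => g x ^+ 2).
Proof.
move=> w; have Lg : square_integrable g by case: w.
have Lw : square_integrable (wder f) by case: (wder_wd w).
rewrite /H1norm sqr_sqrtr; last first.
  by apply: addr_ge0; apply: itg_ge0 => x _; exact: sqr_ge0.
congr (_ + _); apply: (@itg_wder1 (fun _ y => y ^+ 2)) => //; exact: L2_sq.
Qed.

(** Integrate f x^2 <= 2 f y^2 + 2 (f x - f y)^2 in y; the increment is bounded
by the Cauchy-Schwarz inequality. *)
Lemma H1_sup f g x : weak_derivative f g -> -1 <= x <= 1 ->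
  f x ^+ 2 <= 4 * H1norm f ^+ 2.
Proof.
move=> w x11; rewrite (H1normE w).
have Lg : square_integrable g by case: w.
have If2 := L2_sq (wdL2 w).
pose G := itg (fun x => g x ^+ 2).
have G0 : 0 <= G by apply: itg_ge0 => t _; exact: sqr_ge0.
have Ic k : itgb (fun=> k : R) by apply: itgb_cont; exact: continuous_cst'.
have : itg (fun=> f x ^+ 2) <= itg (fun y => 2 * f y ^+ 2 + 4 * G).
  apply: itg_le => //; first by apply: itgbD => //; exact: itgbZ.
  move=> y y11; have h := wd_holder w y11 x11.
  have : `|x - y| * G <= 2 * G by rewrite ler_wpM2r// ler_norml; lra.
  move: h; rewrite -/G; move: (`|x - y| * G) => k h hk.
  have h2 : 0 <= (f x - 2 * f y) ^+ 2 by exact: sqr_ge0.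
  by move: (f x) (f y) h hk h2 => u v; clear; nra.
rewrite itgD ?itgZ ?itg_cst//; last exact: itgbZ.
have : 0 <= itg (fun x => f x ^+ 2) by apply: itg_ge0 => t _; exact: sqr_ge0.
rewrite -/G; set a := itg (fun x => f x ^+ 2); nra.
Qed.

(** From f (-1) = 0 and the Cauchy-Schwarz inequality, f^2 <= 2 * itg (g^2)
pointwise. *)
Lemma poincare f g : weak_derivative f g -> f (-1) = 0 ->
  itg (fun x => f x ^+ 2) <= 4 * itg (fun x => g x ^+ 2).
Proof.
move=> w f0; have Lg : square_integrable g by case: w.
have Ic k : itgb (fun=> k : R) by apply: itgb_cont; exact: continuous_cst'.
pose G := itg (fun x => g x ^+ 2).
have G0 : 0 <= G by apply: itg_ge0 => t _; exact: sqr_ge0.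
have : itg (fun x => f x ^+ 2) <= itg (fun=> 2 * G).
  apply: itg_le => //; first exact: L2_sq (wdL2 w).
  move=> x x11; have := wd_holder w m1_in x11; rewrite f0 subr0 => /le_trans; apply.
  by rewrite ler_wpM2r// ler_norml; lra.
by rewrite itg_cst -/G; move: (itg _) => a; lra.
Qed.

End WeakDerivative.

(** * The potential and the first variation *)

Section Potential.
Context {R : realType}.
Implicit Types (a b c u v w x y K M : R).

Definition wt a b c : R := 3 * a ^+ 2 + b ^+ 2 + c ^+ 2.

Definition pot a b c : R :=
  -8 / 3 * wt a b c + 4 * a * (a ^+ 2 - b ^+ 2 - c ^+ 2) + 1 / 2 * wt a b c ^+ 2.

Definition pot1 a b c : R :=
  - 16 * a + 12 * a ^+ 2 - 4 * b ^+ 2 - 4 * c ^+ 2 + 6 * a * wt a b c.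

Definition pot2 a b c : R := - (16 / 3) * b - 8 * a * b + 2 * b * wt a b c.

Definition pot3 a b c : R := - (16 / 3) * c - 8 * a * c + 2 * c * wt a b c.

Definition dpot a b c u v w : R := pot1 a b c * u + pot2 a b c * v + pot3 a b c * w.

Definition sqs u v w : R := u ^+ 2 + v ^+ 2 + w ^+ 2.

Lemma sqs_ge0 u v w : 0 <= sqs u v w.
Proof. by rewrite /sqs !addr_ge0 ?sqr_ge0. Qed.

Lemma sq_le1 u : `|u| <= 1 -> u ^+ 2 <= 1.
Proof. by move=> u1; rewrite -[u ^+ 2]ger0_norm ?sqr_ge0// normrX exprn_ile1. Qed.

Lemma sq_leM u M : `|u| <= M -> u ^+ 2 <= M ^+ 2.
Proof.
move=> uM; rewrite -[u ^+ 2]ger0_norm ?sqr_ge0// normrX lerXn2r// nnegrE//.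
exact: le_trans uM.
Qed.

Lemma continuous_pot (f g h : R -> R) : continuous f -> continuous g ->
  continuous h -> continuous (fun x => pot (f x) (g x) (h x)).
Proof. by move=> cf cg ch; rewrite /pot /wt; cts. Qed.

Lemma continuous_dpot (f g h f' g' h' : R -> R) :
  continuous f -> continuous g -> continuous h ->
  continuous f' -> continuous g' -> continuous h' ->
  continuous (fun x => dpot (f x) (g x) (h x) (f' x) (g' x) (h' x)).
Proof. by move=> ? ? ? ? ? ?; rewrite /dpot /pot1 /pot2 /pot3 /wt; cts. Qed.

Lemma continuous_sqs (f g h : R -> R) : continuous f -> continuous g ->
  continuous h -> continuous (fun x => sqs (f x) (g x) (h x)).
Proof. by move=> ? ? ?; rewrite /sqs; cts. Qed.

(** The constants come from crude bounds on the Taylor coefficients of order 2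
to 4 of the potential; all that matters is that they depend on M alone. *)
Definition remK M : R := 123 * M ^+ 2 + 20 * M + 27.

Lemma pot_remainder a b c u v w M : 0 <= M ->
  `|a| <= M -> `|b| <= M -> `|c| <= M ->
  `|u| <= 1 -> `|v| <= 1 -> `|w| <= 1 ->
  `|pot (a + u) (b + v) (c + w) - pot a b c - dpot a b c u v w| <=
    remK M * sqs u v w.
Proof.
move=> M0 aM bM cM u1 v1 w1; rewrite /remK.
pose s := sqs u v w; pose n := wt u v w; pose N := wt a b c.
pose B := 3 * a * u + b * v + c * w.
have -> : pot (a + u) (b + v) (c + w) - pot a b c - dpot a b c u v w =
   -8 / 3 * n + (1 / 2 * (2 * B + n) ^+ 2 + N * n)
   + 4 * (a * (u ^+ 2 - v ^+ 2 - w ^+ 2) + u * (2 * a * u - 2 * b * v - 2 * c * w)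
          + u * (u ^+ 2 - v ^+ 2 - w ^+ 2)).
  by rewrite /pot /dpot /pot1 /pot2 /pot3 /n /N /B /wt; field.
have a2 := sq_leM aM; have b2 := sq_leM bM; have c2 := sq_leM cM.
have u2 := sq_le1 u1; have v2 := sq_le1 v1; have w2 := sq_le1 w1.
have hu := sqr_ge0 u; have hv := sqr_ge0 v; have hw := sqr_ge0 w.
have ha := sqr_ge0 a; have hb := sqr_ge0 b; have hc := sqr_ge0 c.
have s0 : 0 <= s by rewrite /s /sqs; lra.
have n0 : 0 <= n by rewrite /n /wt; lra.
have n3 : n <= 3 * s by rewrite /n /s /wt /sqs; lra.
have n5 : n <= 5 by rewrite /n /wt; lra.
have nn : n ^+ 2 <= 15 * s by nra.
have N0 : 0 <= N by rewrite /N /wt; lra.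
have N5 : N <= 5 * M ^+ 2 by rewrite /N /wt; lra.
have Nn : 0 <= N * n <= 15 * M ^+ 2 * s.
  rewrite mulr_ge0//=; apply: (@le_trans _ _ (5 * M ^+ 2 * (3 * s))).
    exact: ler_pM.
  lra.
have prod x y : `|x| <= M -> `|x * y| <= M * `|y|.
  by move=> xM; rewrite normrM ler_wpM2r.
have absq x : `|x| ^+ 2 = x ^+ 2 by rewrite -normrX ger0_norm ?sqr_ge0.
have B2 : B ^+ 2 <= 27 * M ^+ 2 * s.
  have Bs : `|B| <= 3 * (M * (`|u| + `|v| + `|w|)).
    rewrite /B; apply: (le_trans (ler_normD _ _)).
    have := ler_normD (3 * a * u) (b * v).
    have := prod _ u aM; have := prod _ v bM; have := prod _ w cM.
    rewrite -mulrA [`|3 * _|]normrM [`|3|]ger0_norm//.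
    have := mulr_ge0 M0 (normr_ge0 v); have := mulr_ge0 M0 (normr_ge0 w).
    lra.
  have := sq_leM Bs; rewrite -absq => /le_trans; apply.
  rewrite (_ : 27 * M ^+ 2 * s = 9 * (M ^+ 2 * (3 * s))); last by ring.
  rewrite exprMn exprMn (_ : 3 ^+ 2 = 9); last by ring.
  rewrite ler_wpM2l// ler_wpM2l ?sqr_ge0//.
  rewrite /s /sqs -(absq u) -(absq v) -(absq w).
  have := sqr_ge0 (`|u| - `|v|); have := sqr_ge0 (`|v| - `|w|).
  have := sqr_ge0 (`|u| - `|w|).
  move: (`|u|) (`|v|) (`|w|) => x y z; nra.
have BB : 0 <= (2 * B + n) ^+ 2 <= 216 * M ^+ 2 * s + 30 * s.
  have := sqr_ge0 (2 * B - n); have := sqr_ge0 (2 * B + n).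
  move: B2 nn; clear; move: (M ^+ 2) => m; nra.
have uv x y : `|x| <= 1 -> `|y * x| <= `|y|.
  by move=> x1; rewrite normrM ler_piMr.
have C1 : `|a * (u ^+ 2 - v ^+ 2 - w ^+ 2)| <= M * s.
  apply: (le_trans (prod _ _ aM)); rewrite ler_wpM2l// ler_norml /s /sqs; lra.
have C3 : `|u * (u ^+ 2 - v ^+ 2 - w ^+ 2)| <= s.
  rewrite mulrC; apply: (le_trans (uv _ _ u1)).
  rewrite ler_norml /s /sqs; lra.
have D x y : `|y| <= M -> `|u * (2 * y * x)| <= M * (u ^+ 2 + x ^+ 2).
  move=> yM; rewrite (_ : u * (2 * y * x) = y * (2 * u * x)); last by ring.
  apply: (le_trans (prod _ _ yM)); rewrite ler_wpM2l// ler_norml.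
  have := sqr_ge0 (u + x); have := sqr_ge0 (u - x); nra.
have C2 : `|u * (2 * a * u - 2 * b * v - 2 * c * w)| <= 4 * M * s.
  rewrite mulrBr mulrBr.
  have h1 := ler_normB (u * (2 * a * u) - u * (2 * b * v)) (u * (2 * c * w)).
  have h2 := ler_normB (u * (2 * a * u)) (u * (2 * b * v)).
  have := D u a aM; have := D v b bM; have := D w c cM.
  have := mulr_ge0 M0 hu; have := mulr_ge0 M0 hv; have := mulr_ge0 M0 hw.
  by rewrite /s /sqs; move: h1 h2; clear; nra.
move: C1 C2 C3; rewrite !ler_norml.
set x1 := a * _; set x2 := u * _; set x3 := u * _.
by rewrite -/s; move: Nn BB n3 n0 s0; clear; move: (M ^+ 2) => m; nra.
Qed.

(** The quartic part of the potential is strongly monotone and dominates the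
cubic part, hence the gradient is one-sided Lipschitz on the whole space. *)
Lemma pot_monotone a b c a' b' c' :
  - 400 * sqs (a' - a) (b' - b) (c' - c) <=
  dpot a' b' c' (a' - a) (b' - b) (c' - c) - dpot a b c (a' - a) (b' - b) (c' - c).
Proof.
pose u := a' - a; pose v := b' - b; pose w := c' - c.
pose m1 := (a' + a) / 2; pose m2 := (b' + b) / 2; pose m3 := (c' + c) / 2.
have -> : a' = m1 + u / 2 by rewrite /m1 /u; field.
have -> : b' = m2 + v / 2 by rewrite /m2 /v; field.
have -> : c' = m3 + w / 2 by rewrite /m3 /w; field.
have -> : a = m1 - u / 2 by rewrite /m1 /u; field.
have -> : b = m2 - v / 2 by rewrite /m2 /v; field.
have -> : c = m3 - w / 2 by rewrite /m3 /w; field.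
have -> : m1 + u / 2 - (m1 - u / 2) = u by field.
have -> : m2 + v / 2 - (m2 - v / 2) = v by field.
have -> : m3 + w / 2 - (m3 - w / 2) = w by field.
pose n := wt u v w; pose m := wt m1 m2 m3; pose B := 3 * m1 * u + m2 * v + m3 * w.
have -> : dpot (m1 + u / 2) (m2 + v / 2) (m3 + w / 2) u v w
    - dpot (m1 - u / 2) (m2 - v / 2) (m3 - w / 2) u v w =
  - (16 / 3) * n + 2 * n * m + n * n / 2 + 4 * B ^+ 2
  + (24 * m1 * u ^+ 2 - 8 * m1 * (v ^+ 2 + w ^+ 2) - 16 * u * (m2 * v + m3 * w)).
  by rewrite /dpot /pot1 /pot2 /pot3 /n /m /B /wt; field.
have -> : 2 * n * m = 2 * (3 * m1 ^+ 2 * n + m2 ^+ 2 * n + m3 ^+ 2 * n).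
  by rewrite /m /wt; ring.
have B0 := sqr_ge0 B; have nn : 0 <= n * n by rewrite -expr2 sqr_ge0.
rewrite /n /sqs /wt in nn *.
have h1 := mulr_ge0 (sqr_ge0 (m1 + 4)) (sqr_ge0 u).
have h2 := mulr_ge0 (sqr_ge0 (m1 - 4)) (sqr_ge0 v).
have h3 := mulr_ge0 (sqr_ge0 (m1 - 4)) (sqr_ge0 w).
have h4 := sqr_ge0 (m2 * v - 8 * u).
have h5 := sqr_ge0 (m3 * w - 8 * u).
have k1 := mulr_ge0 (sqr_ge0 m1) (sqr_ge0 u).
have k2 := mulr_ge0 (sqr_ge0 m1) (sqr_ge0 v).
have k3 := mulr_ge0 (sqr_ge0 m1) (sqr_ge0 w).
have k4 := mulr_ge0 (sqr_ge0 m2) (sqr_ge0 u).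
have k5 := mulr_ge0 (sqr_ge0 m2) (sqr_ge0 v).
have k6 := mulr_ge0 (sqr_ge0 m2) (sqr_ge0 w).
have k7 := mulr_ge0 (sqr_ge0 m3) (sqr_ge0 u).
have k8 := mulr_ge0 (sqr_ge0 m3) (sqr_ge0 v).
have k9 := mulr_ge0 (sqr_ge0 m3) (sqr_ge0 w).
have := sqr_ge0 u; have := sqr_ge0 v; have := sqr_ge0 w.
move: B0 nn h1 h2 h3 h4 h5 k1 k2 k3 k4 k5 k6 k7 k8 k9.
rewrite ?/n; move: (B ^+ 2) => BB; clear; move: m1 m2 m3 u v w => m1 m2 m3 u v w.
lra.
Qed.

End Potential.

Section FirstVariation.
Context {R : realType}.
Implicit Types (Q g h k : triple R) (f : R -> R) (x y t M lambda : R).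

Definition wd3 Q g : Prop :=
  [/\ weak_derivative (q1 Q) (q1 g), weak_derivative (q2 Q) (q2 g)
    & weak_derivative (q3 Q) (q3 g)].

Lemma H1_3_wd3 Q : H1_3 Q -> exists g, wd3 Q g.
Proof. by case=> -[g1 H1] [g2 H2] [g3 H3]; exists ((g1, g2), g3). Qed.

Lemma wd3_H1_3 Q g : wd3 Q g -> H1_3 Q.
Proof. by case=> H1 H2 H3; split; [exists (q1 g)|exists (q2 g)|exists (q3 g)]. Qed.

Lemma wd3D Q g h k : wd3 Q g -> wd3 h k -> wd3 (Q + h) (g + k).
Proof. by case=> ? ? ? [? ? ?]; split; apply: wdD. Qed.

Lemma wd3B Q g h k : wd3 Q g -> wd3 h k -> wd3 (Q - h) (g - k).
Proof. by case=> ? ? ? [? ? ?]; split; apply: wdB. Qed.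

Lemma wd3_sub Q g : wd3 Q g ->
  [/\ square_integrable (q1 g), square_integrable (q2 g) & square_integrable (q3 g)].
Proof. by case=> -[] ? _ [] ? _ [] ? _. Qed.

Lemma itgb_wt g : square_integrable (q1 g) -> square_integrable (q2 g) ->
  square_integrable (q3 g) -> itgb (fun x => wt (q1 g x) (q2 g x) (q3 g x)).
Proof.
move=> L1 L2 L3; apply: itgbD; last exact: L2_sq.
by apply: itgbD; [exact/itgbZ/L2_sq|exact: L2_sq].
Qed.

Lemma itgb_clamp (F : R -> R) : continuous (fun x => F (clamp x)) -> itgb F.
Proof. by move=> /itgb_cont; apply: itgb_ext => x /clamp_id ->. Qed.

Lemma wd3_clamp Q g : wd3 Q g ->
  [/\ continuous (fun x => q1 Q (clamp x)), continuous (fun x => q2 Q (clamp x))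
    & continuous (fun x => q3 Q (clamp x))].
Proof. by case=> ? ? ?; split; apply: wd_clamp_continuous; eassumption. Qed.

Lemma itgb_pot Q g : wd3 Q g -> itgb (fun x => pot (q1 Q x) (q2 Q x) (q3 Q x)).
Proof. by move=> /wd3_clamp[c1 c2 c3]; apply: itgb_clamp; exact: continuous_pot c1 c2 c3. Qed.

Lemma itgb_dpot Q g h k : wd3 Q g -> wd3 h k ->
  itgb (fun x => dpot (q1 Q x) (q2 Q x) (q3 Q x) (q1 h x) (q2 h x) (q3 h x)).
Proof.
move=> /wd3_clamp[c1 c2 c3] /wd3_clamp[d1 d2 d3].
by apply: itgb_clamp; exact: continuous_dpot c1 c2 c3 d1 d2 d3.
Qed.

Lemma itgb_sqs h k : wd3 h k -> itgb (fun x => sqs (q1 h x) (q2 h x) (q3 h x)).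
Proof. by move=> /wd3_clamp[c1 c2 c3]; apply: itgb_clamp; exact: continuous_sqs c1 c2 c3. Qed.

Lemma itgb_cst (c : R) : itgb (fun=> c).
Proof. by apply: itgb_cont; exact: continuous_cst'. Qed.

Lemma itgbZr (c : R) f : itgb f -> itgb (fun x => f x * c).
Proof. by move=> /(itgbZ c); apply: itgb_ext => x _; rewrite mulrC. Qed.

Lemma energyE lambda Q g : wd3 Q g -> energy (-8) lambda Q =
  itg (fun x => wt (q1 g x) (q2 g x) (q3 g x) / lambda ^+ 2
                + (pot (q1 Q x) (q2 Q x) (q3 Q x) + ctheta (-8))).
Proof.
move=> w; rewrite /energy; case: (w) => w1 w2 w3.
pose F x a b c := wt a b c / lambda ^+ 2
  + (pot (q1 Q x) (q2 Q x) (q3 Q x) + ctheta (-8)).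
have -> : itg (fun x => 1 / (2 * lambda ^+ 2) *
      normsq (Qmx (wder (q1 Q) x) (wder (q2 Q) x) (wder (q3 Q) x)) +
      potential (-8) (Qmx (q1 Q x) (q2 Q x) (q3 Q x))) =
    itg (fun x => F x (wder (q1 Q) x) (wder (q2 Q) x) (wder (q3 Q) x)).
  apply: itg_ext => x _; rewrite normsqE potentialE /F /pot /wt.
  congr (_ + _); rewrite [2 * lambda ^+ 2]mulrC invfM.
  by move: (lambda ^+ 2)^-1 => l; field.
have Ir : itgb (fun x => pot (q1 Q x) (q2 Q x) (q3 Q x) + ctheta (-8)).
  by apply: itgbD; [exact: itgb_pot w|exact: itgb_cst].
apply: itg_wder3 => //; apply: itgbD => //; apply: itgbZr.
  apply: (@itgb_wt ((wder (q1 Q), wder (q2 Q)), wder (q3 Q))).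
  - by case: (wder_wd w1).
  - by case: (wder_wd w2).
  - by case: (wder_wd w3).
by case: (wd3_sub w) => *; exact: itgb_wt.
Qed.

Definition bil g k x : R := 3 * (q1 g x * q1 k x) + q2 g x * q2 k x + q3 g x * q3 k x.

(** The first variation of the energy at Q, with weak derivative g, in the
direction h, with weak derivative k. *)
Definition DE lambda Q g h k : R :=
  itg (fun x => 2 * bil g k x / lambda ^+ 2
     + dpot (q1 Q x) (q2 Q x) (q3 Q x) (q1 h x) (q2 h x) (q3 h x)).

Lemma itgb_bil Q g h k : wd3 Q g -> wd3 h k -> itgb (bil g k).
Proof.
move=> /wd3_sub[g1 g2 g3] /wd3_sub[k1 k2 k3].
apply: itgbD; last exact: L2_mul.
by apply: itgbD; [exact/itgbZ/L2_mul|exact: L2_mul].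
Qed.

Lemma H1norm3E h k : wd3 h k -> H1norm3 h ^+ 2 =
  itg (fun x => sqs (q1 h x) (q2 h x) (q3 h x) + sqs (q1 k x) (q2 k x) (q3 k x)).
Proof.
move=> w; case: (w) => w1 w2 w3; have [k1 k2 k3] := wd3_sub w.
rewrite /H1norm3 sqr_sqrtr; last by rewrite !addr_ge0 ?sqr_ge0.
rewrite (H1normE w1) (H1normE w2) (H1normE w3).
have i1 := L2_sq (wdL2 w1); have i2 := L2_sq (wdL2 w2); have i3 := L2_sq (wdL2 w3).
have j1 := L2_sq k1; have j2 := L2_sq k2; have j3 := L2_sq k3.
rewrite itgD; [|exact: itgb_sqs w|by do 2 apply: itgbD => //].
rewrite /sqs !itgD//; [ring|exact: itgbD|exact: itgbD].
Qed.

Lemma H1norm3_ge0 h : 0 <= H1norm3 h.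
Proof. exact: sqrtr_ge0. Qed.

Lemma H1norm3_le h : [/\ H1norm (q1 h) ^+ 2 <= H1norm3 h ^+ 2,
  H1norm (q2 h) ^+ 2 <= H1norm3 h ^+ 2 & H1norm (q3 h) ^+ 2 <= H1norm3 h ^+ 2].
Proof.
rewrite /H1norm3; move: (H1norm _) (H1norm _) (H1norm _) => a b c.
have ha := sqr_ge0 a; have hb := sqr_ge0 b; have hc := sqr_ge0 c.
by rewrite sqr_sqrtr ?addr_ge0//; split; lra.
Qed.

Lemma H1norm3_sup h k x : wd3 h k -> -1 <= x <= 1 ->
  [/\ `|q1 h x| <= 2 * H1norm3 h, `|q2 h x| <= 2 * H1norm3 h
    & `|q3 h x| <= 2 * H1norm3 h].
Proof.
case=> w1 w2 w3 x11; have [b1 b2 b3] := H1norm3_le h.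
have h1 := H1_sup w1 x11; have h2 := H1_sup w2 x11; have h3 := H1_sup w3 x11.
have := H1norm3_ge0 h; move: (H1norm3 h) b1 b2 b3 => N b1 b2 b3 N0.
have S (y n : R) : y ^+ 2 <= 4 * n ^+ 2 -> n ^+ 2 <= N ^+ 2 -> `|y| <= 2 * N.
  move=> fn nn; rewrite -ler_sqr ?nnegrE ?mulr_ge0//.
  rewrite -normrX ger0_norm ?sqr_ge0// exprMn; apply: (le_trans fn).
  by rewrite (_ : 2 ^+ 2 = 4); [rewrite ler_wpM2l|ring].
by split; [exact: S h1 b1|exact: S h2 b2|exact: S h3 b3].
Qed.

Lemma tripleDE Q h x : (q1 (Q + h) x = q1 Q x + q1 h x) *
  (q2 (Q + h) x = q2 Q x + q2 h x) * (q3 (Q + h) x = q3 Q x + q3 h x).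
Proof. by []. Qed.

Lemma remainder_le (W l S1 S2 K rem : R) : 0 <= l -> 0 <= K -> 0 <= S1 -> 0 <= S2 ->
  0 <= W <= 3 * S2 -> `|rem| <= K * S1 -> `|W * l + rem| <= (3 * l + K) * (S1 + S2).
Proof.
move=> l0 K0 s1 s2 /andP[W0 W3] Hr; apply: (le_trans (ler_normD _ _)).
rewrite ger0_norm ?mulr_ge0//.
have a1 := ler_wpM2r l0 W3; have a2 := mulr_ge0 l0 s1; have a3 := mulr_ge0 K0 s2.
move: (`|rem|) Hr => r Hr; lra.
Qed.

(** The remainder is quadratic in the H^1 norm, because that norm controls the
supremum. Critical points are thus the zeros of DE. *)
Lemma energy_expand lambda Q g M : 0 <= M -> wd3 Q g ->
  (forall x, -1 <= x <= 1 ->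
    [/\ `|q1 Q x| <= M, `|q2 Q x| <= M & `|q3 Q x| <= M]) ->
  forall h k, wd3 h k -> 2 * H1norm3 h <= 1 ->
  `|energy (-8) lambda (Q + h) - energy (-8) lambda Q - DE lambda Q g h k| <=
    (3 / lambda ^+ 2 + remK M) * H1norm3 h ^+ 2.
Proof.
move=> M0 w QM h k wh hn.
have Qh := wd3D w wh.
have [kk1 kk2 kk3] := wd3_sub wh; have [g1 g2 g3] := wd3_sub w.
have [gk1 gk2 gk3] := wd3_sub Qh.
rewrite (energyE _ w) (energyE _ Qh) /DE (H1norm3E wh).
have Iq : itgb (fun x => wt (q1 g x) (q2 g x) (q3 g x) / lambda ^+ 2
                + (pot (q1 Q x) (q2 Q x) (q3 Q x) + ctheta (-8))).
  apply: itgbD; first by apply: itgbZr; exact: itgb_wt.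
  by apply: itgbD; [exact: itgb_pot w|exact: itgb_cst].
have Iqh : itgb (fun x => wt (q1 (g + k) x) (q2 (g + k) x) (q3 (g + k) x) / lambda ^+ 2
                + (pot (q1 (Q + h) x) (q2 (Q + h) x) (q3 (Q + h) x) + ctheta (-8))).
  apply: itgbD; first by apply: itgbZr; exact: itgb_wt.
  by apply: itgbD; [exact: itgb_pot Qh|exact: itgb_cst].
have Id : itgb (fun x => 2 * bil g k x / lambda ^+ 2
     + dpot (q1 Q x) (q2 Q x) (q3 Q x) (q1 h x) (q2 h x) (q3 h x)).
  apply: itgbD; last exact: itgb_dpot w wh.
  by apply: itgbZr; apply: itgbZ; exact: itgb_bil w wh.
rewrite -itgB// -itgB//; last exact: itgbB.
have Is : itgb (fun x => sqs (q1 h x) (q2 h x) (q3 h x) + sqs (q1 k x) (q2 k x) (q3 k x)).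
  apply: itgbD; first exact: itgb_sqs wh.
  by apply: itgbD; [apply: itgbD|]; exact: L2_sq.
have rK : 0 <= remK M by rewrite /remK !addr_ge0// mulr_ge0// exprn_ge0.
have l0 : 0 <= (lambda ^+ 2)^-1 by rewrite invr_ge0 sqr_ge0.
rewrite -itgZ//; set D := fun x => _ - _ - _.
have ID : itgb D by apply: itgbB => //; exact: itgbB.
have DB x : -1 <= x <= 1 -> `|D x| <= (3 / lambda ^+ 2 + remK M) *
    (sqs (q1 h x) (q2 h x) (q3 h x) + sqs (q1 k x) (q2 k x) (q3 k x)).
  move=> x11; have [Q1 Q2 Q3] := QM x x11.
  have [h1 h2 h3] := H1norm3_sup wh x11.
  have := pot_remainder M0 Q1 Q2 Q3 (le_trans h1 hn) (le_trans h2 hn) (le_trans h3 hn).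
  set rem := (X in `|X|) => Hrem.
  have -> : D x = wt (q1 k x) (q2 k x) (q3 k x) / lambda ^+ 2 + rem.
    rewrite /D /rem !tripleDE /bil /wt; move: (lambda ^+ 2)^-1 => l.
    by rewrite /dpot; ring.
  have k1 := sqr_ge0 (q1 k x); have k2 := sqr_ge0 (q2 k x); have k3 := sqr_ge0 (q3 k x).
  apply: remainder_le => //; [exact: sqs_ge0|exact: sqs_ge0|rewrite /wt /sqs].
  by move: (q1 k x ^+ 2) (q2 k x ^+ 2) (q3 k x ^+ 2) k1 k2 k3 => *; lra.
have Ib := itgbZ (3 / lambda ^+ 2 + remK M) Is.
rewrite ler_norml; apply/andP; split.
  rewrite -mulN1r -itgZ//; apply: itg_le => //; first exact: itgbZ.
  by move=> x /DB; rewrite ler_norml mulN1r => /andP[].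
by apply: itg_le => // x /DB; rewrite ler_norml => /andP[].
Qed.

Lemma wd3_bounded Q g : wd3 Q g -> exists2 M : R, 0 <= M &
  forall x, -1 <= x <= 1 -> [/\ `|q1 Q x| <= M, `|q2 Q x| <= M & `|q3 Q x| <= M].
Proof.
case=> /wd_bounded[M1 ? H1] /wd_bounded[M2 ? H2] /wd_bounded[M3 ? H3].
exists (M1 + M2 + M3); first by rewrite !addr_ge0.
by move=> x x11; have := H1 x x11; have := H2 x x11; have := H3 x x11; split; lra.
Qed.

Lemma DE_critical lambda Q g : admissible (-8) Q -> wd3 Q g ->
  (forall h k, H10_3 h -> wd3 h k -> DE lambda Q g h k = 0) ->
  critical (-8) lambda Q.
Proof.
move=> aQ w EL; split=> // eps eps0; have [M M0 QM] := wd3_bounded w.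
pose K := 3 / lambda ^+ 2 + remK M.
have K0 : 0 <= K.
  rewrite addr_ge0 ?mulr_ge0 ?invr_ge0 ?sqr_ge0//.
  by rewrite /remK !addr_ge0// mulr_ge0// exprn_ge0.
exists (Num.min (1 / 2) (eps / (K + 1))).
  by rewrite lt_min !divr_gt0// ltr_wpDl.
move=> h h0; rewrite le_min => /andP[hn1 hn2].
have [k wh] : exists k, wd3 h k.
  by apply: H1_3_wd3; case: h0 => -[? _ _] [? _ _] [? _ _].
have hn : 2 * H1norm3 h <= 1 by lra.
have := energy_expand lambda M0 w QM wh hn; rewrite (EL _ _ h0 wh) subr0.
move=> /le_trans; apply; rewrite -/K expr2 mulrA ler_wpM2r ?H1norm3_ge0//.
move: hn2; rewrite ler_pdivlMr ?ltr_wpDl//; apply: le_trans.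
by rewrite mulrC ler_wpM2l ?H1norm3_ge0// lerDl.
Qed.

Definition scale3 (t : R) h : triple R :=
  ((fun x => t * q1 h x, fun x => t * q2 h x), fun x => t * q3 h x).

Lemma scale3E t h x : (q1 (scale3 t h) x = t * q1 h x) *
  (q2 (scale3 t h) x = t * q2 h x) * (q3 (scale3 t h) x = t * q3 h x).
Proof. by []. Qed.

Lemma wd3Z t h k : wd3 h k -> wd3 (scale3 t h) (scale3 t k).
Proof. by case=> ? ? ?; split; apply: wdZ. Qed.

Lemma H1norm3Z t h k : 0 <= t -> wd3 h k -> H1norm3 (scale3 t h) = t * H1norm3 h.
Proof.
move=> t0 w; apply/eqP; rewrite -(@eqrXn2 _ 2)//; last 2 first.
- exact: H1norm3_ge0.
- by rewrite mulr_ge0// H1norm3_ge0.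
have [k1 k2 k3] := wd3_sub w.
have Is : itgb (fun x => sqs (q1 h x) (q2 h x) (q3 h x) + sqs (q1 k x) (q2 k x) (q3 k x)).
  apply: itgbD; first exact: itgb_sqs w.
  by apply: itgbD; [apply: itgbD|]; exact: L2_sq.
apply/eqP; rewrite exprMn; apply: (etrans (H1norm3E (wd3Z t w))).
apply: (etrans _ (congr1 ( *%R (t ^+ 2)) (esym (H1norm3E w)))); rewrite -(itgZ _ Is).
by apply: itg_ext => x _; rewrite /sqs !scale3E; ring.
Qed.

Lemma DEZ lambda Q g h k t : wd3 Q g -> wd3 h k ->
  DE lambda Q g (scale3 t h) (scale3 t k) = t * DE lambda Q g h k.
Proof.
move=> w wh; rewrite /DE -itgZ.
  apply: itg_ext => x _; rewrite /bil /dpot !scale3E.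
  by move: (lambda ^+ 2)^-1 => l; ring.
apply: itgbD; last exact: itgb_dpot w wh.
by apply: itgbZr; apply: itgbZ; exact: itgb_bil w wh.
Qed.

(** DE is homogeneous in h while the remainder is quadratic, so scaling h to 0
leaves only DE. *)
Lemma critical_DE lambda Q g h k : critical (-8) lambda Q -> wd3 Q g ->
  H10_3 h -> wd3 h k -> DE lambda Q g h k = 0.
Proof.
move=> [aQ crit] w h0 wh; have [M M0 QM] := wd3_bounded w.
pose K := 3 / lambda ^+ 2 + remK M.
have K0 : 0 <= K.
  rewrite addr_ge0 ?mulr_ge0 ?invr_ge0 ?sqr_ge0//.
  by rewrite /remK !addr_ge0// mulr_ge0// exprn_ge0.
apply/eqP; rewrite -normr_le0; apply/ler_addgt0Pl => e e0; rewrite addr0.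
have := H1norm3_ge0 h; move En : (H1norm3 h) => n n0.
have n1 : 0 < n + 1 by lra.
pose eps := e / 2 / (n + 1); have eps0 : 0 < eps by rewrite !divr_gt0.
have [d d0 Hd] := crit eps eps0.
have q0 : 0 <= K * n ^+ 2 by rewrite mulr_ge0// exprn_ge0.
pose t := Num.min (Num.min (1 / 2 / (n + 1)) (d / (n + 1))) (e / 2 / (K * n ^+ 2 + 1)).
have t0 : 0 < t by rewrite !lt_min !divr_gt0// ltr_wpDl.
have tle : [/\ t * (n + 1) <= 1 / 2, t * (n + 1) <= d & t * (K * n ^+ 2 + 1) <= e / 2].
  split; rewrite -ler_pdivlMr ?ltr_wpDl// /t ge_min ?lexx ?orbT// ge_min lexx ?orbT//.
case: tle => t1 t2 t3.
have wt := wd3Z t wh; have nt := H1norm3Z (ltW t0) wh; rewrite En in nt.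
have tn : t * n <= t * (n + 1) by rewrite ler_pM2l// lerDl.
have ht0 : H10_3 (scale3 t h).
  case: h0 => -[_ a1 a2] [_ b1 b2] [_ c1 c2].
  case: wt => w1 w2 w3; split; split; rewrite ?scale3E ?a1 ?a2 ?b1 ?b2 ?c1 ?c2;
    rewrite ?mulr0//.
  - by exists (q1 (scale3 t k)).
  - by exists (q2 (scale3 t k)).
  - by exists (q3 (scale3 t k)).
have hs : 2 * H1norm3 (scale3 t h) <= 1.
  by rewrite nt; move: (le_trans tn t1); move: (t * n); clear=> z; lra.
have hd : H1norm3 (scale3 t h) <= d by rewrite nt; exact: le_trans tn t2.
have A := energy_expand lambda M0 w QM wt hs.
have B := Hd _ ht0 hd.
rewrite (DEZ _ _ w wh) -/K nt in A; rewrite nt in B.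
set L := DE lambda Q g h k in A *.
have : t * `|L| <= t * e.
  rewrite -[X in X * _]gtr0_norm// -normrM.
  have -> : t * L = (energy (-8) lambda (Q + scale3 t h) - energy (-8) lambda Q)
     - (energy (-8) lambda (Q + scale3 t h) - energy (-8) lambda Q - t * L) by ring.
  apply: (le_trans (ler_normB _ _)); apply: (le_trans (lerD B A)).
  have -> : t * e = t * (e / 2) + t * (e / 2) by field.
  apply: lerD.
    rewrite mulrCA ler_pM2l// /eps mulrAC ler_pdivrMr// ler_pM2l ?divr_gt0//.
    by rewrite lerDl.
  rewrite exprMn expr2 mulrCA -mulrA ler_pM2l//.
  by apply: le_trans t3; rewrite ler_pM2l// lerDl.
by rewrite ler_pM2l.
Qed.

End FirstVariation.

(** * Uniform differentiability in a parameter *)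

Section UniformDifferentiability.
Context {R : realType}.
Implicit Types (D : R -> Prop) (F G : R -> R -> R) (f g : R -> R).
Implicit Types (l d K x y r a : R).

(** F l' x = F l x + (l' - l) f x + O((l' - l)^2), uniformly for x in D. The
quadratic form of the remainder makes the notion stable under products,
quotients, square roots and integration with elementary proofs. *)
Definition qdiff D F f l : Prop := exists2 K : R, 0 <= K &
  exists2 d : R, 0 < d & forall l' x, `|l' - l| < d -> D x ->
    [/\ `|F l x| <= K, `|f x| <= K &
        `|F l' x - F l x - (l' - l) * f x| <= K * (l' - l) ^+ 2].

(** Both constants can be taken as small, respectively as large, as needed. *)
Lemma qdiffP D F f l : qdiff D F f l <-> exists2 K : R, 0 <= K &
  exists2 d : R, 0 < d <= 1 & forall l' x, `|l' - l| < d -> D x ->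
    [/\ `|F l x| <= K, `|f x| <= K,
        `|F l' x - F l x - (l' - l) * f x| <= K * (l' - l) ^+ 2 &
        `|F l' x - F l x| <= K * `|l' - l|].
Proof.
split=> [[K K0 [d d0 H]]|[K K0 [d /andP[d0 _] H]]]; last first.
  exists K => //; exists d => // l' x ld Dx; by have [] := H l' x ld Dx.
exists (2 * K); first by rewrite mulr_ge0.
exists (Num.min d 1) => [|l' x]; first by rewrite lt_min d0 ltr01 ge_min lexx orbT.
rewrite lt_min => /andP[ld l1] Dx; have [h1 h2 h3] := H l' x ld Dx.
have s2 : (l' - l) ^+ 2 <= `|l' - l|.
  rewrite -[X in X <= _]ger0_norm ?sqr_ge0// normrX expr2.
  by rewrite -[leRHS]mul1r ler_wpM2r// ltW.
have s0 := sqr_ge0 (l' - l); have n0 := normr_ge0 (l' - l).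
have K2 : K <= 2 * K by lra.
split.
- exact: le_trans K2.
- exact: le_trans K2.
- by apply: (le_trans h3); rewrite ler_wpM2r.
have -> : F l' x - F l x = (F l' x - F l x - (l' - l) * f x) + (l' - l) * f x by ring.
apply: (le_trans (ler_normD _ _)); rewrite normrM.
have a1 : K * (l' - l) ^+ 2 <= K * `|l' - l| by rewrite ler_wpM2l.
have a2 : `|l' - l| * `|f x| <= K * `|l' - l| by rewrite mulrC ler_wpM2r.
by move: h3 a1 a2; set A := `|_ - _ - _|; lra.
Qed.

Lemma qdiff_ext D F G f g l :
  (forall l' x, D x -> F l' x = G l' x) -> (forall x, D x -> f x = g x) ->
  qdiff D F f l -> qdiff D G g l.
Proof.
move=> FG fg [K K0 [d d0 H]]; exists K => //; exists d => // l' x ld Dx.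
by rewrite -!FG// -fg//; exact: H.
Qed.

Lemma qdiff_near D F G f l : (exists2 d : R, 0 < d &
    forall l' x, `|l' - l| < d -> D x -> F l' x = G l' x) ->
  qdiff D F f l -> qdiff D G f l.
Proof.
move=> [e e0 FG] [K K0 [d d0 H]]; exists K => //.
exists (Num.min d e) => [|l' x]; first by rewrite lt_min d0.
rewrite lt_min => /andP[ld le] Dx; have := H l' x ld Dx.
by rewrite -(FG l')// -(FG l)// subrr normr0.
Qed.

Lemma qdiff_sub D D' F f l : (forall x, D' x -> D x) ->
  qdiff D F f l -> qdiff D' F f l.
Proof.
move=> DD [K K0 [d d0 H]]; exists K => //; exists d => // l' x ld Dx.
by apply: H => //; exact: DD.
Qed.

Lemma qdiff_cst D (c : R -> R) l : (exists K, forall x, D x -> `|c x| <= K) ->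
  qdiff D (fun _ => c) (fun=> 0) l.
Proof.
move=> [K cK]; exists `|K| => //; exists 1 => // l' x _ Dx; split.
- by apply: (le_trans (cK x Dx)); exact: ler_norm.
- by rewrite normr0.
- by rewrite subrr mulr0 subr0 normr0 mulr_ge0// sqr_ge0.
Qed.

Lemma qdiff_id D l : qdiff D (fun l _ => l) (fun=> 1) l.
Proof.
exists (`|l| + 1); first by rewrite addr_ge0.
exists 1 => // l' x _ Dx; split; [by rewrite lerDl|by rewrite normr1 lerDr|].
by rewrite mulr1 subrr normr0 mulr_ge0 ?sqr_ge0// addr_ge0.
Qed.

Lemma qdiffD D F G f g l : qdiff D F f l -> qdiff D G g l ->
  qdiff D (fun l x => F l x + G l x) (fun x => f x + g x) l.
Proof.
move=> [K K0 [d d0 H]] [K' K'0 [d' d'0 H']].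
exists (K + K'); first by rewrite addr_ge0.
exists (Num.min d d') => [|l' x]; first by rewrite lt_min d0.
rewrite lt_min => /andP[ld ld'] Dx.
have [h1 h2 h3] := H l' x ld Dx; have [k1 k2 k3] := H' l' x ld' Dx.
split; [exact: le_trans (ler_normD _ _) (lerD h1 k1)
       |exact: le_trans (ler_normD _ _) (lerD h2 k2)|].
have -> : F l' x + G l' x - (F l x + G l x) - (l' - l) * (f x + g x) =
  (F l' x - F l x - (l' - l) * f x) + (G l' x - G l x - (l' - l) * g x) by ring.
by rewrite [leRHS]mulrDl; apply: (le_trans (ler_normD _ _)); exact: lerD.
Qed.

Lemma qdiffM D F G f g l : qdiff D F f l -> qdiff D G g l ->
  qdiff D (fun l x => F l x * G l x) (fun x => f x * G l x + F l x * g x) l.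
Proof.
move=> /qdiffP[K K0 [d /andP[d0 d1] H]] /qdiffP[K' K'0 [d' /andP[d'0 d'1] H']].
exists (3 * (K * K')); first by rewrite !mulr_ge0.
exists (Num.min d d') => [|l' x]; first by rewrite lt_min d0.
rewrite lt_min => /andP[ld ld'] Dx.
have [h1 h2 h3 h4] := H l' x ld Dx; have [k1 k2 k3 k4] := H' l' x ld' Dx.
have KK : 0 <= K * K' by exact: mulr_ge0.
have m1 : `|f x * G l x| <= K * K' by rewrite normrM ler_pM.
have m2 : `|F l x * g x| <= K * K' by rewrite normrM ler_pM.
split.
- by rewrite normrM; apply: (@le_trans _ _ (K * K')); [exact: ler_pM|lra].
- by apply: (le_trans (ler_normD _ _)); lra.
have -> : F l' x * G l' x - F l x * G l x - (l' - l) * (f x * G l x + F l x * g x) =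
  (F l' x - F l x - (l' - l) * f x) * G l x
  + (F l x * (G l' x - G l x - (l' - l) * g x)
  + (F l' x - F l x) * (G l' x - G l x)) by ring.
have s : K * `|l' - l| * (K' * `|l' - l|) = K * K' * (l' - l) ^+ 2.
  rewrite mulrACA -expr2 -normrX ger0_norm ?sqr_ge0//.
have e3 : `|(F l' x - F l x) * (G l' x - G l x)| <= K * K' * (l' - l) ^+ 2.
  by rewrite normrM -s; exact: ler_pM.
have e1 : `|(F l' x - F l x - (l' - l) * f x) * G l x| <= K * K' * (l' - l) ^+ 2.
  by rewrite normrM mulrAC; exact: ler_pM.
have e2 : `|F l x * (G l' x - G l x - (l' - l) * g x)| <= K * K' * (l' - l) ^+ 2.
  by rewrite normrM -mulrA; exact: ler_pM.
apply: (le_trans (ler_normD _ _)).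
apply: (le_trans (lerD (lexx _) (ler_normD _ _))).
rewrite -!mulrA [K * (K' * _)]mulrA; move: e1 e2 e3.
by move: (K * K' * _) => z; move: `|_| `|_| `|_| => A B E; lra.
Qed.

Lemma qdiffN D F f l : qdiff D F f l -> qdiff D (fun l x => - F l x) (fun x => - f x) l.
Proof.
move=> [K K0 [d d0 H]]; exists K => //; exists d => // l' x ld Dx.
have [h1 h2 h3] := H l' x ld Dx; split; rewrite ?normrN//.
have -> : - F l' x - - F l x - (l' - l) * - f x = - (F l' x - F l x - (l' - l) * f x).
  by ring.
by rewrite normrN.
Qed.

Lemma qdiffB D F G f g l : qdiff D F f l -> qdiff D G g l ->
  qdiff D (fun l x => F l x - G l x) (fun x => f x - g x) l.
Proof. by move=> dF dG; apply: qdiffD => //; exact: qdiffN. Qed.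

Lemma qdiffZ D (c : R) F f l : qdiff D F f l ->
  qdiff D (fun l x => c * F l x) (fun x => c * f x) l.
Proof.
move=> dF; have : qdiff D (fun _ _ => c) (fun=> 0) l by apply: qdiff_cst; exists `|c|.
move=> /qdiffM /(_ dF); apply: qdiff_ext => // x Dx; by rewrite mul0r add0r.
Qed.

Lemma qdiffX D n F f l : qdiff D F f l ->
  qdiff D (fun l x => F l x ^+ n.+1) (fun x => n.+1%:R * F l x ^+ n * f x) l.
Proof.
move=> dF; elim: n => [|n IH].
  by apply: qdiff_ext dF => [l' x _|x _]; rewrite ?expr1// expr0 mulr1 mul1r.
apply: qdiff_ext (qdiffM dF IH) => [l' x _|x _]; first by rewrite -exprS.
by rewrite [n.+2%:R]mulrSr !exprS; ring.
Qed.

Lemma sqrt_remainder (a b : R) : 0 < a -> 0 <= b ->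
  `|Num.sqrt b - Num.sqrt a - (b - a) / (2 * Num.sqrt a)| <=
  (b - a) ^+ 2 / (2 * Num.sqrt a * a).
Proof.
move=> a0 b0; have sa : 0 < Num.sqrt a by rewrite sqrtr_gt0.
have sb := sqrtr_ge0 b.
move: (sqr_sqrtr (ltW a0)) (sqr_sqrtr b0) sa sb.
move: (Num.sqrt a) (Num.sqrt b) => s t <- <- s0 t0.
have -> : t - s - (t ^+ 2 - s ^+ 2) / (2 * s) = - ((t - s) ^+ 2 / (2 * s)).
  by field; rewrite gt_eqF.
rewrite normrN ger0_norm; last by rewrite divr_ge0 ?sqr_ge0// mulr_ge0// ltW.
rewrite ler_pdivrMr ?mulr_gt0//.
have -> : (t ^+ 2 - s ^+ 2) ^+ 2 / (2 * s * s ^+ 2) * (2 * s) =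
  (t - s) ^+ 2 * ((t + s) ^+ 2 / s ^+ 2) by field; rewrite gt_eqF.
rewrite ler_peMr ?sqr_ge0// ler_pdivlMr ?exprn_gt0// mul1r.
by have ss := ltW s0; rewrite lerXn2r ?nnegrE ?addr_ge0// lerDr.
Qed.


Lemma inv_remainder (a b : R) : 0 < a -> a / 2 <= b ->
  `|b^-1 - a^-1 - (b - a) * (- (a ^+ 2)^-1)| <= (b - a) ^+ 2 * (2 / a ^+ 3).
Proof.
move=> a0 ab; have a20 : 0 < a / 2 by rewrite divr_gt0.
have b0 : 0 < b by exact: lt_le_trans ab.
have -> : b^-1 - a^-1 - (b - a) * (- (a ^+ 2)^-1) = (b - a) ^+ 2 * (b^-1 / a ^+ 2).
  by field; rewrite !gt_eqF.
have p0 : 0 <= b^-1 / a ^+ 2.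
  by rewrite ltW// divr_gt0 ?invr_gt0// exprn_gt0.
rewrite ger0_norm; last by rewrite mulr_ge0// sqr_ge0.
apply: ler_wpM2l; first exact: sqr_ge0.
have -> : 2 / a ^+ 3 = (a / 2)^-1 / a ^+ 2 by field; rewrite gt_eqF.
by rewrite ler_wpM2r ?invr_ge0 ?sqr_ge0// lef_pV2 ?posrE.
Qed.

(** The outer function does not depend on the parameter; a quadratic Taylor
bound near the values of F l is all that the composition uses. *)
Lemma qdiff_outer D (phi phi' : R -> R) F f l (Q rho : R) : 0 <= Q -> 0 < rho ->
  (forall x, D x -> [/\ `|phi (F l x)| <= Q, `|phi' (F l x)| <= Q &
     forall b, `|b - F l x| <= rho ->
       `|phi b - phi (F l x) - (b - F l x) * phi' (F l x)| <= Q * (b - F l x) ^+ 2]) ->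
  qdiff D F f l ->
  qdiff D (fun l x => phi (F l x)) (fun x => phi' (F l x) * f x) l.
Proof.
move=> Q0 rho0 Hphi /qdiffP[K K0 [d /andP[d0 d1] H]].
exists (Q + Q * K + Q * K ^+ 2 + Q * K); first by rewrite !addr_ge0 ?mulr_ge0 ?sqr_ge0.
exists (Num.min d (rho / (K + 1))) => [|l' x].
  by rewrite lt_min d0 divr_gt0// ltr_wpDl.
rewrite lt_min => /andP[ld lr] Dx; have [h1 h2 h3 h4] := H l' x ld Dx.
have [p1 p2 p3] := Hphi x Dx.
have q1 : 0 <= Q * K by exact: mulr_ge0.
have q2 : 0 <= Q * K ^+ 2 by rewrite mulr_ge0 ?sqr_ge0.
split.
- by lra.
- by rewrite normrM; apply: (@le_trans _ _ (Q * K)); [exact: ler_pM|lra].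
have hr : `|F l' x - F l x| <= rho.
  apply: (le_trans h4); move: lr; rewrite ltr_pdivlMr ?ltr_wpDl// => /ltW.
  by apply: le_trans; rewrite mulrC ler_wpM2l// lerDl.
have -> : phi (F l' x) - phi (F l x) - (l' - l) * (phi' (F l x) * f x) =
  (phi (F l' x) - phi (F l x) - (F l' x - F l x) * phi' (F l x))
  + phi' (F l x) * (F l' x - F l x - (l' - l) * f x) by ring.
apply: (le_trans (ler_normD _ _)).
have e1 : Q * (F l' x - F l x) ^+ 2 <= Q * K ^+ 2 * (l' - l) ^+ 2.
  rewrite -mulrA ler_wpM2l// -[leLHS]ger0_norm ?sqr_ge0// -exprMn.
  rewrite -[leRHS]ger0_norm ?sqr_ge0// !normrX normrM (ger0_norm K0).
  by rewrite lerXn2r ?nnegrE ?mulr_ge0.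
have e2 : `|phi' (F l x) * (F l' x - F l x - (l' - l) * f x)| <= Q * K * (l' - l) ^+ 2.
  by rewrite normrM -mulrA; exact: ler_pM.
have e3 := p3 _ hr.
have s0 := sqr_ge0 (l' - l).
have e4 : 0 <= Q * (l' - l) ^+ 2 by exact: mulr_ge0.
have e5 : 0 <= Q * K * (l' - l) ^+ 2 by exact: mulr_ge0.
apply: (le_trans (lerD (le_trans e3 e1) e2)); move: e4 e5.
by move: ((l' - l) ^+ 2) => z; lra.
Qed.

Lemma qdiffV D F f l (m : R) : 0 < m -> (forall x, D x -> m <= F l x) ->
  qdiff D F f l ->
  qdiff D (fun l x => (F l x)^-1) (fun x => - (F l x ^+ 2)^-1 * f x) l.
Proof.
move=> m0 Fm; pose Q := m^-1 + (m ^+ 2)^-1 + 2 / m ^+ 3.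
have i0 : 0 <= m^-1 by rewrite invr_ge0 ltW.
have i1 : 0 <= (m ^+ 2)^-1 by rewrite invr_ge0 sqr_ge0.
have i2 : 0 <= 2 / m ^+ 3 by rewrite divr_ge0// exprn_ge0// ltW.
apply: (@qdiff_outer D (fun y => y^-1) (fun y => - (y ^+ 2)^-1) F f l Q (m / 2)).
- by rewrite /Q !addr_ge0.
- by rewrite divr_gt0.
move=> x Dx; have mF := Fm x Dx; have F0 : 0 < F l x by exact: lt_le_trans mF.
split.
- rewrite gtr0_norm ?invr_gt0//; apply: (@le_trans _ _ m^-1).
    by rewrite lef_pV2.
  by rewrite /Q; lra.
- rewrite normrN gtr0_norm ?invr_gt0 ?exprn_gt0//; apply: (@le_trans _ _ (m ^+ 2)^-1).
    by rewrite lef_pV2 ?posrE ?exprn_gt0// lerXn2r// nnegrE// ltW.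
  by rewrite /Q; lra.
move=> b bF; have bF' : F l x / 2 <= b by move: bF; rewrite ler_norml; lra.
apply: (le_trans (inv_remainder F0 bF')); rewrite mulrC ler_wpM2r ?sqr_ge0//.
apply: (@le_trans _ _ (2 / m ^+ 3)); last by rewrite /Q; lra.
rewrite ler_wpM2l// lef_pV2 ?posrE ?exprn_gt0// lerXn2r// nnegrE; exact: ltW.
Qed.

Lemma qdiff_sqrt D F f l (m M : R) : 0 < m ->
  (forall x, D x -> m <= F l x <= M) -> qdiff D F f l ->
  qdiff D (fun l x => Num.sqrt (F l x))
    (fun x => (2 * Num.sqrt (F l x))^-1 * f x) l.
Proof.
move=> m0 Fm; pose s := Num.sqrt m; have s0 : 0 < s by rewrite sqrtr_gt0.
pose Q := Num.sqrt M + (2 * s)^-1 + (2 * s * m)^-1.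
have i0 : 0 <= Num.sqrt M by exact: sqrtr_ge0.
have i1 : 0 <= (2 * s)^-1 by rewrite invr_ge0 mulr_ge0// ltW.
have i2 : 0 <= (2 * s * m)^-1 by rewrite invr_ge0 !mulr_ge0// ltW.
apply: (@qdiff_outer D (fun y => Num.sqrt y) (fun y => (2 * Num.sqrt y)^-1) F f l Q m).
- by rewrite /Q !addr_ge0.
- by [].
move=> x Dx; have /andP[mF FM] := Fm x Dx; have F0 : 0 < F l x by exact: lt_le_trans mF.
have sF : 0 < Num.sqrt (F l x) by rewrite sqrtr_gt0.
have ssF : s <= Num.sqrt (F l x) by exact: ler_wsqrtr.
split.
- rewrite ger0_norm ?sqrtr_ge0//; apply: (@le_trans _ _ (Num.sqrt M)).
    exact: ler_wsqrtr.
  by rewrite /Q; lra.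
- rewrite gtr0_norm ?invr_gt0 ?mulr_gt0//; apply: (@le_trans _ _ (2 * s)^-1).
    by rewrite lef_pV2 ?posrE ?mulr_gt0// ler_pM2l.
  by rewrite /Q; lra.
move=> b bF; have b0 : 0 <= b by move: bF; rewrite ler_norml; lra.
apply: (le_trans (sqrt_remainder F0 b0)); rewrite mulrC ler_wpM2r ?sqr_ge0//.
apply: (@le_trans _ _ (2 * s * m)^-1); last by rewrite /Q; lra.
rewrite lef_pV2 ?posrE ?mulr_gt0//; apply: ler_pM => //.
- by rewrite ltW// mulr_gt0.
- exact: ltW.
- by rewrite ler_pM2l.
Qed.

Definition sdiff (c : R -> R) (c' l : R) : Prop :=
  qdiff (fun=> True) (fun l _ => c l) (fun=> c') l.

Lemma sdiff_qdiff D c c' l : sdiff c c' l -> qdiff D (fun l _ => c l) (fun=> c') l.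
Proof. exact: qdiff_sub. Qed.

Lemma sdiff_dv c c' l : sdiff c c' l -> dv c l c'.
Proof.
case=> K K0 [d d0 H]; apply: (@dv_quad _ c l c' K d d0) => t td.
have [|_ _] := H (l + t) 0 _ I; first by rewrite [l + t]addrC addrK.
by rewrite [l + t - l]addrC addKr.
Qed.

Lemma qdiff_comp D F f c c' l : qdiff D F f (c l) -> sdiff c c' l ->
  qdiff D (fun l x => F (c l) x) (fun x => f x * c') l.
Proof.
move=> /qdiffP[K K0 [d /andP[d0 d1] H]] /qdiffP[Q Q0 [e /andP[e0 e1] Hc]].
exists (K + K * Q + K * Q ^+ 2 + K * Q).
  by rewrite !addr_ge0 ?mulr_ge0 ?sqr_ge0.
exists (Num.min e (d / (Q + 1))) => [|l' x].
  by rewrite lt_min e0 divr_gt0// ltr_wpDl.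
rewrite lt_min => /andP[le lr] Dx; have [c1 c2 c3 c4] := Hc l' x le I.
have cd : `|c l' - c l| < d.
  apply: (le_lt_trans c4); move: lr; rewrite ltr_pdivlMr ?ltr_wpDl//.
  by apply: le_lt_trans; rewrite mulrC ler_wpM2l// lerDl.
have [h1 h2 h3 h4] := H (c l') x cd Dx.
have q1 : 0 <= K * Q by exact: mulr_ge0.
have q2 : 0 <= K * Q ^+ 2 by rewrite mulr_ge0 ?sqr_ge0.
split.
- by lra.
- by rewrite normrM; apply: (@le_trans _ _ (K * Q)); [exact: ler_pM|lra].
have -> : F (c l') x - F (c l) x - (l' - l) * (f x * c') =
  (F (c l') x - F (c l) x - (c l' - c l) * f x)
  + f x * (c l' - c l - (l' - l) * c') by ring.
apply: (le_trans (ler_normD _ _)).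
have e1' : K * (c l' - c l) ^+ 2 <= K * Q ^+ 2 * (l' - l) ^+ 2.
  rewrite -mulrA ler_wpM2l// -[leLHS]ger0_norm ?sqr_ge0// -exprMn.
  rewrite -[leRHS]ger0_norm ?sqr_ge0// !normrX normrM (ger0_norm Q0).
  by rewrite lerXn2r ?nnegrE ?mulr_ge0.
have e2 : `|f x * (c l' - c l - (l' - l) * c')| <= K * Q * (l' - l) ^+ 2.
  by rewrite normrM -mulrA; exact: ler_pM.
have s0 := sqr_ge0 (l' - l).
have e4 : 0 <= K * (l' - l) ^+ 2 by exact: mulr_ge0.
have e5 : 0 <= K * Q * (l' - l) ^+ 2 by exact: mulr_ge0.
apply: (le_trans (lerD (le_trans h3 e1') e2)); move: e4 e5.
by move: ((l' - l) ^+ 2) => z; lra.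
Qed.

Lemma prim_bound f (M : R) y : continuous f ->
  (forall t, `|t| <= `|y| -> `|f t| <= M) -> `|prim f y| <= M * `|y|.
Proof.
move=> cf fM; have p0 := prim0 cf; have [y0|y0] := leP 0 y.
  have := @prim_le_cst _ f M 0 y cf y0; rewrite p0 !subr0 [`|y|]ger0_norm//.
  by apply=> t ty; apply: fM; rewrite !ger0_norm; lra.
have := @prim_le_cst _ f M y 0 cf (ltW y0).
rewrite p0 !sub0r normrN [`|y|]ltr0_norm//; apply=> t ty.
by apply: fM; rewrite !ler0_norm; lra.
Qed.

Definition absle (B : R) : R -> Prop := fun x => `|x| <= B.

Lemma qdiff_prim (B : R) F f l : 0 <= B -> continuous f ->
  (exists2 d : R, 0 < d & forall l', `|l' - l| < d -> continuous (F l')) ->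
  qdiff (absle B) F f l ->
  qdiff (absle B) (fun l y => prim (F l) y) (fun y => prim f y) l.
Proof.
move=> B0 cf [e e0 cF] [K K0 [d d0 H]].
exists (K * B); first exact: mulr_ge0.
exists (Num.min d e) => [|l' y]; first by rewrite lt_min d0.
rewrite lt_min => /andP[ld le] By.
have cl : continuous (F l) by apply: cF; rewrite subrr normr0.
have cl' := cF _ le.
have P g M : continuous g -> 0 <= M -> (forall t, `|t| <= B -> `|g t| <= M) ->
    `|prim g y| <= M * B.
  move=> cg M0 gM; apply: (@le_trans _ _ (M * `|y|)); last by rewrite ler_wpM2l.
  by apply: prim_bound => // t ty; apply: gM; exact: le_trans By.
split.
- by apply: P => // t tB; have [] := H l' t ld tB.
- by apply: P => // t tB; have [] := H l' t ld tB.
have -> : prim (F l') y - prim (F l) y - (l' - l) * prim f y =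
    prim (fun t => F l' t - F l t - (l' - l) * f t) y.
  rewrite primB ?primZ ?primB//; [exact: continuousB'|].
  exact: continuousM' (@continuous_cst' R (l' - l)) cf.
rewrite -mulrA [B * _]mulrC mulrA; apply: P.
- by cts.
- by rewrite mulr_ge0 ?sqr_ge0.
by move=> t tB; have [] := H l' t ld tB.
Qed.

Lemma prim_mvt b (B u v : R) : continuous b -> `|u| <= B -> `|v| <= B ->
  exists2 xi, `|xi| <= B /\ `|xi - u| <= `|v - u| &
    prim b v - prim b u = b xi * (v - u).
Proof.
move=> cb uB vB.
have cp : forall u v, {within `[u, v], continuous (prim b)}.
  by move=> ? ?; exact/cont_within/continuous_prim.
have [ab|/ltW ab] := leP u v.
  have [c cab ->] := mvt ab (cp _ _) (fun x _ => dv_prim x cb); exists c => //.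
  split; first by move: uB vB; rewrite !ler_norml; lra.
  by case/andP: cab => ? ?; rewrite !ger0_norm ?subr_ge0// lerD2r.
have [c cab E] := mvt ab (cp _ _) (fun x _ => dv_prim x cb); exists c => //.
  split; first by move: uB vB; rewrite !ler_norml; lra.
  by case/andP: cab => ? ?; rewrite !ler0_norm ?subr_le0// lerN2 lerD2r.
by apply: oppr_inj; rewrite opprB E -mulrN opprB.
Qed.

(** Leibniz' rule for an integral with a moving end point. *)
Lemma qdiff_prim_end D (B L : R) b bdot Y (y : R -> R) l : 0 <= B -> 0 <= L ->
  continuous bdot ->
  (exists2 d : R, 0 < d & forall l', `|l' - l| < d -> continuous (b l')) ->
  qdiff (absle B) b bdot l ->
  (forall r r', `|r| <= B -> `|r'| <= B -> `|b l r - b l r'| <= L * `|r - r'|) ->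
  qdiff D Y y l ->
  (exists2 d : R, 0 < d & forall l' x, `|l' - l| < d -> D x -> `|Y l' x| <= B) ->
  qdiff D (fun l x => prim (b l) (Y l x))
    (fun x => prim bdot (Y l x) + b l (Y l x) * y x) l.
Proof.
move=> B0 L0 cbd cb db lip dY [d1 d10 YB].
have dP := qdiff_prim B0 cbd cb db.
case: cb => d2 d20 cb.
have /qdiffP[K1 K10 [e1 /andP[e10 _] H1]] := db.
have /qdiffP[K2 K20 [e2 /andP[e20 _] H2]] := dY.
have /qdiffP[K3 K30 [e3 /andP[e30 _] H3]] := dP.
pose M := K3 + K1 * K2 + K2 * (K1 + L * K2).
have m0 : 0 <= K1 * K2 by exact: mulr_ge0.
have m1 : 0 <= K2 * (K1 + L * K2) by rewrite mulr_ge0// addr_ge0// mulr_ge0.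
exists M; first by rewrite /M !addr_ge0.
exists (Num.min (Num.min d1 d2) (Num.min e1 (Num.min e2 e3))) => [|l' x].
  by rewrite !lt_min d10 d20 e10 e20.
rewrite !lt_min => /andP[/andP[ld1 ld2] /and3P[le1 le2 le3]] Dx.
have Yl : `|Y l x| <= B by apply: YB => //; rewrite subrr normr0.
have Yl' : `|Y l' x| <= B by exact: YB.
have [a1 a2 a3 a4] := H3 l' (Y l x) le3 Yl.
have [b1 b2 b3 b4] := H1 l' (Y l x) le1 Yl.
have [c1 c2 c3 c4] := H2 l' x le2 Dx.
split.
- by apply: (le_trans a1); rewrite /M -addrA lerDl addr_ge0.
- apply: (le_trans (ler_normD _ _)); apply: (@le_trans _ _ (K3 + K1 * K2)).
    by apply: lerD => //; rewrite normrM; exact: ler_pM.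
  by rewrite /M lerDl.
have cb' := cb _ ld2.
have [xi xiB xiE] := prim_mvt cb' Yl Yl'.
case: xiB => xiB xiY.
have -> : prim (b l') (Y l' x) - prim (b l) (Y l x)
    - (l' - l) * (prim bdot (Y l x) + b l (Y l x) * y x) =
  (prim (b l') (Y l x) - prim (b l) (Y l x) - (l' - l) * prim bdot (Y l x))
  + (b l (Y l x) * (Y l' x - Y l x - (l' - l) * y x)
  + (b l' xi - b l (Y l x)) * (Y l' x - Y l x)).
  rewrite -[prim (b l') (Y l' x)](subrK (prim (b l') (Y l x))) xiE; ring.
apply: (le_trans (ler_normD _ _)).
apply: (le_trans (lerD (lexx _) (ler_normD _ _))).
have e2' : `|b l (Y l x) * (Y l' x - Y l x - (l' - l) * y x)| <= K1 * K2 * (l' - l) ^+ 2.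
  by rewrite normrM -mulrA; exact: ler_pM.
have bx : `|b l' xi - b l (Y l x)| <= (K1 + L * K2) * `|l' - l|.
  have -> : b l' xi - b l (Y l x) = (b l' xi - b l xi) + (b l xi - b l (Y l x)) by ring.
  apply: (le_trans (ler_normD _ _)); rewrite mulrDl; apply: lerD.
    by have [] := H1 l' xi le1 xiB.
  apply: (le_trans (lip _ _ xiB Yl)); rewrite -mulrA ler_wpM2l//.
  exact: le_trans xiY c4.
have e3' : `|(b l' xi - b l (Y l x)) * (Y l' x - Y l x)| <=
    K2 * (K1 + L * K2) * (l' - l) ^+ 2.
  have -> : K2 * (K1 + L * K2) * (l' - l) ^+ 2 =
      (K1 + L * K2) * `|l' - l| * (K2 * `|l' - l|).
    have -> : (l' - l) ^+ 2 = `|l' - l| ^+ 2 by rewrite -normrX ger0_norm ?sqr_ge0.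
    by ring.
  by rewrite normrM; exact: ler_pM.
apply: (le_trans (lerD a3 (lerD e2' e3'))); rewrite /M.
by rewrite le_eqVlt; apply/orP; left; apply/eqP; ring.
Qed.

(** The implicit function theorem for prim (b l) (Y l x) = T l x, where b is
bounded away from zero. *)
Lemma qdiff_implicit D (B L m : R) b bdot Y T (t : R -> R) l : 0 <= B -> 0 <= L ->
  0 < m -> continuous bdot ->
  (exists2 d : R, 0 < d & forall l', `|l' - l| < d ->
     continuous (b l') /\ forall r, `|r| <= B -> m <= b l' r) ->
  qdiff (absle B) b bdot l ->
  (forall r r', `|r| <= B -> `|r'| <= B -> `|b l r - b l r'| <= L * `|r - r'|) ->
  qdiff D T t l ->
  (exists2 d : R, 0 < d & forall l' x, `|l' - l| < d -> D x ->
     `|Y l' x| <= B /\ prim (b l') (Y l' x) = T l' x) ->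
  qdiff D Y (fun x => (t x - prim bdot (Y l x)) / b l (Y l x)) l.
Proof.
move=> B0 L0 m0 cbd [d2 d20 cb] db lip dT [d1 d10 YB].
have dP : qdiff (absle B) (fun l y => prim (b l) y) (fun y => prim bdot y) l.
  by apply: qdiff_prim => //; exists d2 => // l' /cb[].
have /qdiffP[K1 K10 [e1 /andP[e10 _] H1]] := db.
have /qdiffP[K2 K20 [e2 /andP[e20 _] H2]] := dT.
have /qdiffP[K3 K30 [e3 /andP[e30 _] H3]] := dP.
pose L2 := (K2 + K3) / m.
have L20 : 0 <= L2 by rewrite divr_ge0 ?addr_ge0// ltW.
pose M := (K2 + K3 + L2 * (K1 + L * L2)) / m.
have m1 : 0 <= L2 * (K1 + L * L2) by rewrite mulr_ge0// addr_ge0// mulr_ge0.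
have ML2 : L2 <= M by rewrite /L2 /M ler_pM2r ?invr_gt0// lerDl.
exists (B + M); first by rewrite addr_ge0// (le_trans L20).
exists (Num.min (Num.min d1 d2) (Num.min e1 (Num.min e2 e3))) => [|l' x].
  by rewrite !lt_min d10 d20 e10 e20.
rewrite !lt_min => /andP[/andP[ld1 ld2] /and3P[le1 le2 le3]] Dx.
have [Yl El] : `|Y l x| <= B /\ prim (b l) (Y l x) = T l x.
  by apply: YB => //; rewrite subrr normr0.
have [Yl' El'] := YB _ _ ld1 Dx.
have [a1 a2 a3 a4] := H3 l' (Y l x) le3 Yl.
have [b1 b2 b3 b4] := H1 l' (Y l x) le1 Yl.
have [c1 c2 c3 c4] := H2 l' x le2 Dx.
have [cb' mb'] := cb _ ld2.
have [cbl mbl] : continuous (b l) /\ forall r, `|r| <= B -> m <= b l r.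
  by apply: cb; rewrite subrr normr0.
have bm := mbl _ Yl; have b0 : 0 < b l (Y l x) by exact: lt_le_trans bm.
have ib : 0 < (b l (Y l x))^-1 <= m^-1 by rewrite invr_gt0 b0 lef_pV2.
have [ib0 ibm] := andP ib.
have [xi [xiB xiY] xiE] := prim_mvt cb' Yl Yl'.
have bxi := mb' _ xiB; have bxi0 : 0 < b l' xi by exact: lt_le_trans bxi.
have E1 : b l' xi * (Y l' x - Y l x) =
    (T l' x - T l x) - (prim (b l') (Y l x) - prim (b l) (Y l x)).
  by rewrite -xiE El' El; ring.
have s1 : `|Y l' x - Y l x| <= L2 * `|l' - l|.
  rewrite /L2 mulrAC ler_pdivlMr// mulrC.
  apply: (@le_trans _ _ (`|b l' xi * (Y l' x - Y l x)|)).
    by rewrite normrM (gtr0_norm bxi0) ler_wpM2r.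
  by rewrite E1 mulrDl; apply: (le_trans (ler_normB _ _)); exact: lerD.
have bx : `|b l' xi - b l (Y l x)| <= (K1 + L * L2) * `|l' - l|.
  have -> : b l' xi - b l (Y l x) = (b l' xi - b l xi) + (b l xi - b l (Y l x)) by ring.
  apply: (le_trans (ler_normD _ _)); rewrite mulrDl; apply: lerD.
    by have [] := H1 l' xi le1 xiB.
  apply: (le_trans (lip _ _ xiB Yl)); rewrite -mulrA ler_wpM2l//.
  exact: le_trans xiY s1.
split.
- by rewrite (le_trans Yl)// lerDl (le_trans L20).
- rewrite normrM (gtr0_norm ib0); apply: (@le_trans _ _ L2).
    by apply: ler_pM => //; [exact: ltW|apply: (le_trans (ler_normB _ _)); exact: lerD].
  by apply: (le_trans ML2); rewrite lerDr.
have -> : Y l' x - Y l x - (l' - l) * ((t x - prim bdot (Y l x)) / b l (Y l x)) =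
  ((T l' x - T l x - (l' - l) * t x)
   - (prim (b l') (Y l x) - prim (b l) (Y l x) - (l' - l) * prim bdot (Y l x))
   - (b l' xi - b l (Y l x)) * (Y l' x - Y l x)) / b l (Y l x).
  rewrite [(b l' xi - b l (Y l x)) * _]mulrBl E1; move: b0.
  move: (b l (Y l x)) (prim _ _) (prim _ _) (prim _ _).
  by move=> z p1 p2 p3 z0; field; rewrite gt_eqF.
have e3' : `|(b l' xi - b l (Y l x)) * (Y l' x - Y l x)| <=
    L2 * (K1 + L * L2) * (l' - l) ^+ 2.
  have -> : L2 * (K1 + L * L2) * (l' - l) ^+ 2 =
      (K1 + L * L2) * `|l' - l| * (L2 * `|l' - l|).
    have -> : (l' - l) ^+ 2 = `|l' - l| ^+ 2 by rewrite -normrX ger0_norm ?sqr_ge0.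
    by ring.
  by rewrite normrM; exact: ler_pM.
rewrite normrM (gtr0_norm ib0).
apply: (@le_trans _ _ (M * (l' - l) ^+ 2)); last first.
  by rewrite ler_wpM2r ?sqr_ge0// lerDr.
rewrite /M mulrAC; apply: ler_pM => //; first exact: ltW.
apply: (le_trans (ler_normB _ _)); rewrite [leRHS]mulrDl; apply: lerD => //.
by rewrite [leRHS]mulrDl; apply: (le_trans (ler_normB _ _)); exact: lerD.
Qed.

(** Monotonicity brackets the value of g, which gives its continuity; the
expansion of f at g l is then solved for the increment of g. *)
Lemma sdiff_inverse (f g : R -> R) a l :
  (forall c c' : R, 0 < c -> c < c' -> f c' < f c) ->
  (forall l', 0 < l' -> 0 < g l' /\ f (g l') = l') -> 0 < l ->
  sdiff f a (g l) -> a < 0 -> sdiff g a^-1 l.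
Proof.
move=> fdec gP l0 /qdiffP[K K0 [e /andP[e0 e1] H]] a0.
have [c0 fc] := gP l l0; set c := g l in c0 fc H *.
pose rho := Num.min (Num.min (e / 2) (c / 2)) (- a / (2 * (K + 1))).
have K1 : 0 < K + 1 by rewrite ltr_wpDl.
have rho0 : 0 < rho by rewrite !lt_min !divr_gt0 ?oppr_gt0 ?mulr_gt0.
have rho1 : rho <= e / 2 by rewrite /rho !ge_min lexx.
have rho2 : rho <= c / 2 by rewrite /rho !ge_min lexx orbT.
have rho3 : rho * (2 * (K + 1)) <= - a.
  by rewrite -ler_pdivlMr ?mulr_gt0// /rho ge_min lexx orbT.
clearbody rho.
pose d := Num.min (Num.min (f (c - rho) - l) (l - f (c + rho))) l.
have d0 : 0 < d.
  rewrite !lt_min !subr_gt0 l0 -fc.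
  by rewrite !fdec//; [lra|lra|lra].
have near l' : `|l' - l| < d -> 0 < l' /\ `|g l' - c| < rho.
  rewrite !lt_min !ltr_norml => /andP[/andP[h1 h2] h3].
  have l'0 : 0 < l' by lra.
  split=> //; have [g0 fg] := gP _ l'0.
  apply/andP; split; rewrite ltNge; apply/negP => hg.
    rewrite lerBlDr addrC in hg; have : f (c - rho) <= l'.
      rewrite -fg; move: hg; rewrite le_eqVlt => /predU1P[->//|hh].
      by apply/ltW/fdec => //.
    lra.
  rewrite lerBrDr addrC in hg; have : l' <= f (c + rho).
    rewrite -fg; move: hg; rewrite le_eqVlt => /predU1P[->//|hh].
    by apply/ltW/fdec => //; lra.
  lra.
have ia : `|a^-1| = (- a)^-1 by rewrite ltr0_norm ?invr_lt0// invrN.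
have na0 : 0 < - a by rewrite oppr_gt0.
pose L := 2 / - a; have L0 : 0 < L by rewrite divr_gt0.
have lip l' : `|l' - l| < d -> `|g l' - c| <= L * `|l' - l|.
  move=> /near[l'0 gc]; have [g0 fg] := gP _ l'0.
  have ge : `|g l' - c| < e by lra.
  have [_ _ h _] := H (g l') 0 ge I.
  rewrite fg fc in h; rewrite /L mulrAC ler_pdivlMr//.
  have h2 : `|(g l' - c) * a| <= `|l' - l| + K * (g l' - c) ^+ 2.
    have -> : (g l' - c) * a = (l' - l) - (l' - l - (g l' - c) * a) by ring.
    by apply: (le_trans (ler_normB _ _)); rewrite lerD2l.
  rewrite normrM (ltr0_norm a0) in h2.
  have h3 : K * (g l' - c) ^+ 2 <= `|g l' - c| * (- a / 2).
    have -> : (g l' - c) ^+ 2 = `|g l' - c| * `|g l' - c|.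
      by rewrite -expr2 -normrX ger0_norm ?sqr_ge0.
    rewrite mulrCA ler_wpM2l//.
    have hk : K * `|g l' - c| <= (K + 1) * rho.
      by apply: ler_pM => //; [rewrite lerDl|exact: ltW].
    by lra.
  by move: h2 h3; move: (`|g l' - c|) (`|l' - l|) (K * _) => x y z; lra.
have ia0 : 0 <= (- a)^-1 by rewrite invr_ge0 ltW.
have q0 : 0 <= K * L ^+ 2 / - a.
  by apply: mulr_ge0 => //; rewrite mulr_ge0// sqr_ge0.
exists (c + (- a)^-1 + K * L ^+ 2 / - a); first by rewrite !addr_ge0// ltW.
exists d => // l' _ ld _.
rewrite -/c; split.
- by rewrite gtr0_norm// -addrA lerDl addr_ge0.
- by rewrite ia addrAC lerDr addr_ge0// ltW.
have [l'0 gc] := near _ ld; have [g0 fg] := gP _ l'0.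
have ge : `|g l' - c| < e by lra.
have [_ _ h _] := H (g l') 0 ge I; rewrite fg fc in h.
have -> : g l' - c - (l' - l) * a^-1 = (l' - l - (g l' - c) * a) * - a^-1.
  by field; rewrite lt_eqF.
rewrite normrM normrN ia; apply: (@le_trans _ _ (K * (g l' - c) ^+ 2 / - a)).
  by rewrite ler_wpM2r.
apply: (@le_trans _ _ (K * L ^+ 2 / - a * (l' - l) ^+ 2)); last first.
  by rewrite ler_wpM2r ?sqr_ge0// lerDr addr_ge0// ltW.
rewrite [leRHS]mulrAC ler_wpM2r// -mulrA ler_wpM2l//.
have -> : (g l' - c) ^+ 2 = `|g l' - c| ^+ 2 by rewrite -normrX ger0_norm ?sqr_ge0.
have -> : (l' - l) ^+ 2 = `|l' - l| ^+ 2 by rewrite -normrX ger0_norm ?sqr_ge0.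
by rewrite -exprMn lerXn2r ?nnegrE ?mulr_ge0 ?lip// ltW.
Qed.

End UniformDifferentiability.

(** * The double well and its primitives *)

Section Profile.
Context {R : realType}.
Implicit Types (c r t x y l K M L : R) (k n : nat).

Definition ramp t : R := Num.max 0 t.

Lemma ramp_ge0 t : 0 <= ramp t.
Proof. by rewrite /ramp le_max lexx. Qed.

Lemma ramp_sq t t' : `|ramp t' ^+ 2 - ramp t ^+ 2 - 2 * ramp t * (t' - t)| <= (t' - t) ^+ 2.
Proof.
rewrite ler_norml /ramp !maxEle; have := sqr_ge0 (t' - t).
by case: ifPn; case: ifPn; rewrite -?ltNge; nra.
Qed.

Lemma ramp_lip t t' : `|ramp t' - ramp t| <= `|t' - t|.
Proof.
have h1 := ler_norm (t' - t); have h2 := lerNnormlW (lexx `|t' - t|).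
by rewrite ler_norml /ramp !maxEle; case: ifPn; case: ifPn; rewrite -?ltNge; lra.
Qed.

(** Cutting the parabola off at 0 makes the double well C^1 and bounded on the
whole line, so that q' = - l * sqrt (P(q) + c) is solvable globally; on
[-2, 2], where the solution lives, nothing changes. *)
Definition well r : R := ramp (4 - r ^+ 2).

Definition dblwell r : R := well r ^+ 2 / 2.

Lemma well_ge0 r : 0 <= well r. Proof. exact: ramp_ge0. Qed.

Lemma well_le4 r : well r <= 4.
Proof. by rewrite /well /ramp ge_max; have := sqr_ge0 r; lra. Qed.

Lemma wellE r : `|r| <= 2 -> well r = 4 - r ^+ 2.
Proof.
move=> r2; rewrite /well /ramp max_r// subr_ge0.
have r0 := normr_ge0 r; have -> : r ^+ 2 = `|r| ^+ 2.
  by rewrite -normrX ger0_norm ?sqr_ge0.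
nra.
Qed.

Lemma wellN r : well (- r) = well r. Proof. by rewrite /well sqrrN. Qed.

Lemma continuous_well : continuous well.
Proof.
move=> r; have c4 : continuous (fun r : R => 4 - r ^+ 2) by cts.
apply: (@continuous_comp _ _ _ (fun r : R => 4 - r ^+ 2) ramp); first exact: c4.
apply/cvgrPdist_le => e e0; near=> t.
rewrite distrC; apply: (le_trans (ramp_lip _ _)); rewrite distrC.
by near: t; exact: cvgr_dist_le.
Unshelve. all: by end_near. Qed.

Lemma dblwell_ge0 r : 0 <= dblwell r.
Proof. by rewrite /dblwell divr_ge0 ?sqr_ge0. Qed.

Lemma dblwell_le8 r : dblwell r <= 8.
Proof. by rewrite /dblwell; have := well_ge0 r; have := well_le4 r; nra. Qed.

Lemma dblwellN r : dblwell (- r) = dblwell r. Proof. by rewrite /dblwell wellN. Qed.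

Lemma dv_sqramp t : dv (fun t => ramp t ^+ 2) t (2 * ramp t).
Proof.
apply: (@dv_quad _ _ t (2 * ramp t) 1 1) => // s _.
have := ramp_sq t (t + s); rewrite mul1r [t + s]addrC addrK.
by rewrite [s * _]mulrC.
Qed.

Lemma dv_dblwell r : dv dblwell r (- 2 * r * well r).
Proof.
have d4 : dv (fun r : R => 4 - r ^+ 2) r (0 - 2%:R * r ^+ 1 * 1).
  by apply: dvB; [exact: dv_cst|apply: (@dvX _ 1); exact: dv_id].
have := dvZ (2^-1) (@dv_comp _ (fun t => ramp t ^+ 2) (fun r => 4 - r ^+ 2) _ _ _
  (dv_sqramp (4 - r ^+ 2)) d4).
move=> h; apply: (dv_ext _ (dv_eq h _)) => [y|]; first by rewrite mulrC.
by rewrite -/(well r) expr1; field.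
Qed.

Definition wgt c r : R := Num.sqrt (dblwell r + c).

Lemma wgt_sq c r : 0 < c -> wgt c r ^+ 2 = dblwell r + c.
Proof. by move=> c0; rewrite sqr_sqrtr// addr_ge0 ?dblwell_ge0// ltW. Qed.

Lemma wgt_gt0 c r : 0 < c -> 0 < wgt c r.
Proof. by move=> c0; rewrite sqrtr_gt0 ltr_wpDl// dblwell_ge0. Qed.

Lemma wgt_bounds c r : 0 < c -> Num.sqrt c <= wgt c r <= Num.sqrt (8 + c).
Proof.
move=> c0; have d0 := dblwell_ge0 r; have d8 := dblwell_le8 r.
by rewrite !ler_wsqrtr//; lra.
Qed.

Lemma wgtN c r : wgt c (- r) = wgt c r. Proof. by rewrite /wgt dblwellN. Qed.

Lemma dv_sqrt (a : R) : 0 < a -> dv Num.sqrt a (2 * Num.sqrt a)^-1.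
Proof.
move=> a0; apply: (@dv_quad _ _ a _ (2 * Num.sqrt a * a)^-1 a) => // t ta.
have at0 : 0 <= a + t by move: ta; rewrite ltr_norml; lra.
have := sqrt_remainder a0 at0; rewrite [a + t - a]addrC addKr.
by rewrite [_^-1 * _]mulrC.
Qed.

Lemma dv_wgt c r : 0 < c -> dv (wgt c) r (- r * well r / wgt c r).
Proof.
move=> c0; have w0 := wgt_gt0 r c0.
have d1 : dv (fun r => dblwell r + c) r (- 2 * r * well r + 0).
  by apply: dvD; [exact: dv_dblwell|exact: dv_cst].
have s0 : 0 < dblwell r + c by rewrite ltr_wpDl// dblwell_ge0.
have := @dv_comp _ Num.sqrt (fun r => dblwell r + c) _ _ _ (dv_sqrt s0) d1.
rewrite -/(wgt c r) => /dv_eq; apply.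
by field; rewrite gt_eqF.
Qed.

Lemma continuous_wgt c : 0 < c -> continuous (wgt c).
Proof. by move=> c0; apply: dv_continuous => r; exact: dv_wgt. Qed.

(** The integrands (P + c)^(-(2 k + 1) / 2); each is, up to a factor, the
derivative of the previous one with respect to c. *)
Definition ker k c r : R := (wgt c r)^-1 ^+ k.*2.+1.

Lemma ker_gt0 k c r : 0 < c -> 0 < ker k c r.
Proof. by move=> c0; rewrite exprn_gt0// invr_gt0 wgt_gt0. Qed.

Lemma kerN k c r : ker k c (- r) = ker k c r. Proof. by rewrite /ker wgtN. Qed.

Lemma continuous_ker k c : 0 < c -> continuous (ker k c).
Proof.
move=> c0; apply: continuousX' => r; apply: cvgV; last exact: continuous_wgt.
by rewrite gt_eqF// wgt_gt0.
Qed.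

Lemma dv_ker k c r : 0 < c ->
  dv (ker k c) r (k.*2.+1%:R * (wgt c r)^-1 ^+ k.*2 *
    (r * well r * (wgt c r)^-1 ^+ 3)).
Proof.
move=> c0; have w0 := wgt_gt0 r c0.
have wn : wgt c r != 0 by rewrite gt_eqF.
apply: (dv_eq (dvX k.*2 (dvV wn (dv_wgt r c0)))); congr (_ * _).
by field.
Qed.

Lemma ker_lip k c : 0 < c -> exists2 L : R, 0 <= L &
  forall r r', `|r| <= 2 -> `|r'| <= 2 -> `|ker k c r - ker k c r'| <= L * `|r - r'|.
Proof.
move=> c0; have cw := continuous_wgt c0.
have ciw : continuous (fun r => (wgt c r)^-1).
  by move=> r; apply: cvgV; [rewrite gt_eqF// wgt_gt0|exact: cw].
have cd : continuous (fun r => k.*2.+1%:R * (wgt c r)^-1 ^+ k.*2 *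
    (r * well r * (wgt c r)^-1 ^+ 3)).
  have cwl := continuous_well; cts.
have le22 : (-2 : R) <= 2 by lra.
have [M M0 HM] := continuous_bounded le22 cd; exists M => // r r' r2 r'2.
wlog rr : r r' r2 r'2 / r' <= r => [hw|].
  have [rr|/ltW rr] := leP r' r; first exact: hw.
  by rewrite distrC [`|r - r'|]distrC; exact: hw.
have cw2 : {within `[r', r], continuous (ker k c)}.
  exact/cont_within/continuous_ker.
have [x xrr ->] := mvt rr cw2 (fun x _ => dv_ker k x c0).
rewrite normrM ler_wpM2r//; apply: HM.
by move: r2 r'2; rewrite !ler_norml; lra.
Qed.

Lemma qdiff_ker k c : 0 < c ->
  qdiff (absle 2) (ker k) (fun r => - (k%:R + 2^-1) * ker k.+1 c r) c.
Proof.
move=> c0; apply: (@qdiff_sub _ (fun=> True)) => //.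
have d1 : qdiff (fun=> True) (fun c r => dblwell r + c) (fun=> 1) c.
  have h1 : qdiff (fun=> True) (fun _ r => dblwell r) (fun=> 0) c.
    apply: qdiff_cst; exists 8 => r _; rewrite ger0_norm ?dblwell_ge0//.
    exact: dblwell_le8.
  have := qdiffD h1 (qdiff_id (fun=> True) c).
  by apply: qdiff_ext => // x _; rewrite add0r.
have d2 : qdiff (fun=> True) wgt (fun r => (2 * wgt c r)^-1 * 1) c.
  apply: (@qdiff_sqrt _ _ _ _ _ c (8 + c) c0 _ d1) => r _.
  by have := dblwell_ge0 r; have := dblwell_le8 r; lra.
have s0 : 0 < Num.sqrt c by rewrite sqrtr_gt0.
have d3 := @qdiffV _ _ _ _ _ _ s0
  (fun r _ => proj1 (andP (wgt_bounds r c0))) d2.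
apply: qdiff_ext (qdiffX k.*2 d3) => // r _.
have w0 := wgt_gt0 r c0; rewrite /ker doubleS !exprS -muln2 mulrS natrM.
by field; rewrite gt_eqF.
Qed.

Definition Gk k c y : R := prim (ker k c) y.

Lemma dv_Gk k c y : 0 < c -> dv (Gk k c) y (ker k c y).
Proof. by move=> c0; apply: dv_prim; exact: continuous_ker. Qed.

Lemma Gk0 k c : 0 < c -> Gk k c 0 = 0.
Proof. by move=> c0; apply: prim0; exact: continuous_ker. Qed.

Lemma Gk_lt k c y y' : 0 < c -> y < y' -> Gk k c y < Gk k c y'.
Proof.
move=> c0 yy; apply: (prim_gt0 (@continuous_ker k c c0) yy (c := y)).
- by rewrite lexx ltW.
- by move=> r _; rewrite ltW// ker_gt0.
- exact: ker_gt0.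
Qed.

Lemma Gk_inj k c : 0 < c -> injective (Gk k c).
Proof.
move=> c0 y y' E; apply/eqP; rewrite eq_le !leNgt.
by apply/andP; split; apply/negP => /(Gk_lt k c0); rewrite E ltxx.
Qed.

Lemma Gk_le k c y y' : 0 < c -> (Gk k c y <= Gk k c y') = (y <= y').
Proof.
move=> c0; apply/idP/idP; last first.
  by rewrite le_eqVlt => /predU1P[->//|/(Gk_lt k c0)/ltW].
by rewrite !leNgt; apply: contra; exact: Gk_lt.
Qed.

Lemma GkN k c y : 0 < c -> Gk k c (- y) = - Gk k c y.
Proof.
move=> c0; have cN : continuous (ker k c) .
  exact: continuous_ker.
have := @primEg _ (ker k c) (fun y => - Gk k c (- y)) 0 y cN.
rewrite -/(Gk k c) -/(Gk k c y) -/(Gk k c 0) oppr0 Gk0// subr0 oppr0 subr0.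
move=> ->; rewrite ?opprK// => x.
have dN : dv (fun y : R => - y) x (- 1) by apply: dvN; exact: dv_id.
apply: (dv_eq (dvN (dv_comp (dv_Gk k (- x) c0) dN))).
by rewrite mulrN1 opprK kerN.
Qed.

Lemma Gk_lower c y : 0 < c -> 0 <= y -> y / Num.sqrt (8 + c) <= Gk 0 c y.
Proof.
move=> c0 y0; have s0 : 0 < Num.sqrt (8 + c) by rewrite sqrtr_gt0; lra.
have := @prim_le _ (fun=> (Num.sqrt (8 + c))^-1) (ker 0 c) 0 y.
rewrite !prim_cst mulr0 subr0 -/(Gk 0 c y) -/(Gk 0 c 0) Gk0// subr0 mulrC.
apply=> //; [exact: continuous_cst'|exact: continuous_ker|].
move=> x _; rewrite /ker expr1 lef_pV2 ?posrE ?wgt_gt0//.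
by have /andP[] := wgt_bounds x c0.
Qed.

Lemma Gk_surj c t : 0 < c -> exists y, Gk 0 c y = t.
Proof.
move=> c0; wlog t0 : t / 0 <= t => [hw|].
  have [/hw//|/ltW t0] := leP 0 t.
  have [y Ey] := hw (- t) ltac:(by rewrite oppr_ge0).
  by exists (- y); rewrite GkN// Ey opprK.
have s0 : 0 < Num.sqrt (8 + c) by rewrite sqrtr_gt0; lra.
pose y := t * Num.sqrt (8 + c); have y0 : 0 <= y by rewrite mulr_ge0// ltW.
have Gy : t <= Gk 0 c y by have := Gk_lower c0 y0; rewrite /y mulfK ?gt_eqF.
have cG : {within `[0, y], continuous (Gk 0 c)}.
  exact/cont_within/continuous_prim/continuous_ker.
have [|z _ Ez] := IVT y0 cG (v := t); last by exists z.
by rewrite Gk0// min_l ?max_r ?t0// (le_trans t0).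
Qed.

Definition Ginv c t : R := xget 0 [set y | Gk 0 c y = t].

Lemma GinvK c t : 0 < c -> Gk 0 c (Ginv c t) = t.
Proof.
move=> c0; rewrite /Ginv; case: xgetP => [y _ //|].
by have [y Ey] := Gk_surj t c0; move=> /(_ y).
Qed.

Lemma GkK c y : 0 < c -> Ginv c (Gk 0 c y) = y.
Proof. by move=> c0; apply: (@Gk_inj 0 c c0); rewrite GinvK. Qed.

Lemma dv_Ginv c t : 0 < c -> dv (Ginv c) t (wgt c (Ginv c t)).
Proof.
move=> c0; have w0 := wgt_gt0 (Ginv c t) c0.
have k0 : ker 0 c (Ginv c t) != 0 by rewrite gt_eqF// ker_gt0.
have := @is_derive_inverse R (Gk 0 c) (Ginv c) (ker 0 c (Ginv c t)) (Ginv c t).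
rewrite GinvK// /ker expr1 invrK; apply.
- by near=> y; exact: GkK.
- by near=> y; exact: (continuous_prim (@continuous_ker 0 c c0)).
- by have := dv_Gk 0 (Ginv c t) c0; rewrite /dv /ker expr1.
- by rewrite invr_neq0// gt_eqF.
Unshelve. all: by end_near. Qed.

End Profile.

(** * The explicit solution *)

Section Branch.
Context {R : realType}.
Implicit Types (c r t x y l K M L : R) (k n : nat).

Lemma qdiff_at (D : R -> Prop) F f l x : D x -> qdiff D F f l ->
  sdiff (fun l => F l x) (f x) l.
Proof.
move=> Dx [K K0 [d d0 H]]; exists K => //; exists d => // l' _ ld _.
exact: H.
Qed.

(** The length of the interval on which the solution of q'^2 = P(q) + c
descends from 2 to -2 is twice this. *)
Definition halflength c : R := Gk 0 c 2.

Lemma halflength_decr c c' : 0 < c -> c < c' -> halflength c' < halflength c.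
Proof.
move=> c0 cc; have c'0 : 0 < c' by exact: lt_trans cc.
have w r : ker 0 c' r < ker 0 c r.
  rewrite /ker !expr1 ltf_pV2 ?posrE ?wgt_gt0// ltr_sqrt ?ltrD2l//.
  by rewrite ltr_wpDl// dblwell_ge0.
have ck := @continuous_ker R 0 c c0; have ck' := @continuous_ker R 0 c' c'0.
have cd : continuous (fun r => ker 0 c r - ker 0 c' r) by exact: continuousB'.
have h02 : (0 : R) < 2 by [].
have := prim_gt0 cd h02 (c := 0); rewrite !primB// !prim0// subrr => H.
rewrite -subr_gt0; apply: H; [by rewrite lexx ltW| |by rewrite subr_gt0].
by move=> r _; rewrite subr_ge0 ltW.
Qed.

Lemma halflength_le c : 0 < c -> halflength c <= 2 / Num.sqrt c.
Proof.
move=> c0; have s0 : 0 < Num.sqrt c by rewrite sqrtr_gt0.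
have := @prim_le _ (ker 0 c) (fun=> (Num.sqrt c)^-1) 0 2.
rewrite !prim_cst mulr0 subr0 -/(Gk 0 c 2) -/(Gk 0 c 0) Gk0// subr0 mulrC.
apply=> //; [exact: continuous_ker|exact: continuous_cst'|].
move=> x _; rewrite /ker expr1 lef_pV2 ?posrE ?wgt_gt0//.
by have /andP[] := wgt_bounds x c0.
Qed.

(** As c tends to 0 the length diverges logarithmically, because the double
well has a double zero at 2. *)
Lemma halflength_large l : exists2 c : R, 0 < c & l <= halflength c.
Proof.
(* for c = s^2, sqrt (P (r) + c) <= 3 (2 - r) + s on [0, 2] because
P (r) <= 8 (2 - r)^2; the inverse of the bound has a logarithm as primitive *)
pose s := expR (- (3 * l)); have s0 : 0 < s by exact: expR_gt0.
have s20 : 0 < s ^+ 2 by rewrite exprn_gt0.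
exists (s ^+ 2) => //; set c := s ^+ 2.
pose A r := 3 * (2 - r) + s.
have A0 r : r <= 2 -> 0 < A r by rewrite /A; lra.
have dA r : dv A r (3 * (0 - 1) + 0).
  apply: dvD; last exact: dv_cst.
  by apply: dvZ; apply: dvB; [exact: dv_cst|exact: dv_id].
have dH r : r <= 2 -> dv (fun r => Gk 0 c r + 3^-1 * ln (A r)) r (ker 0 c r - (A r)^-1).
  move=> r2; have h1 : dv (@ln R) (A r) (A r)^-1 by exact: (is_derive1_ln (A0 r r2)).
  have h2 := dvD (dv_Gk 0 r s20) (dvZ (3^-1) (@dv_comp _ (@ln R) A _ _ _ h1 (dA r))).
  apply: (dv_eq h2); congr (_ + _); have := A0 r r2; move: (A r) => a a0.
  by field; rewrite gt_eqF.
have h02 : (0 : R) <= 2 by [].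
have cH : {within `[0, 2], continuous (fun r => Gk 0 c r + 3^-1 * ln (A r))}.
  apply: continuous_in_subspaceT => r; rewrite inE /= in_itv /= => /andP[_ r2].
  exact: dv_cont (dH r r2).
have := dv_ge0_le h02 cH (fun r r02 => dH r (ltW (proj2 (andP r02)))).
rewrite Gk0// add0r -/(halflength c) => H.
have {}H : 3^-1 * ln (A 0) <= halflength c + 3^-1 * ln (A 2).
  apply: H => r /andP[r0 r2]; rewrite subr_ge0 /ker expr1.
  rewrite lef_pV2 ?posrE ?wgt_gt0 ?A0// -ler_sqr ?nnegrE; last 2 first.
  - by rewrite ltW// wgt_gt0.
  - by rewrite ltW// A0.
  rewrite wgt_sq// /dblwell wellE; last by rewrite ger0_norm.
  have e1 : 0 <= 16 - (2 + r) ^+ 2 by nra.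
  have e2 := mulr_ge0 (sqr_ge0 (2 - r)) e1.
  have e3 : 0 <= s * (2 - r) by rewrite mulr_ge0 ?subr_ge0// ltW.
  have e4 := sqr_ge0 (2 - r).
  by rewrite /A /c; move: (s) e2 e3 e4; clear=> z *; lra.
have l2 : ln (A 2) = - (3 * l) by rewrite /A subrr mulr0 add0r /s expRK.
have l0 : 0 <= ln (A 0) by apply: ln_ge0; rewrite /A; lra.
by rewrite l2 in H; lra.
Qed.

Lemma sdiff_halflength c : 0 < c -> sdiff halflength (- 2^-1 * Gk 1 c 2) c.
Proof.
move=> c0; have b0 : continuous (fun r => - (0%:R + 2^-1) * ker 1 c r).
  have ck := @continuous_ker R 1 c c0; cts.
have two0 : (0 : R) <= 2 by [].
have h : qdiff (absle 2) (fun c y => prim (ker 0 c) y)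
    (fun y => prim (fun r => - (0%:R + 2^-1) * ker 1 c r) y) c.
  apply: (qdiff_prim two0 b0 _ (qdiff_ker 0 c0)).
  exists c => // c' cc; apply: continuous_ker.
  by move: cc; rewrite ltr_norml; lra.
have D2 : absle 2 (2 : R) by rewrite /absle ger0_norm.
have := qdiff_at D2 h; rewrite primZ; last exact: continuous_ker.
by rewrite add0r.
Qed.

Lemma Gk_2_gt0 k c : 0 < c -> 0 < Gk k c 2.
Proof. by move=> c0; rewrite -(Gk0 k c0) Gk_lt. Qed.

(** The integration constant of the solution for the parameter l. *)
Definition Cof l : R := xget 1 [set c | 0 < c /\ halflength c = l].

Lemma CofP l : 0 < l -> 0 < Cof l /\ halflength (Cof l) = l.
Proof.
move=> l0; rewrite /Cof; case: xgetP => [y _ //|].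
have [c1 c10 lc1] := halflength_large l.
pose c2 := (2 / l) ^+ 2.
have c20 : 0 < c2 by rewrite exprn_gt0// divr_gt0.
have lc2 : halflength c2 <= l.
  apply: (le_trans (halflength_le c20)); rewrite sqrtr_sqr gtr0_norm ?divr_gt0//.
  by rewrite le_eqVlt; apply/orP; left; apply/eqP; field; rewrite gt_eqF.
have c12 : c1 <= c2.
  by rewrite leNgt; apply/negP => /(halflength_decr c20); lra.
have cL : {within `[c1, c2], continuous halflength}.
  apply: continuous_in_subspaceT => c; rewrite inE /= in_itv /= => /andP[cc _].
  apply: (@dv_cont _ halflength c _ (sdiff_dv (sdiff_halflength _))).
  exact: lt_le_trans cc.
have [|c] := IVT c12 cL (v := l).
  by rewrite ge_min le_max lc1 lc2 orbT.
rewrite in_itv /= => /andP[cc _] Ec.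
by move=> /(_ c); case; split => //; exact: lt_le_trans cc.
Qed.

Lemma Cof_gt0 l : 0 < l -> 0 < Cof l. Proof. by case/CofP. Qed.
Hint Resolve Cof_gt0 : core.

Lemma CofE l : 0 < l -> Gk 0 (Cof l) 2 = l. Proof. by case/CofP. Qed.

Definition dCof l : R := - 2 * (Gk 1 (Cof l) 2)^-1.

Lemma dCof_lt0 l : 0 < l -> dCof l < 0.
Proof.
by move=> l0; rewrite /dCof mulNr oppr_lt0 mulr_gt0// invr_gt0 Gk_2_gt0// Cof_gt0.
Qed.

Lemma sdiff_Cof l : 0 < l -> sdiff Cof (dCof l) l.
Proof.
move=> l0; have c0 := Cof_gt0 l0; have G0 := Gk_2_gt0 1 c0.
have -> : dCof l = (- 2^-1 * Gk 1 (Cof l) 2)^-1.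
  by rewrite /dCof; field; rewrite gt_eqF.
apply: (@sdiff_inverse _ halflength) => //.
- exact: halflength_decr.
- exact: CofP.
- exact: sdiff_halflength.
- by rewrite mulNr oppr_lt0 mulr_gt0.
Qed.

Lemma Cof_near l : 0 < l -> exists2 d : R, 0 < d &
  forall l', `|l' - l| < d -> 0 < l' /\ 0 < Cof l' <= Cof l + 1.
Proof.
move=> l0; have /qdiffP[K K0 [d /andP[d0 _] H]] := sdiff_Cof l0.
exists (Num.min (Num.min d l) (K + 1)^-1).
  by rewrite !lt_min d0 l0 invr_gt0 ltr_wpDl.
move=> l'; rewrite !lt_min => /andP[/andP[h1 h2] h3].
have l'0 : 0 < l' by move: h2; rewrite ltr_norml; lra.
split=> //; rewrite (Cof_gt0 l'0)/=; have [_ _ _ h] := H l' 0 h1 I.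
have K1 : 0 < K + 1 by rewrite ltr_wpDl.
have : K * `|l' - l| <= 1.
  apply: (@le_trans _ _ ((K + 1) * (K + 1)^-1)); last by rewrite mulfV// gt_eqF.
  by apply: ler_pM => //; [rewrite lerDl|exact: ltW].
by move: h; rewrite ler_norml; lra.
Qed.

(** The solution of q'' = l^2 q (q^2 - 4), q(-1) = 2, q(1) = -2. *)
Definition sol l x : R := Ginv (Cof l) (- (l * x)).

Lemma solE l x : 0 < l -> Gk 0 (Cof l) (sol l x) = - (l * x).
Proof. by move=> l0; rewrite GinvK// Cof_gt0. Qed.

Lemma sol_eq l x y : 0 < l -> Gk 0 (Cof l) y = - (l * x) -> sol l x = y.
Proof. by move=> l0 E; rewrite /sol -E GkK// Cof_gt0. Qed.

Lemma sol1 l : 0 < l -> sol l 1 = - 2.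
Proof. by move=> l0; apply: sol_eq => //; rewrite GkN ?Cof_gt0// CofE// mulr1. Qed.

Lemma solN1 l : 0 < l -> sol l (- 1) = 2.
Proof. by move=> l0; apply: sol_eq => //; rewrite CofE// mulrN1 opprK. Qed.

Lemma solN l x : 0 < l -> sol l (- x) = - sol l x.
Proof.
by move=> l0; apply: sol_eq => //; rewrite GkN ?Cof_gt0// solE// mulrN.
Qed.

Lemma sol_anti l x y : 0 < l -> x <= y -> sol l y <= sol l x.
Proof.
move=> l0 xy; rewrite -(@Gk_le _ 0 (Cof l)) ?Cof_gt0// !solE//.
by rewrite lerN2 ler_pM2l.
Qed.

Lemma sol_le2 l x : 0 < l -> `|x| <= 1 -> `|sol l x| <= 2.
Proof.
move=> l0; rewrite !ler_norml => /andP[x1 x2].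
by rewrite -{1}(sol1 l0) -[X in _ && (_ <= X)](solN1 l0) !sol_anti.
Qed.

Definition slope l x : R := wgt (Cof l) (sol l x).

Lemma dv_sol l x : 0 < l -> dv (sol l) x (- l * slope l x).
Proof.
move=> l0; have dl : dv (fun x => - (l * x)) x (- (l * 1)).
  by apply: dvN; apply: dvZ; exact: dv_id.
have := @dv_comp _ (Ginv (Cof l)) (fun x => - (l * x)) x _ _
  (dv_Ginv (- (l * x)) (Cof_gt0 l0)) dl.
by move/dv_eq; apply; rewrite mulr1 mulrC.
Qed.

Lemma continuous_sol l : 0 < l -> continuous (sol l).
Proof. by move=> l0; apply: dv_continuous => x; exact: dv_sol. Qed.

Lemma slope_gt0 l x : 0 < l -> 0 < slope l x.
Proof. by move=> l0; rewrite wgt_gt0// Cof_gt0. Qed.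

Lemma dv_slope l x : 0 < l -> dv (slope l) x (l * (sol l x * well (sol l x))).
Proof.
move=> l0; have := dv_comp (dv_wgt (sol l x) (Cof_gt0 l0)) (dv_sol x l0).
rewrite -/(slope l x) => /dv_eq; apply.
by have := slope_gt0 x l0; move: (slope l x) => w w0; field; rewrite gt_eqF.
Qed.

Lemma continuous_slope l : 0 < l -> continuous (slope l).
Proof. by move=> l0; apply: dv_continuous => x; exact: dv_slope. Qed.

Definition Ik k l x : R := Gk k (Cof l) (sol l x).

Definition Jk k l : R := Gk k (Cof l) 2.

(** Implicit differentiation of Gk 0 (Cof l) (sol l x) = - (l * x) with respect
to l. *)
Definition dsol l x : R := slope l x * (- x + 2^-1 * dCof l * Ik 1 l x).

Lemma qdiff_kerC k l : 0 < l -> qdiff (absle 2) (fun l r => ker k (Cof l) r)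
  (fun r => - (k%:R + 2^-1) * ker k.+1 (Cof l) r * dCof l) l.
Proof.
move=> l0; have h := qdiff_ker k (Cof_gt0 l0).
exact: (qdiff_comp h (sdiff_Cof l0)).
Qed.

Lemma continuous_kerC k l : 0 < l ->
  continuous (fun r => - (k%:R + 2^-1) * ker k.+1 (Cof l) r * dCof l).
Proof.
move=> l0; have ck : continuous (ker k.+1 (Cof l)).
  by apply: continuous_ker; exact: Cof_gt0.
cts.
Qed.

Lemma near_kerC k l : 0 < l -> exists2 d : R, 0 < d &
  forall l', `|l' - l| < d -> continuous (ker k (Cof l')).
Proof.
move=> l0; exists l => // l'; rewrite ltr_norml => ll.
by apply: continuous_ker; apply: Cof_gt0; lra.
Qed.

Lemma prim_kerC k l y : 0 < l ->
  prim (fun r => - (k%:R + 2^-1) * ker k.+1 (Cof l) r * dCof l) y =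
  - (k%:R + 2^-1) * dCof l * Gk k.+1 (Cof l) y.
Proof.
move=> l0; rewrite /Gk -primZ; last by apply: continuous_ker; exact: Cof_gt0.
by congr (prim _ y); apply/funext => r; ring.
Qed.

Lemma qdiff_sol l : 0 < l -> qdiff (absle 1) sol (dsol l) l.
Proof.
move=> l0; have c0 := Cof_gt0 l0; have [L L0 lip] := ker_lip 0 c0.
have [d d0 dP] := Cof_near l0.
have s0 : 0 < (Num.sqrt (9 + Cof l))^-1 by rewrite invr_gt0 sqrtr_gt0; lra.
have two0 : (0 : R) <= 2 by [].
have dT : qdiff (absle 1) (fun l x => - (l * x)) (fun x => - x) l.
  apply: qdiffN; have hx : qdiff (absle 1) (fun _ x => x) (fun=> 0) l.
    by apply: qdiff_cst; exists 1.
  have := qdiffM (qdiff_id (absle 1) l) hx.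
  by apply: qdiff_ext => // x _; rewrite mul1r mulr0 addr0.
have := @qdiff_implicit _ (absle 1) 2 L _ _ _ sol _ _ l two0 L0 s0
  (@continuous_kerC 0 l l0) _ (qdiff_kerC 0 l0) lip dT.
move=> H; apply: qdiff_ext (H _ _) => //.
- move=> x _; rewrite prim_kerC// /dsol /slope /Ik /ker expr1.
  have := wgt_gt0 (sol l x) c0; move: (wgt _ _) => w w0.
  by rewrite invrK add0r; ring.
- exists d => // l' /dP[l'0 /andP[c'0 c'1]]; split; first exact: continuous_ker.
  move=> r _; rewrite /ker expr1 lef_pV2 ?posrE ?wgt_gt0 ?sqrtr_gt0//; last by lra.
  have /andP[_] := wgt_bounds r c'0; move/le_trans; apply.
  by apply: ler_wsqrtr; lra.
- exists d => // l' x /dP[l'0 _] x1; split; [exact: sol_le2|exact: solE].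
Qed.

Lemma qdiff_slope l : 0 < l -> qdiff (absle 1) slope
  (fun x => (2 * slope l x)^-1 *
     ((sol l x ^+ 2 - 4) * (2 * sol l x * dsol l x) + dCof l)) l.
Proof.
move=> l0; have c0 := Cof_gt0 l0; have dq := qdiff_sol l0.
have h : qdiff (absle 1) (fun l x => 2^-1 * (sol l x ^+ 2 - 4) ^+ 2 + Cof l)
   (fun x => (sol l x ^+ 2 - 4) * (2 * sol l x * dsol l x) + dCof l) l.
  have h4 : qdiff (absle 1) (fun _ _ => 4) (fun=> 0) l by apply: qdiff_cst; exists `|4|.
  have := qdiffD (qdiffZ (2^-1) (qdiffX 1 (qdiffB (qdiffX 1 dq) h4)))
    (sdiff_qdiff (absle 1) (sdiff_Cof l0)).
  apply: qdiff_ext => // x _; rewrite !expr1 subr0; congr (_ + _).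
  by field.
have E l' x : 0 < l' -> absle 1 x ->
    2^-1 * (sol l' x ^+ 2 - 4) ^+ 2 + Cof l' = dblwell (sol l' x) + Cof l'.
  move=> l'0 x1; rewrite /dblwell wellE ?sol_le2//; congr (_ + _).
  by rewrite mulrC -sqrrN opprB.
have bnd x : absle 1 x ->
    Cof l <= 2^-1 * (sol l x ^+ 2 - 4) ^+ 2 + Cof l <= 8 + Cof l.
  move=> x1; rewrite E//; have := dblwell_ge0 (sol l x); have := dblwell_le8 (sol l x).
  by lra.
have := qdiff_sqrt c0 bnd h => H.
apply: (@qdiff_near _ _ (fun l x => Num.sqrt (2^-1 * (sol l x ^+ 2 - 4) ^+ 2 + Cof l))).
  exists l => // l' x; rewrite ltr_norml => ll x1; rewrite E//; lra.
by apply: qdiff_ext H => // x x1; rewrite E.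
Qed.

Lemma qdiff_islope l : 0 < l -> qdiff (absle 1) (fun l x => (slope l x)^-1)
  (fun x => - (slope l x ^+ 2)^-1 * ((2 * slope l x)^-1 *
     ((sol l x ^+ 2 - 4) * (2 * sol l x * dsol l x) + dCof l))) l.
Proof.
move=> l0; have c0 := Cof_gt0 l0; have s0 : 0 < Num.sqrt (Cof l) by rewrite sqrtr_gt0.
apply: (qdiffV s0 _ (qdiff_slope l0)) => x _.
by have /andP[] := wgt_bounds (sol l x) c0.
Qed.

Lemma qdiff_Ik k l : 0 < l -> qdiff (absle 1) (Ik k)
  (fun x => - (k%:R + 2^-1) * dCof l * Ik k.+1 l x
     + (slope l x)^-1 ^+ k.*2.+1 * dsol l x) l.
Proof.
move=> l0; have c0 := Cof_gt0 l0; have [L L0 lip] := ker_lip k c0.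
have two0 : (0 : R) <= 2 by [].
have := qdiff_prim_end two0 L0 (@continuous_kerC k l l0) (near_kerC k l0)
  (qdiff_kerC k l0) lip (qdiff_sol l0).
move=> H; apply: qdiff_ext (H _) => //.
  by move=> x _; rewrite prim_kerC.
by exists l => // l' x; rewrite ltr_norml => ll x1; apply: sol_le2 => //; lra.
Qed.

Lemma sdiff_Jk k l : 0 < l -> sdiff (Jk k) (- (k%:R + 2^-1) * dCof l * Jk k.+1 l) l.
Proof.
move=> l0; have two0 : (0 : R) <= 2 by [].
have h := qdiff_prim two0 (@continuous_kerC k l l0) (near_kerC k l0) (qdiff_kerC k l0).
have D2 : absle 2 (2 : R) by rewrite /absle ger0_norm.
by have := qdiff_at D2 h; rewrite prim_kerC.
Qed.

End Branch.

(** * Smoothness of the branch *)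

Section SmoothBranch.
Context {R : realType}.
Implicit Types (c r t x y l K M L : R) (k n : nat) (F G : R -> R -> R).

(** An algebra of functions of (l, x), stable under both derivations, that
contains the solution. *)
Inductive smooth_fun : (R -> R -> R) -> Prop :=
| sm_cst c : smooth_fun (fun _ _ => c)
| sm_par : smooth_fun (fun l _ => l)
| sm_var : smooth_fun (fun _ x => x)
| sm_sol : smooth_fun sol
| sm_slope : smooth_fun slope
| sm_islope : smooth_fun (fun l x => (slope l x)^-1)
| sm_I k : smooth_fun (Ik k)
| sm_J k : smooth_fun (fun l _ => Jk k l)
| sm_iJ : smooth_fun (fun l _ => (Jk 1 l)^-1)
| sm_add F G : smooth_fun F -> smooth_fun G -> smooth_fun (fun l x => F l x + G l x)
| sm_mul F G : smooth_fun F -> smooth_fun G -> smooth_fun (fun l x => F l x * G l x).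

Lemma sm_exp F n : smooth_fun F -> smooth_fun (fun l x => F l x ^+ n).
Proof.
move=> sF; elim: n => [|n IH]; first exact: sm_cst.
rewrite [X in smooth_fun X](_ : _ = fun l x => F l x * F l x ^+ n).
  exact: sm_mul.
by apply/funext => l; apply/funext => x; rewrite exprS.
Qed.

Lemma sm_scale c F : smooth_fun F -> smooth_fun (fun l x => c * F l x).
Proof. by move=> sF; apply: sm_mul => //; exact: sm_cst. Qed.

Lemma sm_dCof : smooth_fun (fun l _ => dCof l).
Proof. exact: sm_scale sm_iJ. Qed.

Lemma sm_opp F : smooth_fun F -> smooth_fun (fun l x => - F l x).
Proof.
move=> /(sm_scale (-1)); congr smooth_fun.
by apply/funext => l; apply/funext => x; rewrite mulN1r.
Qed.

Lemma sm_dsol : smooth_fun dsol.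
Proof.
apply: sm_mul; first exact: sm_slope.
apply: sm_add; first exact: sm_opp sm_var.
by apply: sm_mul; [apply: sm_scale; exact: sm_dCof|exact: sm_I].
Qed.

Definition par_diff F : Prop := exists2 F', smooth_fun F' &
  forall l, 0 < l -> qdiff (absle 1) F (F' l) l.

Definition var_diff F : Prop := exists2 G, smooth_fun G &
  forall l x, 0 < l -> `|x| <= 1 -> dv (F l) x (G l x).

Definition var_cont F : Prop := forall l, 0 < l -> continuous (F l).

Lemma sm_ext F G : smooth_fun F -> (forall l x, F l x = G l x) -> smooth_fun G.
Proof.
move=> sF FG; rewrite [G](_ : _ = F)//.
by apply/funext => l; apply/funext => x.
Qed.

Lemma sm_dslope : smooth_fun (fun l x => (2 * slope l x)^-1 *
     ((sol l x ^+ 2 - 4) * (2 * sol l x * dsol l x) + dCof l)).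
Proof.
apply: sm_mul.
  by apply: (sm_ext (sm_scale 2^-1 sm_islope)) => l x; rewrite invfM.
apply: sm_add; last exact: sm_dCof.
apply: sm_mul; first by apply: sm_add; [apply: sm_exp; exact: sm_sol|exact: sm_cst].
by apply: sm_mul; [apply: sm_scale; exact: sm_sol|exact: sm_dsol].
Qed.

Lemma smooth_par_diff F : smooth_fun F -> par_diff F.
Proof.
elim=> {F}.
- move=> c; exists (fun _ _ => 0); first exact: sm_cst.
  by move=> l _; apply: qdiff_cst; exists `|c|.
- exists (fun _ _ => 1); first exact: sm_cst.
  by move=> l _; exact: qdiff_id.
- exists (fun _ _ => 0); first exact: sm_cst.
  by move=> l _; apply: qdiff_cst; exists 1.
- by exists dsol; [exact: sm_dsol|exact: qdiff_sol].
- by eexists; [exact: sm_dslope|exact: qdiff_slope].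
- eexists; last exact: qdiff_islope.
  apply: sm_mul; last exact: sm_dslope.
  apply: sm_opp; apply: (sm_ext (sm_exp 2 sm_islope)) => l x.
  by rewrite exprVn.
- move=> k; eexists; last exact: qdiff_Ik.
  apply: sm_add.
    by apply: sm_mul; [apply: sm_scale; exact: sm_dCof|exact: sm_I].
  by apply: sm_mul; [apply: sm_exp; exact: sm_islope|exact: sm_dsol].
- move=> k; exists (fun l _ => - (k%:R + 2^-1) * dCof l * Jk k.+1 l).
    by apply: sm_mul; [apply: sm_scale; exact: sm_dCof|exact: sm_J].
  by move=> l l0; apply: sdiff_qdiff; exact: sdiff_Jk.
- exists (fun l _ => - (Jk 1 l ^+ 2)^-1 * (- (1%:R + 2^-1) * dCof l * Jk 2 l)).
    apply: sm_mul; last first.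
      by apply: sm_mul; [apply: sm_scale; exact: sm_dCof|exact: sm_J].
    apply: sm_opp; apply: (sm_ext (sm_exp 2 sm_iJ)) => l x.
    by rewrite exprVn.
  move=> l l0; have J0 : 0 < Jk 1 l by apply: Gk_2_gt0; exact: Cof_gt0.
  apply: (qdiffV J0) => //.
  by apply: sdiff_qdiff; exact: sdiff_Jk.
- move=> F G _ [F' sF' dF] _ [G' sG' dG].
  exists (fun l x => F' l x + G' l x); first exact: sm_add.
  by move=> l l0; apply: qdiffD; [exact: dF|exact: dG].
- move=> F G sF [F' sF' dF] sG [G' sG' dG].
  exists (fun l x => F' l x * G l x + F l x * G' l x).
    by apply: sm_add; exact: sm_mul.
  by move=> l l0; apply: qdiffM; [exact: dF|exact: dG].
Qed.

Lemma dv_islope l x : 0 < l ->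
  dv (fun x => (slope l x)^-1) x
    (- (l * (sol l x * well (sol l x))) / slope l x ^+ 2).
Proof.
by move=> l0; apply: dvV; [rewrite gt_eqF// slope_gt0|exact: dv_slope].
Qed.

Lemma dv_Ik k l x : 0 < l ->
  dv (Ik k l) x ((slope l x)^-1 ^+ k.*2.+1 * (- l * slope l x)).
Proof.
move=> l0; exact: (dv_comp (dv_Gk k (sol l x) (Cof_gt0 l0)) (dv_sol x l0)).
Qed.

Lemma smooth_var_diff F : smooth_fun F -> var_diff F.
Proof.
elim=> {F}.
- by move=> c; exists (fun _ _ => 0); [exact: sm_cst|move=> *; exact: dv_cst].
- by exists (fun _ _ => 0); [exact: sm_cst|move=> *; exact: dv_cst].
- by exists (fun _ _ => 1); [exact: sm_cst|move=> *; exact: dv_id].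
- exists (fun l x => - l * slope l x).
    by apply: sm_mul; [exact: sm_opp sm_par|exact: sm_slope].
  by move=> l x l0 _; exact: dv_sol.
- exists (fun l x => l * (sol l x * (4 - sol l x ^+ 2))).
    apply: sm_mul; first exact: sm_par.
    apply: sm_mul; first exact: sm_sol.
    apply: sm_add; [exact: sm_cst|apply: sm_opp; apply: sm_exp; exact: sm_sol].
  by move=> l x l0 x1; rewrite -wellE ?sol_le2//; exact: dv_slope.
- exists (fun l x => - (l * (sol l x * (4 - sol l x ^+ 2))) * (slope l x)^-1 ^+ 2).
    apply: sm_mul; last by apply: sm_exp; exact: sm_islope.
    apply: sm_opp; apply: sm_mul; first exact: sm_par.
    apply: sm_mul; first exact: sm_sol.
    apply: sm_add; [exact: sm_cst|apply: sm_opp; apply: sm_exp; exact: sm_sol].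
  move=> l x l0 x1; rewrite -wellE ?sol_le2// exprVn; exact: dv_islope.
- move=> k; exists (fun l x => (slope l x)^-1 ^+ k.*2.+1 * (- l * slope l x)).
    apply: sm_mul; first by apply: sm_exp; exact: sm_islope.
    by apply: sm_mul; [exact: sm_opp sm_par|exact: sm_slope].
  by move=> l x l0 _; exact: dv_Ik.
- by move=> k; exists (fun _ _ => 0); [exact: sm_cst|move=> *; exact: dv_cst].
- by exists (fun _ _ => 0); [exact: sm_cst|move=> *; exact: dv_cst].
- move=> F G _ [F' sF' dF] _ [G' sG' dG].
  exists (fun l x => F' l x + G' l x); first exact: sm_add.
  by move=> l x l0 x1; apply: dvD; [exact: dF|exact: dG].
- move=> F G sF [F' sF' dF] sG [G' sG' dG].
  exists (fun l x => F' l x * G l x + F l x * G' l x).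
    by apply: sm_add; exact: sm_mul.
  by move=> l x l0 x1; apply: dvM; [exact: dF|exact: dG].
Qed.

Lemma smooth_var_cont F : smooth_fun F -> var_cont F.
Proof.
elim=> {F} //.
- by move=> c l _; exact: continuous_cst'.
- by move=> l _; exact: continuous_cst'.
- by move=> l _; exact: continuous_id'.
- by move=> l l0; exact: continuous_sol.
- by move=> l l0; exact: continuous_slope.
- by move=> l l0; apply: dv_continuous => x; exact: dv_islope.
- by move=> k l l0; apply: dv_continuous => x; exact: dv_Ik.
- by move=> k l _; exact: continuous_cst'.
- by move=> l _; exact: continuous_cst'.
- by move=> F G _ cF _ cG l l0; apply: continuousD'; [exact: cF|exact: cG].
- by move=> F G _ cF _ cG l l0; apply: continuousM'; [exact: cF|exact: cG].
Qed.

Lemma absle1 x : absle 1 x = (-1 <= x <= 1) :> Prop.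
Proof. by rewrite /absle ler_norml. Qed.

(** Differentiation with respect to the parameter commutes with weak
differentiation in x: the latter amounts to an integral identity, which
passes to the limit in the difference quotients. *)
Lemma smooth_mixed F F' G H : smooth_fun F -> smooth_fun F' -> smooth_fun G ->
  smooth_fun H ->
  (forall l, 0 < l -> qdiff (absle 1) F (F' l) l) ->
  (forall l x, 0 < l -> `|x| <= 1 -> dv (F l) x (G l x)) ->
  (forall l, 0 < l -> qdiff (absle 1) G (H l) l) ->
  forall l, 0 < l -> weak_derivative (F' l) (H l).
Proof.
move=> sF sF' sG sH dF dG dH l l0.
have [F'x sF'x dF'] := smooth_var_diff sF'.
have cH := smooth_var_cont sH l0; have cF'x := smooth_var_cont sF'x l0.
have FE l' x : 0 < l' -> -1 <= x <= 1 ->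
    F l' x - F l' (-1) = prim (G l') x - prim (G l') (-1).
  move=> l'0 x11; apply/esym/primE.
  - exact: smooth_var_cont.
  - by case/andP: x11.
  - exact/cont_within/smooth_var_cont.
  by move=> t tx; apply: dG => //; rewrite ler_norml; lra.
apply: (wd_prim cH) => //; first exact: L2_cont.
move=> x x11.
have /qdiffP[K K0 [d /andP[d0 _] HF]] := dF l l0.
have /qdiffP[K' K'0 [d' /andP[d'0 _] HG]] := dH l l0.
set A := F' l x - F' l (-1); set B := prim (H l) x - prim (H l) (-1).
apply/eqP; rewrite -subr_eq0 -normr_le0; apply/ler_addgt0Pl => e e0; rewrite addr0.
pose M := 2 * K + 2 * K'.
have M0 : 0 <= M by rewrite addr_ge0// mulr_ge0.
pose s := Num.min (Num.min (d / 2) (d' / 2)) (e / (M + 1)).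
have s0 : 0 < s by rewrite !lt_min !divr_gt0// ltr_wpDl.
have sd : s < d.
  by apply: (@le_lt_trans _ _ (d / 2)); [rewrite /s !ge_min lexx|lra].
have sd' : s < d'.
  by apply: (@le_lt_trans _ _ (d' / 2)); [rewrite /s !ge_min lexx orbT|lra].
have sM : M * s <= e.
  have : s * (M + 1) <= e by rewrite -ler_pdivlMr ?ltr_wpDl// /s ge_min lexx orbT.
  by have := ltW s0; rewrite mulrC; nra.
have ls : `|l + s - l| < d by rewrite [l + s]addrC addrK gtr0_norm.
have ls' : `|l + s - l| < d' by rewrite [l + s]addrC addrK gtr0_norm.
have ls0 : 0 < l + s by rewrite addr_gt0.
have m11 : absle 1 (-1 : R) by rewrite absle1 lexx /=; lra.
have Dx : absle 1 x by rewrite absle1.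
have [_ _ h1 _] := HF _ _ ls Dx; have [_ _ h2 _] := HF _ _ ls m11.
have cG t : 0 < t -> continuous (G t) by exact: smooth_var_cont.
have h3 : `|(prim (G (l + s)) x - prim (G (l + s)) (-1))
    - (prim (G l) x - prim (G l) (-1)) - s * B| <= K' * s ^+ 2 * 2.
  have c1 := cG _ ls0; have c2 := cG _ l0.
  have -> : (prim (G (l + s)) x - prim (G (l + s)) (-1))
     - (prim (G l) x - prim (G l) (-1)) - s * B =
     prim (fun t => G (l + s) t - G l t - s * H l t) x
     - prim (fun t => G (l + s) t - G l t - s * H l t) (-1).
    have csH : continuous (fun t => s * H l t) by cts.
    have cd : continuous (fun t => G (l + s) t - G l t) by cts.
    by rewrite !primB// !primZ// /B; ring.
  have xm : -1 <= x by case/andP: x11.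
  apply: (@le_trans _ _ (K' * s ^+ 2 * (x - -1))).
    apply: prim_le_cst => //; first by cts.
    move=> t tx; have Dt : absle 1 t by rewrite absle1; lra.
    by have [_ _ + _] := HG _ _ ls' Dt; rewrite [l + s - l]addrC addKr.
  by apply: ler_wpM2l; [rewrite mulr_ge0// sqr_ge0|lra].
rewrite -!FE// in h3.
rewrite [l + s - l]addrC addKr in h1 h2.
have : s * `|A - B| <= s * e.
  rewrite -{1}(gtr0_norm s0) -normrM.
  have -> : s * (A - B) =
    (F (l + s) x - F (l + s) (-1) - (F l x - F l (-1)) - s * B)
    - (F (l + s) x - F l x - s * F' l x)
    + (F (l + s) (-1) - F l (-1) - s * F' l (-1)) by rewrite /A; ring.
  apply: (le_trans (ler_normD _ _)).
  apply: (le_trans (lerD (ler_normB _ _) (lexx _))).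
  apply: (le_trans (lerD (lerD h3 h1) h2)).
  have -> : K' * s ^+ 2 * 2 + K * s ^+ 2 + K * s ^+ 2 = s * (M * s).
    by rewrite /M; ring.
  by rewrite ler_pM2l.
by rewrite ler_pM2l.
Qed.

Lemma smooth_wd F G : smooth_fun F -> smooth_fun G ->
  (forall l x, 0 < l -> `|x| <= 1 -> dv (F l) x (G l x)) ->
  forall l, 0 < l -> weak_derivative (F l) (G l).
Proof.
move=> sF sG dG l l0; apply: wd_dv.
- exact: smooth_var_cont.
- exact: smooth_var_cont.
- by move=> x x11; apply: dG => //; rewrite ler_norml; lra.
Qed.

(** The successive derivatives of the solution with respect to the parameter. *)
Lemma smooth_iterate : exists D : nat -> R -> R -> R, D 0%N = sol /\
  forall k, [/\ smooth_fun (D k), smooth_fun (D k.+1) &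
    forall l, 0 < l -> qdiff (absle 1) (D k) (D k.+1 l) l].
Proof.
pose T := {F : R -> R -> R | smooth_fun F}.
have step (F : T) : {G : T | forall l, 0 < l -> qdiff (absle 1) (sval F) (sval G l) l}.
  apply: cid; case: F => F sF /=; have [G sG H] := smooth_par_diff sF.
  by exists (exist _ G sG).
pose E := fix E n : T := if n is n'.+1 then sval (step (E n')) else exist _ sol sm_sol.
exists (fun n => sval (E n)); split=> // k; split.
- exact: svalP (E k).
- exact: svalP (E k.+1).
- exact: svalP (step (E k)).
Qed.

Definition chi l : triple R := ((fun=> 2 / 3, sol l), fun=> 0).

Lemma itg_sq_small (f : R -> R) K : itgb (fun x => f x ^+ 2) -> 0 <= K ->
  (forall x, -1 <= x <= 1 -> `|f x| <= K) -> itg (fun x => f x ^+ 2) <= 2 * K ^+ 2.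
Proof.
move=> If K0 fK; apply: (@le_trans _ _ (itg (fun=> K ^+ 2))); last first.
  by rewrite itg_cst mulrC.
apply: itg_le => //; first by apply: itgb_cont; exact: continuous_cst'.
by move=> x x11; apply: sq_leM; exact: fK.
Qed.

Lemma H1norm_small f g K : weak_derivative f g -> 0 <= K ->
  (forall x, -1 <= x <= 1 -> `|f x| <= K) ->
  (forall x, -1 <= x <= 1 -> `|g x| <= K) -> H1norm f <= 2 * K.
Proof.
move=> w K0 fK gK; have Lg : square_integrable g by case: w.
rewrite -ler_sqr ?nnegrE ?mulr_ge0//; last exact: sqrtr_ge0.
rewrite (H1normE w) exprMn (_ : 2 ^+ 2 = 2 + 2); last by ring.
rewrite mulrDl; apply: lerD; apply: itg_sq_small => //.
  exact: L2_sq (wdL2 w).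
exact: L2_sq.
Qed.

Lemma H1norm3_small Q g K : wd3 Q g -> 0 <= K ->
  (forall x, -1 <= x <= 1 -> [/\ `|q1 Q x| <= K, `|q2 Q x| <= K & `|q3 Q x| <= K]) ->
  (forall x, -1 <= x <= 1 -> [/\ `|q1 g x| <= K, `|q2 g x| <= K & `|q3 g x| <= K]) ->
  H1norm3 Q <= 4 * K.
Proof.
case=> w1 w2 w3 K0 QK gK.
have h1 : H1norm (q1 Q) <= 2 * K.
  by apply: (H1norm_small w1) => // x x11; [case: (QK x x11)|case: (gK x x11)].
have h2 : H1norm (q2 Q) <= 2 * K.
  by apply: (H1norm_small w2) => // x x11; [case: (QK x x11)|case: (gK x x11)].
have h3 : H1norm (q3 Q) <= 2 * K.
  by apply: (H1norm_small w3) => // x x11; [case: (QK x x11)|case: (gK x x11)].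
rewrite /H1norm3.
have n1 : 0 <= H1norm (q1 Q) by exact: sqrtr_ge0.
have n2 : 0 <= H1norm (q2 Q) by exact: sqrtr_ge0.
have n3 : 0 <= H1norm (q3 Q) by exact: sqrtr_ge0.
move: (H1norm _) (H1norm _) (H1norm _) h1 h2 h3 n1 n2 n3 => a b c h1 h2 h3 n1 n2 n3.
rewrite -ler_sqr ?nnegrE ?mulr_ge0// sqr_sqrtr ?addr_ge0 ?sqr_ge0//.
have e1 : a ^+ 2 <= (2 * K) ^+ 2 by rewrite lerXn2r ?nnegrE// mulr_ge0.
have e2 : b ^+ 2 <= (2 * K) ^+ 2 by rewrite lerXn2r ?nnegrE// mulr_ge0.
have e3 : c ^+ 2 <= (2 * K) ^+ 2 by rewrite lerXn2r ?nnegrE// mulr_ge0.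
by have := sqr_ge0 K; move: e1 e2 e3; rewrite !exprMn; lra.
Qed.

(** Both the remainder in the parameter and that of its x-derivative are
quadratic uniformly in x, hence quadratic in H^1. *)
Lemma chi_smooth : smooth_curve [set l | 0 < l] chi.
Proof.
have [D [D0 HD]] := smooth_iterate.
pose c0 k : R := if k is 0%N then 2 / 3 else 0.
exists (fun k l => ((fun=> c0 k, D k l), fun=> 0)); split.
  by apply/funext => l; rewrite D0.
move=> k l /= l0; have [sD sD' dD] := HD k.
have [G sG dG] := smooth_var_diff sD; have [H sH dH] := smooth_par_diff sG.
have wD t : 0 < t -> weak_derivative (D k t) (G t) by exact: smooth_wd.
have wD' := smooth_mixed sD sD' sG sH dD dG dH.
split.
  split=> /=; [by exists (fun=> 0); exact: wd_cst| |by exists (fun=> 0); exact: wd_cst].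
  by exists (G l); exact: wD.
have /qdiffP[K K0 [d /andP[d0 _] HF]] := dD l l0.
have /qdiffP[K' K'0 [d' /andP[d'0 _] HG]] := dH l l0.
have M1 : 0 < 4 * (K + K') + 1 by rewrite ltr_wpDl// mulr_ge0// addr_ge0.
apply/cvgrPdist_le => e e0; near=> t.
have t0 : t != 0 by near: t; exact: nbhs_dnbhs_neq.
have td : `|t| < d by near: t; exact: dnbhs0_lt.
have td' : `|t| < d' by near: t; exact: dnbhs0_lt.
have tl : `|t| < l by near: t; exact: dnbhs0_lt.
have tK : `|t| <= e / (4 * (K + K') + 1) by near: t; apply: dnbhs0_le; rewrite divr_gt0.
have lt0 : 0 < l + t by move: tl; rewrite ltr_norml; lra.
rewrite distrC subr0 ger0_norm ?H1norm3_ge0//.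
set Q := (X in H1norm3 X).
pose g : triple R := ((fun=> t^-1 * (0 - 0) - 0,
  fun x => t^-1 * (G (l + t) x - G l x) - H l x), fun=> t^-1 * (0 - 0) - 0).
have wg : wd3 Q g.
  split.
  - apply: (wdB (f1 := fun=> t^-1 * (c0 k - c0 k)) (f2 := fun=> 0)); last exact: wd_cst.
    by apply: wdZ; apply: wdB; exact: wd_cst.
  - apply: (wdB (f1 := fun x => t^-1 * (D k (l + t) x - D k l x))).
      by apply: wdZ; apply: wdB; exact: wD.
    exact: wD'.
  - apply: (wdB (f1 := fun=> t^-1 * (0 - 0)) (f2 := fun=> 0)); last exact: wd_cst.
    by apply: wdZ; apply: wdB; exact: wd_cst.
have KK : 0 <= (K + K') * `|t| by rewrite mulr_ge0// addr_ge0.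
have quot (a b M : R) : `|a - t * b| <= M * t ^+ 2 -> M <= K + K' ->
    `|t^-1 * a - b| <= (K + K') * `|t|.
  move=> h MK; have -> : t^-1 * a - b = t^-1 * (a - t * b) by field.
  rewrite normrM normfV ler_pdivrMl ?normr_gt0//; apply: (le_trans h).
  have -> : t ^+ 2 = `|t| * `|t| by rewrite -normrM -expr2 ger0_norm ?sqr_ge0.
  by rewrite [leRHS]mulrCA ler_wpM2r// mulr_ge0.
have lt_l : `|l + t - l| = `|t| by rewrite [l + t]addrC addrK.
apply: (le_trans (H1norm3_small wg KK _ _)).
- move=> x x11; have Dx : absle 1 x by rewrite absle1.
  split.
  + have -> : q1 Q x = t^-1 * (c0 k - c0 k) - 0 by [].
    by rewrite subrr mulr0 subr0 normr0.
  + have [|_ _ h _] := HF (l + t) x _ Dx; first by rewrite lt_l.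
    rewrite [l + t - l]addrC addKr in h.
    by apply: (quot _ _ _ h); rewrite lerDl.
  + have -> : q3 Q x = t^-1 * (0 - 0) - 0 by [].
    by rewrite subrr mulr0 subr0 normr0.
- move=> x x11; have Dx : absle 1 x by rewrite absle1.
  split.
  + by rewrite /q1 /= subrr mulr0 subr0 normr0.
  + have [|_ _ h _] := HG (l + t) x _ Dx; first by rewrite lt_l.
    rewrite [l + t - l]addrC addKr in h.
    by apply: (quot _ _ _ h); rewrite lerDr.
  + by rewrite /q3 /= subrr mulr0 subr0 normr0.
move: tK; rewrite ler_pdivlMr// => /(le_trans _); apply.
by rewrite mulrA mulrC ler_wpM2l// lerDl.
Unshelve. all: by end_near. Qed.

End SmoothBranch.

(** * The second variation along the branch *)

Section Jacobi.
Context {R : realType}.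
Implicit Types (h k phi dphi W f g : R -> R) (x y m M : R).

Lemma itg_sq_gt0 h k x : weak_derivative h k -> -1 <= x <= 1 -> h x != 0 ->
  0 < itg (fun x => h x ^+ 2).
Proof.
move=> w x11 hx.
have cf : continuous (fun x => h (clamp x) ^+ 2).
  by apply: continuousX'; exact: wd_clamp_continuous w.
rewrite (itg_prim cf) => [|y y11]; last by rewrite clamp_id.
rewrite subr_gt0; apply: (prim_gt0 cf _ x11) => //.
- by move=> y _; exact: sqr_ge0.
- by rewrite clamp_id// lt_neqAle sqr_ge0 eq_sym expf_neq0.
Qed.

Lemma itg_sq_eq0 h k x : weak_derivative h k -> itg (fun x => h x ^+ 2) <= 0 ->
  -1 <= x <= 1 -> h x = 0.
Proof.
move=> w h0 x11; apply/eqP/negPn/negP => hx.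
by have := itg_sq_gt0 w x11 hx; rewrite ltNge h0.
Qed.

Lemma dv_near f g x d : (\forall y \near x, f y = g y) -> dv f x d -> dv g x d.
Proof. by move=> fg; exact: near_eq_is_derive. Qed.

Lemma near_clamp x : -1 < x < 1 -> \forall y \near x, clamp y = y.
Proof.
move=> /andP[x1 x2]; near=> y; apply: clamp_id; apply/andP; split; apply: ltW.
  by near: y; exact: lt_nbhsr.
by near: y; exact: lt_nbhsl.
Unshelve. all: by end_near. Qed.

(** If phi'' = W phi and phi > 0, then
h'^2 + W h^2 = phi^2 ((h / phi)')^2 + (h^2 phi' / phi)', and the last term
integrates to 0; the Poincare inequality for h / phi gives the bound. *)
Lemma jacobi_lower_bound h k phi dphi W m M : weak_derivative h k ->
  h (-1) = 0 -> h 1 = 0 ->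
  continuous phi -> continuous dphi -> continuous W ->
  (forall x, -1 < x < 1 -> dv phi x (dphi x) /\ dv dphi x (W x * phi x)) ->
  0 < m -> (forall x, -1 <= x <= 1 -> m <= phi x <= M) ->
  m ^+ 2 / (4 * M ^+ 2) * itg (fun x => h x ^+ 2) <=
  itg (fun x => k x ^+ 2 + W x * h x ^+ 2).
Proof.
move=> w hm1 h1 cphi cdphi cW dphiP m0 phiB.
have Lk : square_integrable k by case: w.
pose psi x := (phi (clamp x))^-1.
have cclamp : continuous (@clamp R).
  move=> x; apply/cvgrPdist_le => e e0; near=> y.
  rewrite distrC; apply: (le_trans (clamp_lip _ _)); rewrite distrC.
  by near: y; exact: cvgr_dist_le.
have phic x : 0 < phi (clamp x).
  by have /andP[h2 _] := phiB _ (clamp_in x); exact: lt_le_trans h2.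
have cpsi : continuous psi.
  move=> x; apply: cvgV; first by rewrite gt_eqF.
  exact: (continuous_comp' cphi cclamp).
pose dpsi x := - dphi (clamp x) * psi x ^+ 2.
have cdc : continuous (fun x => dphi (clamp x)) by exact: (continuous_comp' cdphi cclamp).
have cdpsi : continuous dpsi by rewrite /dpsi; cts.
have dpsiP x : -1 < x < 1 -> dv psi x (dpsi x).
  move=> x11; have x11' : -1 <= x <= 1 by lra.
  have [dp _] := dphiP x x11.
  have px : phi x != 0 by have := phic x; rewrite clamp_id// => /lt0r_neq0.
  apply: (@dv_near (fun y => (phi y)^-1)).
    near=> y; rewrite /psi; congr (phi _)^-1; apply/esym.
    by near: y; exact: near_clamp.
  apply: (dv_eq (dvV px dp)); rewrite /dpsi /psi clamp_id// exprVn //.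
pose g x := psi x * h x; pose g' x := dpsi x * h x + psi x * k x.
have wg : weak_derivative g g' by exact: wdM_cont.
have Lg' : square_integrable g' by case: wg.
pose theta x := dphi x * psi x.
pose dtheta x := W x - dphi x ^+ 2 * psi x ^+ 2.
have cth : continuous theta by rewrite /theta; cts.
have cdth : continuous dtheta by rewrite /dtheta; cts.
have dthP x : -1 < x < 1 -> dv theta x (dtheta x).
  move=> x11; have x11' : -1 <= x <= 1 by lra.
  have [_ d2] := dphiP x x11.
  apply: (dv_eq (dvM d2 (dpsiP x x11))); rewrite /dtheta /dpsi /psi clamp_id//.
  by have := phic x; rewrite clamp_id// => p0; field; rewrite gt_eqF.
have wD := wdM_cont (wdM w w) cth cdth dthP.
set D := (X in weak_derivative _ X) in wD.
have LD : square_integrable D by case: wD.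
have D0 : itg D = 0 by rewrite (itg_deriv wD) hm1 h1 !mulr0 subr0.
have chc := wd_clamp_continuous w.
have IWh : itgb (fun x => W x * h x ^+ 2).
  have : continuous (fun x => W x * h (clamp x) ^+ 2) by cts.
  by move=> /itgb_cont; apply: itgb_ext => x /clamp_id ->.
have Ik := L2_sq Lk.
have -> : itg (fun x => k x ^+ 2 + W x * h x ^+ 2) =
    itg (fun x => (k x ^+ 2 + W x * h x ^+ 2) - D x).
  by rewrite itgB ?D0 ?subr0//; [exact: itgbD|exact: L2_int].
have E x : -1 <= x <= 1 -> (k x ^+ 2 + W x * h x ^+ 2) - D x = phi x ^+ 2 * g' x ^+ 2.
  move=> x11; rewrite /D /g' /theta /dtheta /dpsi /psi clamp_id//.
  by have := phic x; rewrite clamp_id// => p0; field; rewrite gt_eqF.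
have M0 : 0 < M.
  have := phiB 0; have -> : -1 <= (0 : R) <= 1 by lra.
  by move=> /(_ isT) /andP[a b]; exact: lt_le_trans (le_trans a b).
apply: (@le_trans _ _ (m ^+ 2 * itg (fun x => g' x ^+ 2))); last first.
  rewrite -itgZ; last exact: L2_sq.
  apply: itg_le; first by apply: itgbZ; exact: L2_sq.
    by apply: itgbB; [exact: itgbD|exact: L2_int].
  move=> x x11; rewrite E// ler_wpM2r ?sqr_ge0//.
  have /andP[a _] := phiB x x11; rewrite lerXn2r ?nnegrE ?(ltW m0)//.
  exact: le_trans (ltW m0) a.
rewrite -[leLHS]mulrA; apply: ler_wpM2l; first exact: sqr_ge0.
rewrite mulrC ler_pdivrMr ?mulr_gt0 ?exprn_gt0//.
have := poincare wg; rewrite /g hm1 mulr0 => /(_ erefl).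
have Ig : itgb (fun x => (psi x * h x) ^+ 2) by exact: L2_sq (wdL2 wg).
have : itg (fun x => h x ^+ 2) <= M ^+ 2 * itg (fun x => (psi x * h x) ^+ 2).
  rewrite -itgZ//; apply: itg_le; [exact: L2_sq (wdL2 w)|exact: itgbZ|].
  move=> x x11; have /andP[a b] := phiB x x11; rewrite /psi clamp_id//.
  have p0 : 0 < phi x by exact: lt_le_trans a.
  have -> : M ^+ 2 * ((phi x)^-1 * h x) ^+ 2 = (M / phi x) ^+ 2 * h x ^+ 2.
    by rewrite !exprMn exprVn; ring.
  rewrite ler_peMl ?sqr_ge0// exprn_ege1// ler_pdivlMr// mul1r//.
move=> h2 h3; apply: (le_trans h2).
have -> : itg (fun x => g' x ^+ 2) * (4 * M ^+ 2) =
  M ^+ 2 * (4 * itg (fun x => g' x ^+ 2)) by ring.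
by apply: ler_wpM2l => //; exact: sqr_ge0.
Unshelve. all: by end_near. Qed.

End Jacobi.

Section Solution.
Context {R : realType}.
Implicit Types (Q g h k : triple R) (c r t x y l K M L eta : R).

Lemma qplusE : qplus (-8 : R) = 2 / 3.
Proof.
rewrite /qplus (_ : 1 - -8 = 3 ^+ 2 :> R); last by ring.
by rewrite sqrtr_sqr ger0_norm//; field.
Qed.

Definition dchi l : triple R := ((fun=> 0, fun x => - l * slope l x), fun=> 0).

Lemma chi_wd3 l : 0 < l -> wd3 (chi l) (dchi l).
Proof.
move=> l0; split; [exact: wd_cst| |exact: wd_cst].
apply: wd_dv; [|exact: continuous_sol|by move=> x _; exact: dv_sol].
have cs := continuous_slope l0.
by rewrite /q2 /=; cts.
Qed.

Lemma chi_admissible l : 0 < l -> admissible_ee (-8) (chi l).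
Proof.
move=> l0; split=> //; split.
- exact: wd3_H1_3 (chi_wd3 l0).
- by rewrite qplusE.
- by rewrite qplusE /q2 /= sol1// solN1//; split; field.
- by [].
Qed.

Definition dslopex l x : R := l * (l * (4 * sol l x - sol l x ^+ 3)).

Lemma continuous_dslopex l : 0 < l -> continuous (dslopex l).
Proof. by move=> l0; have cs := continuous_sol l0; rewrite /dslopex; cts. Qed.

Lemma dv_lslope l x : 0 < l -> `|x| <= 1 -> dv (fun x => l * slope l x) x (dslopex l x).
Proof.
move=> l0 x1; apply: (dv_eq (dvZ l (dv_slope x l0))).
by rewrite wellE ?sol_le2// /dslopex; ring.
Qed.

Lemma dv_lslopeI l : 0 < l ->
  forall x, -1 < x < 1 -> dv (fun x => l * slope l x) x (dslopex l x).
Proof. by move=> l0 x x11; apply: dv_lslope => //; rewrite ler_norml; lra. Qed.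

Lemma dv_dslopex l x : 0 < l ->
  dv (dslopex l) x (l ^+ 2 * (3 * sol l x ^+ 2 - 4) * (l * slope l x)).
Proof.
move=> l0; have ds := dv_sol x l0.
apply: (dv_eq (dvZ l (dvZ l (dvB (dvZ 4 ds) (dvX 2 ds))))).
by rewrite /=; ring.
Qed.

(** At q1 = 2/3 the first Euler-Lagrange equation holds for every q2, the third
one is trivial, and the second one reduces to q'' = l^2 q (q^2 - 4). *)
Lemma chi_critical l : 0 < l -> critical (-8) l (chi l).
Proof.
move=> l0; apply: (DE_critical _ (chi_wd3 l0)); first by case: (chi_admissible l0).
move=> h k [_ [_ h2m h2p] _] [_ w2 _].
have cs := continuous_slope l0.
have cp : continuous (fun x => l * slope l x) by cts.
have wd := wdM_cont w2 cp (@continuous_dslopex _ l0) (dv_lslopeI l0).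
set D := (X in weak_derivative _ X) in wd.
have LD : square_integrable D by case: wd.
have D0 : itg D = 0 by rewrite (itg_deriv wd) h2m h2p !mulr0 subr0.
rewrite /DE; have -> : itg (fun x => 2 * bil (dchi l) k x / l ^+ 2 +
   dpot (q1 (chi l) x) (q2 (chi l) x) (q3 (chi l) x) (q1 h x) (q2 h x) (q3 h x)) =
   itg (fun x => - (2 / l ^+ 2) * D x); last first.
  by rewrite itgZ ?D0 ?mulr0//; exact: L2_int.
apply: itg_ext => x x11; rewrite /bil /D /dchi /chi /q1 /q2 /q3 /= /dslopex.
rewrite /dpot /pot1 /pot2 /pot3 /wt.
move: (sol l x) (slope l x) (k.1.2 x) (h.1.2 x) (h.1.1 x) (h.2 x) (k.1.1 x) (k.2 x).
by move=> *; field; rewrite gt_eqF.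
Qed.

(** The first entry bounds the q1 direction, the second one the q2 direction,
where - q' is a positive solution of the linearised equation with values in
l * [sqrt C, sqrt (8 + C)]. *)
Definition coer l : R :=
  Num.min 16 (Cof l / (2 * l ^+ 2 * (8 + Cof l))).

Lemma coer_gt0 l : 0 < l -> 0 < coer l.
Proof.
move=> l0; have c0 := Cof_gt0 l0; rewrite lt_min; apply/andP; split => //.
by rewrite divr_gt0// !mulr_gt0 ?exprn_gt0// ltr_wpDl.
Qed.

Lemma linearised_lower_bound l (h k : R -> R) : 0 < l -> weak_derivative h k ->
  h (-1) = 0 -> h 1 = 0 ->
  coer l * itg (fun x => h x ^+ 2) <=
  itg (fun x => 2 * k x ^+ 2 / l ^+ 2 + 2 * (3 * sol l x ^+ 2 - 4) * h x ^+ 2).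
Proof.
move=> l0 w hm hp; have c0 := Cof_gt0 l0.
have cs := continuous_slope l0; have cq := continuous_sol l0.
have cp : continuous (fun x => l * slope l x) by cts.
have cW : continuous (fun x => l ^+ 2 * (3 * sol l x ^+ 2 - 4)) by cts.
have s0 : 0 < Num.sqrt (Cof l) by rewrite sqrtr_gt0.
have m0 : 0 < l * Num.sqrt (Cof l) by rewrite mulr_gt0.
have Lk : square_integrable k by case: w.
have I1 : itgb (fun x => k x ^+ 2 + l ^+ 2 * (3 * sol l x ^+ 2 - 4) * h x ^+ 2).
  apply: itgbD; first exact: L2_sq.
  have chc := wd_clamp_continuous w.
  have : continuous (fun x => l ^+ 2 * (3 * sol l x ^+ 2 - 4) * h (clamp x) ^+ 2) by cts.
  by move=> /itgb_cont; apply: itgb_ext => x /clamp_id ->.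
have B x : -1 <= x <= 1 ->
    l * Num.sqrt (Cof l) <= l * slope l x <= l * Num.sqrt (8 + Cof l).
  by move=> _; rewrite !ler_pM2l//; exact: wgt_bounds.
have dP x : -1 < x < 1 -> dv (fun x => l * slope l x) x (dslopex l x) /\
    dv (dslopex l) x (l ^+ 2 * (3 * sol l x ^+ 2 - 4) * (l * slope l x)).
  by move=> x11; split; [exact: dv_lslopeI|exact: dv_dslopex].
have := jacobi_lower_bound w hm hp cp (@continuous_dslopex _ l0) cW dP m0 B.
have -> : (l * Num.sqrt (Cof l)) ^+ 2 / (4 * (l * Num.sqrt (8 + Cof l)) ^+ 2) =
    Cof l / (4 * (8 + Cof l)).
  rewrite !exprMn !sqr_sqrtr; [|lra|lra].
  by field; apply/andP; split; rewrite gt_eqF//; lra.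
have -> : itg (fun x => 2 * k x ^+ 2 / l ^+ 2 + 2 * (3 * sol l x ^+ 2 - 4) * h x ^+ 2) =
    2 / l ^+ 2 * itg (fun x => k x ^+ 2 + l ^+ 2 * (3 * sol l x ^+ 2 - 4) * h x ^+ 2).
  by rewrite -itgZ//; apply: itg_ext => x _; field; rewrite gt_eqF.
have l2 : 0 < 2 / l ^+ 2 by rewrite divr_gt0// exprn_gt0.
rewrite -(ler_pM2l l2); apply: le_trans; rewrite mulrA ler_wpM2r//.
  by apply: itg_ge0 => x _; exact: sqr_ge0.
rewrite /coer ge_min; apply/orP; right; rewrite le_eqVlt; apply/orP; left.
by apply/eqP; field; rewrite !gt_eqF//; lra.
Qed.

(** Along the branch q1 = 2/3, so the coefficient 3 q1 - 2 of the coupling term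
vanishes and the two directions separate. *)
Lemma plane_lower_bound l (h1 h2 k1 k2 : R -> R) : 0 < l ->
  weak_derivative h1 k1 -> weak_derivative h2 k2 -> h2 (-1) = 0 -> h2 1 = 0 ->
  coer l * itg (fun x => h1 x ^+ 2 + h2 x ^+ 2) <=
  itg (fun x => (6 * k1 x ^+ 2 + 2 * k2 x ^+ 2) / l ^+ 2 + 16 * h1 x ^+ 2
      + 2 * (3 * sol l x ^+ 2 - 4) * h2 x ^+ 2).
Proof.
move=> l0 w1 w2 hm hp; have cq := continuous_sol l0.
have L1 : square_integrable k1 by case: w1.
have L2 : square_integrable k2 by case: w2.
have i1 := L2_sq (wdL2 w1); have i2 := L2_sq (wdL2 w2).
have j1 := L2_sq L1; have j2 := L2_sq L2.
have I2 : itgb (fun x => 2 * k2 x ^+ 2 / l ^+ 2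
    + 2 * (3 * sol l x ^+ 2 - 4) * h2 x ^+ 2).
  apply: itgbD; first by apply: itgbZr; exact: itgbZ.
  have chc := wd_clamp_continuous w2.
  have : continuous (fun x => 2 * (3 * sol l x ^+ 2 - 4) * h2 (clamp x) ^+ 2) by cts.
  by move=> /itgb_cont; apply: itgb_ext => x /clamp_id ->.
have I1 : itgb (fun x => 16 * h1 x ^+ 2) by exact: itgbZ.
have I0 : itgb (fun x => 6 * k1 x ^+ 2 / l ^+ 2) by apply: itgbZr; exact: itgbZ.
have -> : itg (fun x => (6 * k1 x ^+ 2 + 2 * k2 x ^+ 2) / l ^+ 2 + 16 * h1 x ^+ 2
      + 2 * (3 * sol l x ^+ 2 - 4) * h2 x ^+ 2) =
  itg (fun x => (6 * k1 x ^+ 2 / l ^+ 2 + 16 * h1 x ^+ 2) +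
    (2 * k2 x ^+ 2 / l ^+ 2 + 2 * (3 * sol l x ^+ 2 - 4) * h2 x ^+ 2)).
  by apply: itg_ext => x _; ring.
rewrite (itgD (itgbD I0 I1) I2) (itgD i1 i2) mulrDr.
apply: lerD; last exact: linearised_lower_bound.
apply: (@le_trans _ _ (16 * itg (fun x => h1 x ^+ 2))).
  apply: ler_wpM2r; first by apply: itg_ge0 => x _; exact: sqr_ge0.
  by rewrite /coer ge_min lexx.
rewrite -itgZ//; apply: itg_le => //; first exact: itgbD.
move=> x _; rewrite lerDr divr_ge0 ?sqr_ge0// mulr_ge0// sqr_ge0//.
Qed.

Lemma H10_bump : H10 (fun x : R => 1 - x ^+ 2).
Proof.
split; last 2 first.
- by rewrite sqrrN expr1n subrr.
- by rewrite expr1n subrr.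
exists (fun x => 0 - 2%:R * x ^+ 1 * 1); apply: wd_dv; [cts|cts|].
by move=> x _; apply: dvB; [exact: dv_cst|apply: dvX; exact: dv_id].
Qed.

Lemma nu_lower_bound kappa l Q : kappa = 4 \/ kappa = 2 -> 0 < l ->
  same_on Q (chi l) -> coer l <= nu kappa (-8) l Q.
Proof.
move=> hk l0 QE; apply: lb_le_inf.
  eexists; exists (fun=> 0), (fun x => 1 - x ^+ 2); split; last reflexivity.
  - by split=> //; exists (fun=> 0); exact: wd_cst.
  - exact: H10_bump.
  - by exists 0; [lra|rewrite expr0n subr0 oner_neq0 orbT].
move=> _ [h1 [h2 [[[g1 w1] h1m h1p] [[g2 w2] h2m h2p] [x x11 hx] ->]]].
have {}w1 := wder_wd w1; have {}w2 := wder_wd w2.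
have i1 := L2_sq (wdL2 w1); have i2 := L2_sq (wdL2 w2).
have N0 : 0 < itg (fun x => h1 x ^+ 2 + h2 x ^+ 2).
  rewrite itgD//; have n1 : 0 <= itg (fun x => h1 x ^+ 2).
    by apply: itg_ge0 => y _; exact: sqr_ge0.
  have n2 : 0 <= itg (fun x => h2 x ^+ 2) by apply: itg_ge0 => y _; exact: sqr_ge0.
  case/orP: hx => hx.
    by rewrite ltr_pwDl// (itg_sq_gt0 w1 x11).
  by rewrite ltr_wpDl// (itg_sq_gt0 w2 x11).
rewrite ler_pdivlMr//; apply: (le_trans (plane_lower_bound l0 w1 w2 h2m h2p)).
have L1 : square_integrable (wder h1) by case: w1.
have L2 : square_integrable (wder h2) by case: w2.
have c1 := wd_clamp_continuous w1; have c2 := wd_clamp_continuous w2.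
have cq := continuous_sol l0.
have IK : itgb (fun x => (6 * wder h1 x ^+ 2 + 2 * wder h2 x ^+ 2) / l ^+ 2).
  by apply: itgbZr; apply: itgbD; apply: itgbZ; exact: L2_sq.
have Phi_chi : Phi kappa (-8) l Q h1 h2 =
  itg (fun x => (6 * wder h1 x ^+ 2 + 2 * wder h2 x ^+ 2) / l ^+ 2
   + (6 * (4 / 3 + kappa * (2 / 3) + sol l x ^+ 2) * h1 x ^+ 2
      + 2 * (3 * sol l x ^+ 2 - 4) * h2 x ^+ 2)).
  apply: itg_ext => y y11; have [-> -> _] := QE y y11.
  have -> : q1 (chi l) y = 2 / 3 by [].
  have -> : q2 (chi l) y = sol l y by [].
  by move: (_ / l ^+ 2) => z; field.
rewrite Phi_chi; apply: itg_le.
- apply: itgbD; last first.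
    have : continuous (fun x => 2 * (3 * sol l x ^+ 2 - 4) * h2 (clamp x) ^+ 2) by cts.
    by move=> /itgb_cont; apply: itgb_ext => y /clamp_id ->.
  by apply: itgbD => //; exact: itgbZ.
- apply: itgbD => //.
  have : continuous (fun x => 6 * (4 / 3 + kappa * (2 / 3) + sol l x ^+ 2)
     * h1 (clamp x) ^+ 2 + 2 * (3 * sol l x ^+ 2 - 4) * h2 (clamp x) ^+ 2) by cts.
  by move=> /itgb_cont; apply: itgb_ext => y /clamp_id ->.
move=> y y11; rewrite -addrA lerD2l lerD2r ler_wpM2r ?sqr_ge0//.
by have := sqr_ge0 (sol l y); case: hk => ->; lra.
Qed.

Lemma nu_chi_gt0 kappa l Q : kappa = 4 \/ kappa = 2 -> 0 < l ->
  same_on Q (chi l) -> 0 < nu kappa (-8) l Q.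
Proof. by move=> hk l0 /(nu_lower_bound hk l0); apply: lt_le_trans; exact: coer_gt0. Qed.

End Solution.

(** * Uniqueness of critical points *)

Section Uniqueness.
Context {R : realType}.
Implicit Types (P Q d e g h k : triple R) (X : R -> triple R).
Implicit Types (c s t x y l L K M eta : R).

Lemma admissible_sub P Q : admissible (-8) P -> admissible (-8) Q -> H10_3 (Q - P).
Proof.
move=> [HP [p1 p1'] [p2 p2'] [p3 p3']] [HQ [u1 u1'] [u2 u2'] [u3 u3']].
have [k wQ] := H1_3_wd3 HQ; have [g wP] := H1_3_wd3 HP.
have [w1 w2 w3] := wd3B wQ wP.
have E1 x : q1 (Q - P) x = q1 Q x - q1 P x by [].
have E2 x : q2 (Q - P) x = q2 Q x - q2 P x by [].
have E3 x : q3 (Q - P) x = q3 Q x - q3 P x by [].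
split; (split; [by eexists; eassumption|rewrite ?E1 ?E2 ?E3..]).
- by rewrite p1 u1 subrr.
- by rewrite p1' u1' subrr.
- by rewrite p2 u2 subrr.
- by rewrite p2' u2' subrr.
- by rewrite p3 u3 subrr.
- by rewrite p3' u3' subrr.
Qed.

(** Testing the equations of two solutions against their difference. *)
Lemma critical_pair l P Q g k : critical (-8) l P -> critical (-8) l Q ->
  wd3 P g -> wd3 Q k ->
  itg (fun x => 2 * bil (k - g) (k - g) x / l ^+ 2
    + (dpot (q1 Q x) (q2 Q x) (q3 Q x) (q1 (Q - P) x) (q2 (Q - P) x) (q3 (Q - P) x)
     - dpot (q1 P x) (q2 P x) (q3 P x) (q1 (Q - P) x) (q2 (Q - P) x) (q3 (Q - P) x)))
  = 0.
Proof.
move=> cP cQ wP wQ; have wd := wd3B wQ wP.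
have h0 : H10_3 (Q - P) by apply: admissible_sub; [case: cP|case: cQ].
have D1 := critical_DE cQ wQ h0 wd; have D2 := critical_DE cP wP h0 wd.
have : DE l Q k (Q - P) (k - g) - DE l P g (Q - P) (k - g) = 0 by rewrite D1 D2 subrr.
rewrite /DE -itgB; last 2 first.
- apply: itgbD; last exact: itgb_dpot wQ wd.
  by apply: itgbZr; apply: itgbZ; exact: itgb_bil wQ wd.
- apply: itgbD; last exact: itgb_dpot wP wd.
  by apply: itgbZr; apply: itgbZ; exact: itgb_bil wP wd.
move=> <-; apply: itg_ext => x _.
have -> : bil (k - g) (k - g) x = bil k (k - g) x - bil g (k - g) x.
  have E1 : q1 (k - g) x = q1 k x - q1 g x by [].
  have E2 : q2 (k - g) x = q2 k x - q2 g x by [].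
  have E3 : q3 (k - g) x = q3 k x - q3 g x by [].
  by rewrite /bil E1 E2 E3; ring.
by ring.
Qed.

Lemma sqs_eq0_same P Q g k : wd3 P g -> wd3 Q k ->
  itg (fun x => sqs (q1 (Q - P) x) (q2 (Q - P) x) (q3 (Q - P) x)) <= 0 ->
  same_on Q P.
Proof.
move=> wP wQ; have wd := wd3B wQ wP; have [w1 w2 w3] := wd.
have [] := (wdL2 w1, wdL2 w2, wdL2 w3) => -[/L2_sq i1 /L2_sq i2] /L2_sq i3.
rewrite /sqs (itgD (itgbD i1 i2) i3) (itgD i1 i2).
have p f : 0 <= itg (fun x : R => f x ^+ 2) by apply: itg_ge0 => x _; exact: sqr_ge0.
have := p (q1 (Q - P)); have := p (q2 (Q - P)); have := p (q3 (Q - P)).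
have e1 := @itg_sq_eq0 _ _ _ _ w1; have e2 := @itg_sq_eq0 _ _ _ _ w2.
have e3 := @itg_sq_eq0 _ _ _ _ w3; move: e1 e2 e3.
move: (itg (fun x => q1 (Q - P) x ^+ 2)) => A.
move: (itg (fun x => q2 (Q - P) x ^+ 2)) => B.
move: (itg (fun x => q3 (Q - P) x ^+ 2)) => C.
move=> e1 e2 e3 C0 B0 A0 S0 x x11; split.
- by apply/eqP; rewrite -subr_eq0; apply/eqP; apply: (e1 _ _ x11); lra.
- by apply/eqP; rewrite -subr_eq0; apply/eqP; apply: (e2 _ _ x11); lra.
- by apply/eqP; rewrite -subr_eq0; apply/eqP; apply: (e3 _ _ x11); lra.
Qed.

Lemma poincare3 h k : H10_3 h -> wd3 h k ->
  itg (fun x => sqs (q1 h x) (q2 h x) (q3 h x)) <=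
  4 * itg (fun x => bil k k x).
Proof.
move=> [[_ h1 _] [_ h2 _] [_ h3 _]] w; have [w1 w2 w3] := w.
have [L1 L2 L3] := wd3_sub w.
have [] := (wdL2 w1, wdL2 w2, wdL2 w3) => -[/L2_sq i1 /L2_sq i2] /L2_sq i3.
have [] := (L2_sq L1, L2_sq L2, L2_sq L3) => -[j1 j2] j3.
have -> : itg (fun x => bil k k x) =
   3 * itg (fun x => q1 k x ^+ 2) + itg (fun x => q2 k x ^+ 2) + itg (fun x => q3 k x ^+ 2).
  have j1' := itgbZ 3 j1.
  rewrite -itgZ// -(itgD j1' j2) -(itgD (itgbD j1' j2) j3).
  by apply: itg_ext => x _; rewrite /bil -!expr2.
rewrite /sqs (itgD (itgbD i1 i2) i3) (itgD i1 i2).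
have := poincare w1 h1; have := poincare w2 h2; have := poincare w3 h3.
have : 0 <= itg (fun x => q1 k x ^+ 2) by apply: itg_ge0 => x _; exact: sqr_ge0.
move: (itg _) (itg _) (itg _) (itg _) (itg _) (itg _) => A B C D E F.
by lra.
Qed.

(** For short intervals the Dirichlet energy dominates the failure of convexity
of the potential. *)
Lemma small_unique l P Q : 0 < l -> 1600 * l ^+ 2 < 2 ->
  critical (-8) l P -> critical (-8) l Q -> same_on Q P.
Proof.
move=> l0 ls cP cQ.
have [g wP] : exists g, wd3 P g by apply: H1_3_wd3; case: cP => -[].
have [k wQ] : exists k, wd3 Q k by apply: H1_3_wd3; case: cQ => -[].
have wd := wd3B wQ wP; have CP := critical_pair cP cQ wP wQ.
have h0 : H10_3 (Q - P) by apply: admissible_sub; [case: cP|case: cQ].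
apply: (sqs_eq0_same wP wQ).
have PO := poincare3 h0 wd.
have IS := itgb_sqs wd; have IB := itgb_bil wd wd.
have : 2 / l ^+ 2 * itg (fun x => bil (k - g) (k - g) x) - 400 *
  itg (fun x => sqs (q1 (Q - P) x) (q2 (Q - P) x) (q3 (Q - P) x)) <= 0.
  rewrite -CP -!itgZ// -itgB; [|exact: itgbZ|exact: itgbZ].
  apply: itg_le.
  - by apply: itgbB; exact: itgbZ.
  - apply: itgbD; first by apply: itgbZr; exact: itgbZ.
    by apply: itgbB; [exact: itgb_dpot wQ wd|exact: itgb_dpot wP wd].
  move=> x x11.
  have := pot_monotone (q1 P x) (q2 P x) (q3 P x) (q1 Q x) (q2 Q x) (q3 Q x).
  have E1 : q1 (Q - P) x = q1 Q x - q1 P x by [].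
  have E2 : q2 (Q - P) x = q2 Q x - q2 P x by [].
  have E3 : q3 (Q - P) x = q3 Q x - q3 P x by [].
  rewrite -E1 -E2 -E3 mulNr => H.
  by rewrite [2 * bil _ _ _ / _]mulrAC; exact: lerD.
move: PO; set S := itg (fun x => sqs _ _ _); set B := itg _ => PO.
have S0 : 0 <= S by apply: itg_ge0 => x _; exact: sqs_ge0.
have : 1600 < 2 / l ^+ 2 by rewrite ltr_pdivlMr// exprn_gt0.
move: (2 / l ^+ 2) S B PO S0 => z S B PO S0 z1 H.
clear -PO S0 z1 H; nra.
Qed.

Lemma Cof_anti l L : 0 < l -> l <= L -> Cof L <= Cof l.
Proof.
move=> l0 lL; have L0 : 0 < L by exact: lt_le_trans lL.
rewrite leNgt; apply/negP => /(halflength_decr (Cof_gt0 l0)).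
by rewrite /halflength !CofE// ltNge lL.
Qed.

(** A larger parameter amounts to a longer interval, hence to a smaller C. *)
Lemma coer_anti l L : 0 < l -> l <= L -> coer L <= coer l.
Proof.
move=> l0 lL; have L0 : 0 < L by exact: lt_le_trans lL.
have cc := Cof_anti l0 lL; have c0 := Cof_gt0 L0.
have c1 : 0 < Cof l by exact: lt_le_trans cc.
rewrite /coer le_min ge_min lexx /= ge_min; apply/orP; right.
rewrite ler_pdivrMr; last by rewrite !mulr_gt0 ?exprn_gt0//; lra.
rewrite mulrAC ler_pdivlMr; last by rewrite !mulr_gt0 ?exprn_gt0//; lra.
have : l ^+ 2 <= L ^+ 2 by rewrite lerXn2r ?nnegrE ?(ltW l0) ?(ltW L0).
have : 0 < l ^+ 2 by rewrite exprn_gt0.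
move: (l ^+ 2) (L ^+ 2) (Cof l) (Cof L) cc c0 c1 => a b c d cd d0 c0 a0 ab.
have H : d * a <= c * b by apply: ler_pM => //; exact: ltW.
have H2 : d * a * (2 * 8) <= c * b * (2 * 8) by lra.
have H3 : d * c * a <= d * c * b by rewrite ler_pM2l// mulr_gt0.
clear -H H3; lra.
Qed.

(** The linear part is the second variation along the branch; the terms of
higher order are absorbed by the last one. *)
Lemma dpot_near_chi b u v eta : `|b| <= 2 -> `|u| <= eta -> `|v| <= eta -> eta <= 1 ->
  (24 + 6 * b ^+ 2) * u ^+ 2 + (6 * b ^+ 2 - 8) * v ^+ 2 - 120 * eta * (u ^+ 2 + v ^+ 2)
  <= dpot (2 / 3 + u) (b + v) 0 u v 0 - dpot (2 / 3) b 0 u v 0.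
Proof.
move=> b2 u1 v1 e1.
have -> : dpot (2 / 3 + u) (b + v) 0 u v 0 - dpot (2 / 3) b 0 u v 0 =
  (24 + 6 * b ^+ 2) * u ^+ 2 + (6 * b ^+ 2 - 8) * v ^+ 2 +
  ((48 * u + 18 * u ^+ 2 + 18 * b * v + 12 * v ^+ 2) * u ^+ 2
   + (6 * b * v + 2 * v ^+ 2) * v ^+ 2).
  by rewrite /dpot /pot1 /pot2 /wt; field.
rewrite lerD2l mulrDr opprD; have uu := sqr_ge0 u; have vv := sqr_ge0 v.
have bv : - (2 * eta) <= b * v.
  rewrite lerNl; apply: le_trans (ler_norm _) _; rewrite normrN normrM.
  by apply: ler_pM.
have e0 : 0 <= eta by exact: le_trans u1.
rewrite -!mulNr; apply: lerD; apply: ler_wpM2r => //.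
  by move: u1; rewrite ler_norml => /andP[]; lra.
by lra.
Qed.

(** The second variation stays coercive in a neighbourhood of chi for the
supremum norm, whose size depends only on coer l. *)
Lemma local_unique l Q eta : 0 < l -> critical (-8) l Q ->
  (forall x, -1 <= x <= 1 -> q3 Q x = 0) -> 0 <= eta <= 1 -> 120 * eta < coer l ->
  (forall x, -1 <= x <= 1 ->
     `|q1 Q x - q1 (chi l) x| <= eta /\ `|q2 Q x - q2 (chi l) x| <= eta) ->
  same_on Q (chi l).
Proof.
move=> l0 cQ q30 /andP[e0 e1] ec near; set P := chi l.
have wP := chi_wd3 l0; have cP := chi_critical l0.
have [k wQ] : exists k, wd3 Q k by apply: H1_3_wd3; case: cQ => -[].
have wd := wd3B wQ wP; have CP := critical_pair cP cQ wP wQ.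
have h0 : H10_3 (Q - P) by apply: admissible_sub; [case: cP|case: cQ].
have IS := itgb_sqs wd; have IB := itgb_bil wd wd; have [w1 w2 w3] := wd.
have [L1 L2 L3] := wd3_sub wd.
have [] := (wdL2 w1, wdL2 w2) => /L2_sq i1 /L2_sq i2.
have [j1 j2] := (L2_sq L1, L2_sq L2).
apply: (sqs_eq0_same wP wQ).
have -> : itg (fun x => sqs (q1 (Q - P) x) (q2 (Q - P) x) (q3 (Q - P) x)) =
   itg (fun x => q1 (Q - P) x ^+ 2 + q2 (Q - P) x ^+ 2).
  apply: itg_ext => x x11; rewrite /sqs.
  have -> : q3 (Q - P) x = q3 Q x - q3 P x by [].
  by rewrite q30// subrr expr0n addr0.
have := plane_lower_bound l0 w1 w2 (let: And3 _ (And3 _ a _) _ := h0 in a)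
   (let: And3 _ (And3 _ _ a) _ := h0 in a).
set S := itg (fun x => q1 (Q - P) x ^+ 2 + _).
have S0 : 0 <= S by apply: itg_ge0 => x _; rewrite addr_ge0 ?sqr_ge0.
set T := itg _ => CS.
have IT : itgb (fun x => (6 * q1 (k - dchi l) x ^+ 2 + 2 * q2 (k - dchi l) x ^+ 2) / l ^+ 2
  + 16 * q1 (Q - P) x ^+ 2 + 2 * (3 * sol l x ^+ 2 - 4) * q2 (Q - P) x ^+ 2).
  apply: itgbD.
    apply: itgbD; last exact: itgbZ.
    by apply: itgbZr; apply: itgbD; exact: itgbZ.
  have chc := wd_clamp_continuous w2; have cq := continuous_sol l0.
  have : continuous (fun x => 2 * (3 * sol l x ^+ 2 - 4) * q2 (Q - P) (clamp x) ^+ 2) by cts.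
  by move=> /itgb_cont; apply: itgb_ext => x /clamp_id ->.
have : T - 120 * eta * S <= 0.
  have Is := itgbD i1 i2.
  rewrite -CP /T /S -itgZ// -itgB//; last exact: itgbZ.
  apply: itg_le.
  - by apply: itgbB => //; exact: itgbZ.
  - apply: itgbD; first by apply: itgbZr; exact: itgbZ.
    by apply: itgbB; [exact: itgb_dpot wQ wd|exact: itgb_dpot wP wd].
  move=> x x11; have [n1 n2] := near x x11.
  have b2 : `|sol l x| <= 2 by apply: sol_le2 => //; rewrite ler_norml.
  have := dpot_near_chi b2 n1 n2 e1.
  have -> : 2 / 3 + (q1 Q x - q1 (chi l) x) = q1 Q x.
    by have -> : q1 (chi l) x = 2 / 3 by []; ring.
  have -> : sol l x + (q2 Q x - q2 (chi l) x) = q2 Q x.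
    by have -> : q2 (chi l) x = sol l x by []; ring.
  have E1 : q1 (Q - P) x = q1 Q x - q1 P x by [].
  have E2 : q2 (Q - P) x = q2 Q x - q2 P x by [].
  have E3 : q3 (Q - P) x = 0.
    by have -> : q3 (Q - P) x = q3 Q x - q3 P x by []; rewrite q30// subrr.
  rewrite E3 -E1 -E2.
  have -> : q3 Q x = 0 by exact: q30.
  have -> : q1 P x = 2 / 3 by [].
  have -> : q2 P x = sol l x by [].
  have -> : q3 P x = 0 by [].
  move: (dpot (q1 Q x) _ _ _ _ _) (dpot (2 / 3) _ _ _ _ _) => A B H.
  have Hb : (6 * q1 (k - dchi l) x ^+ 2 + 2 * q2 (k - dchi l) x ^+ 2) / l ^+ 2 <=
    2 * bil (k - dchi l) (k - dchi l) x / l ^+ 2.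
    rewrite ler_wpM2r// ?invr_ge0 ?sqr_ge0// /bil.
    have := sqr_ge0 (q3 (k - dchi l) x).
    move: (q1 _ x) (q2 _ x) (q3 _ x) => a b c; nra.
  move: (_ / l ^+ 2) (2 * bil _ _ _ / _) Hb => z z' Hb.
  have := mulr_ge0 (sqr_ge0 (sol l x)) (sqr_ge0 (q1 (Q - P) x)).
  have := sqr_ge0 (q1 (Q - P) x).
  move: (q1 (Q - P) x ^+ 2) (q2 (Q - P) x ^+ 2) H => u v H u0 su.
  clear -Hb H u0 su; nra.
move: S0 CS ec; move: S T (coer l) => S T c S0 CS ec H.
clear -S0 CS ec H; nra.
Qed.

End Uniqueness.

(** * Continuation of branches *)

Section Continuation.
Context {R : realType}.
Implicit Types (P Q d e g h k : triple R) (X : R -> triple R).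
Implicit Types (c s t x y l L K M eta eps : R).

Definition sup_near P Q eps := forall x : R, -1 <= x <= 1 ->
  [/\ `|q1 P x - q1 Q x| <= eps, `|q2 P x - q2 Q x| <= eps
    & `|q3 P x - q3 Q x| <= eps].

Lemma sup_near_sym P Q eps : sup_near P Q eps -> sup_near Q P eps.
Proof. by move=> H x x11; rewrite !(distrC (_ Q x)); exact: H. Qed.

Lemma sup_near_trans P Q S eps eps' : sup_near P Q eps -> sup_near Q S eps' ->
  sup_near P S (eps + eps').
Proof.
move=> H H' x x11; have [a1 a2 a3] := H x x11; have [b1 b2 b3] := H' x x11.
split; [apply: (le_trans (ler_distD (q1 Q x) _ _))
  |apply: (le_trans (ler_distD (q2 Q x) _ _))
  |apply: (le_trans (ler_distD (q3 Q x) _ _))]; exact: lerD.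
Qed.

Lemma sup_near_chi l eps : 0 < l -> 0 < eps -> exists2 del : R, 0 < del &
  forall l', `|l' - l| < del -> sup_near (chi l') (chi l) eps.
Proof.
move=> l0 e0; have /qdiffP [K K0 [d /andP[d0 _] H]] := qdiff_sol l0.
exists (Num.min d (eps / (K + 1))); first by rewrite lt_min d0 divr_gt0//; lra.
move=> l'; rewrite lt_min ltr_pdivlMr; last by lra.
move=> /andP[l'd l'e] x x11; split=> [||]; last 1 first.
- by rewrite subrr normr0 ltW.
- by rewrite subrr normr0 ltW.
have [_ _ _] := H l' x l'd (ltac:(by rewrite absle1)).
rewrite /chi /q2 /= => /le_trans; apply.
have := normr_ge0 (l' - l); move: `|l' - l| l'e => z; clear -K0; nra.
Qed.

Lemma smooth_curve_cont (A : set R) X l eps : smooth_curve A X -> A l ->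
  (exists2 d : R, 0 < d & forall t, `|t| < d -> A (l + t)) -> 0 < eps ->
  exists2 del : R, 0 < del & forall l', `|l' - l| < del -> sup_near (X l') (X l) eps.
Proof.
move=> [D [<- H]] Al [d d0 dA] e0; have [HD1 _] := H 1%N l Al.
have [HX cv] := H 0%N l Al; have [w1 wD1] := H1_3_wd3 HD1.
have [w0 wD0] := H1_3_wd3 HX.
have [M M0 MB] := wd3_bounded wD1.
have : \forall t \near (0 : R)^',
    `|0 - H1norm3 (t^-1 *: (D 0%N (l + t) - D 0%N l) - D 1%N l)| <= 1.
  by move/cvgrPdist_le: cv => /(_ 1 ltr01).
move=> /nbhs_ballP[r r0 Hr].
exists (Num.min (Num.min d r) (eps / (M + 2))).
  by rewrite !lt_min d0 divr_gt0//= ?r0//; lra.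
move=> l'; rewrite !lt_min ltr_pdivlMr; last by lra.
move=> /andP[/andP[l'd l'r] l'e].
have [->|ll] := eqVneq l' l.
  by move=> x _; split; rewrite subrr normr0 ltW.
set t := l' - l; have t0 : t != 0 by rewrite subr_eq0.
have lt : l + t = l' by rewrite /t; ring.
have := Hr t; rewrite /= /ball /= sub0r normrN => /(_ l'r t0).
rewrite sub0r normrN ger0_norm ?H1norm3_ge0// lt => N1.
have [HX' _] := H 0%N _ (dA t l'd); rewrite lt in HX'.
have [w' wD'] := H1_3_wd3 HX'.
have wd := wd3B (wd3Z t^-1 (wd3B wD' wD0)) wD1.
move=> x x11; have [b1 b2 b3] := MB x x11.
have [] := H1norm3_sup wd x11.
have -> : H1norm3 (scale3 t^-1 (D 0%N l' - D 0%N l) - D 1%N l) =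
  H1norm3 (t^-1 *: (D 0%N l' - D 0%N l) - D 1%N l) by [].
have bnd (u v z : R) : `|z| <= M ->
    `|t^-1 * (u - v) - z| <= 2 * H1norm3 (t^-1 *: (D 0%N l' - D 0%N l) - D 1%N l) ->
    `|u - v| <= eps.
  move=> zM uv.
  have -> : u - v = t * ((t^-1 * (u - v) - z) + z) by field.
  rewrite normrM; have := ler_normD (t^-1 * (u - v) - z) z.
  move: uv N1 zM; move: `|_ + z| `|_ - z| `|z| (H1norm3 _) => a1 a2 a3 a4.
  have := normr_ge0 t; move: l'e; rewrite -/t; move: `|t| => T.
  clear -M0 e0; move=> h1 h2 h3 h4 h5 h6.
  have : T * a1 <= T * (M + 2) by apply: ler_wpM2l => //; lra.
  by lra.
by split; [exact: (bnd _ _ (q1 (D 1%N l) x))|exact: (bnd _ _ (q2 (D 1%N l) x))|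
  exact: (bnd _ _ (q3 (D 1%N l) x))].
Qed.

(** Continuation: the set of parameters up to which a branch agrees with chi is
open by local uniqueness, closed by continuity. *)
Lemma branch_eq_chi kappa l0 (ls : \bar R) X : is_branch kappa (-8) l0 ls X ->
  forall l, 0 < l -> (l%:E < ls)%E -> same_on (X l) (chi l).
Proof.
move=> [[l00 l0s] uniq smX crX _] L L0 Ls.
pose A := [set t | t <= L /\ forall s, 0 < s <= t -> same_on (X s) (chi s)].
have small s : 0 < s < l0 -> same_on (X s) (chi s).
  move=> s0 x x11; have [|a b c] := uniq s s0 (chi s) _ x x11.
    by apply: chi_critical; case/andP: s0.
  by split; apply/esym.
have [t0 t00 t0A] : exists2 t : R, 0 < t & A t.
  exists (Num.min (l0 / 2) L); first by rewrite lt_min L0 andbT divr_gt0.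
  split; first by rewrite ge_min lexx orbT.
  by move=> s /andP[s0]; rewrite le_min => /andP[s1 _]; apply: small; rewrite s0/=; lra.
have supA : has_sup A by split; [exists t0|exists L => t []].
set s := sup A; have ts : t0 <= s by exact: sup_upper_bound.
have s0 : 0 < s by exact: lt_le_trans ts.
have sL : s <= L by apply: sup_le_ub; [exists t0|move=> t []].
pose B : set R := [set l | 0 < l /\ (l%:E < ls)%E].
have Bs : B s by split => //; apply: le_lt_trans Ls; rewrite lee_fin.
have BsO : exists2 d : R, 0 < d & forall t, `|t| < d -> B (s + t).
  have [r r0 rP] : exists2 r : R, 0 < r & forall t, t < r -> ((s + t)%:E < ls)%E.
    case: (ls) Ls Bs.2 => [b| |]//= Lb sb.
      by exists (b - s); [move: sb; rewrite lte_fin; lra|move=> t; rewrite lte_fin; lra].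
    by exists 1 => // t _; rewrite ltry.
  exists (Num.min r s); first by rewrite lt_min r0.
  move=> t; rewrite lt_min => /andP[tr]; rewrite ltr_norml => /andP[t1 t2].
  by split; [lra|apply: rP; apply: le_lt_trans tr; exact: ler_norm].
have [eta [eta0 eta1 etaL]] :
    exists eta : R, [/\ 0 < eta, eta <= 1 & 120 * eta < coer L].
  move: (coer L) (coer_gt0 L0) => c c0; exists (Num.min 1 (c / 240)); split.
  - by rewrite lt_min ltr01 /=; lra.
  - by rewrite ge_min lexx.
  - have : Num.min 1 (c / 240) <= c / 240 by rewrite ge_min lexx orbT.
    by move: (Num.min _ _) => z; lra.
have e4 : 0 < eta / 4 by rewrite divr_gt0.
have e44 : eta / 4 + eta / 4 + (eta / 4 + eta / 4) = eta by field.
have [d1 d10 H1] := smooth_curve_cont smX Bs BsO e4.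
have [d2 d20 H2] := sup_near_chi s0 e4.
pose d := Num.min d1 d2; have d0 : 0 < d by rewrite lt_min d10.
have d2' : 0 < d / 2 by rewrite divr_gt0.
have dd : d / 2 < d by rewrite ltr_pdivrMr// ltr_pMr// ltr1n.
have [t [tL tA] st] := sup_adherent d0 supA; rewrite -/s in st.
have tles : t <= s by apply: sup_upper_bound.
pose t' := Num.max t t0.
have t'A : A t'.
  by rewrite /t'; case: (leP t t0) => _.
have {}st : s - d < t' by rewrite /t' lt_max st.
have {}tles : t' <= s by rewrite ge_max tles.
have t'0 : 0 < t' by rewrite lt_max t00 orbT.
have near_s u : s - d < u -> u < s + d -> 0 < u -> u <= L -> same_on (X u) (chi u).
  move=> ud ud' u0 uL.
  have Bu : B u by split => //; apply: le_lt_trans Ls; rewrite lee_fin.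
  have [adm cu _] := crX u u0 Bu.2.
  have [ud1 ud2] : `|u - s| < d1 /\ `|u - s| < d2.
    by apply/andP; rewrite -lt_min -/d ltr_norml; lra.
  have [td1 td2] : `|t' - s| < d1 /\ `|t' - s| < d2.
    by apply/andP; rewrite -lt_min -/d ltr_norml; lra.
  have N1 := sup_near_trans (H1 _ ud1) (sup_near_sym (H1 _ td1)).
  have N2 := sup_near_trans (H2 _ td2) (sup_near_sym (H2 _ ud2)).
  apply: (@local_unique _ u (X u) eta) => //.
  - by case: adm.
  - by rewrite (ltW eta0).
  - by apply: lt_le_trans etaL _; exact: coer_anti.
  have [_ t'S] := t'A; have {}t'S := t'S t' (ltac:(by rewrite t'0 lexx)).
  move=> x x11; have [a1 a2 _] := N1 x x11; have [b1 b2 _] := N2 x x11.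
  have [c1 c2 _] := t'S x x11; rewrite c1 in a1; rewrite c2 in a2.
  split; apply: (le_trans (ler_distD _ _ _)).
    by apply: le_trans (lerD a1 b1) _; rewrite e44.
  by apply: le_trans (lerD a2 b2) _; rewrite e44.
have [sL'|sL'] := ltP (s + d / 2) L.
  suff : A (s + d / 2).
    by move=> /(sup_upper_bound supA); rewrite -/s leNgt ltrDl d2'.
  split; first exact: ltW.
  move=> u /andP[u0 us]; have [ut|ut] := leP u t'; first by apply: t'A.2; rewrite u0.
  apply: near_s => //; [exact: lt_trans ut| |exact: le_trans us (ltW sL')].
  by apply: (le_lt_trans us); rewrite ltrD2l.
apply: near_s; [|by apply: (le_lt_trans sL'); rewrite ltrD2l|exact: L0|exact: lexx].
by apply: lt_le_trans sL; rewrite ltrBlDr ltrDl.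
Qed.

(** At a finite end point nu would tend to 0, although it is bounded below by
coer, which does not increase. *)
Lemma branch_infinite kappa l0 (ls : \bar R) X : kappa = 4 \/ kappa = 2 ->
  is_branch kappa (-8) l0 ls X -> ls = +oo%E.
Proof.
move=> hk br; have eqX := branch_eq_chi br.
case: br => [[l00 l0s] _ _ _ [//|[l lsE cv]]]; exfalso; subst ls.
have l1 : 0 < l by apply: lt_le_trans l00 _; move: l0s; rewrite lee_fin.
have cl := coer_gt0 l1.
have ev : \forall t \near l^'-, coer l <= nu kappa (-8) t (X t).
  near=> t.
  have tl : t < l by near: t; exact: nbhs_left_lt.
  have t0 : 0 < t by near: t; exact: nbhs_left_gt.
  apply: (le_trans (coer_anti t0 (ltW tl))).
  by apply: nu_lower_bound => //; apply: eqX => //; rewrite lte_fin.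
have : coer l <= 0.
  have cn : cvg (nu kappa (-8) t (X t) @[t --> l^'-]) by apply/cvg_ex; exists 0.
  rewrite -(cvg_lim _ cv) //; exact: limr_ge.
by rewrite leNgt cl.
Unshelve. all: by end_near. Qed.

Lemma chi_is_branch kappa : kappa = 4 \/ kappa = 2 ->
  is_branch kappa (-8) (1 / 30 : R) +oo%E chi.
Proof.
move=> hk; split.
- by rewrite leey; split; rewrite // divr_gt0.
- move=> l /andP[l0 l1] Q cQ.
  (* 1600 / 30^2 < 2 *)
  have l2 : 1600 * l ^+ 2 < 2 by move: l l0 l1 {cQ} => l l0 l1; nra.
  exact: small_unique l0 l2 (chi_critical l0) cQ.
- have [D [D0 DP]] := chi_smooth (R := R); exists D; split => // k l [l0 _].
  exact: DP.
- move=> l l0 _; split; [exact: chi_admissible|exact: chi_critical|].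
  by apply: nu_chi_gt0.
- by left.
Qed.

End Continuation.

(** * Linear equations of the second order *)

Section LinearEquation.
Context {R : realType}.
Implicit Types (a u : nat -> R) (f g W V phi : R -> R) (c x y t s M K eps : R) (k m n : nat).

Lemma geometric_lt c eps : 0 < eps -> exists n, c * 2^-1 ^+ n < eps.
Proof.
move=> e0; exists (Num.bound (`|c| / eps)).
have := upper_nthrootP (leqnn (Num.bound (`|c| / eps))).
move: (Num.bound _) => n; rewrite ltr_pdivrMr// => H.
rewrite exprVn ltr_pdivrMr ?exprn_gt0// mulrC; exact: le_lt_trans (ler_norm c) H.
Qed.

(** The limit is the supremum of the lower error bounds
a n - 2 c 2^-n. *)
Lemma geometric_limit a c : 0 <= c ->
  (forall n, `|a n.+1 - a n| <= c * 2^-1 ^+ n) ->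
  exists s : R, forall n, `|s - a n| <= 2 * c * 2^-1 ^+ n.
Proof.
move=> c0 H; have p n : 0 < 2^-1 ^+ n :> R by rewrite exprn_gt0.
have B n j : `|a (n + j)%N - a n| <= 2 * c * 2^-1 ^+ n - 2 * c * 2^-1 ^+ (n + j).
  elim: j => [|j IH]; first by rewrite addn0 !subrr normr0.
  rewrite addnS; have -> : a (n + j).+1 - a n = (a (n + j).+1 - a (n + j)%N) + (a (n + j)%N - a n).
    by ring.
  apply: (le_trans (ler_normD _ _)); apply: (le_trans (lerD (H _) IH)).
  by rewrite exprS; lra.
have L n m : a m - 2 * c * 2^-1 ^+ m <= a n + 2 * c * 2^-1 ^+ n.
  have cp k : 0 <= 2 * c * 2^-1 ^+ k by rewrite !mulr_ge0 ?(ltW (p k)).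
  have := cp m; have := cp n; case: (leqP m n) => mn.
    by have := B m (n - m)%N; rewrite subnKC// ler_norml => /andP[h _]; lra.
  by have := B n (m - n)%N; rewrite subnKC 1?ltnW// ler_norml => /andP[_ h]; lra.
pose A := [set x | exists m, x = a m - 2 * c * 2^-1 ^+ m].
exists (sup A) => n; rewrite ler_norml; apply/andP; split.
  suff : a n - 2 * c * 2^-1 ^+ n <= sup A by lra.
  apply: ub_le_sup; last by exists n.
  by exists (a n + 2 * c * 2^-1 ^+ n) => _ [m ->].
suff : sup A <= a n + 2 * c * 2^-1 ^+ n by lra.
by apply: sup_le_ub; [exists (a n - 2 * c * 2^-1 ^+ n); exists n|move=> _ [m ->]].
Qed.

Lemma continuous_flip f : continuous f -> continuous (fun y => f (- y)).
Proof. by move=> cf; apply: (@continuous_comp' _ f (fun y => - y)) => //; cts. Qed.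

Lemma prim_norm_le f g x : continuous f -> continuous g -> 0 <= x ->
  (forall y, 0 <= y -> `|f y| <= g y) -> `|prim f x| <= prim g x.
Proof.
move=> cf cg x0 fg; have cNf : continuous (fun y => - f y) by cts.
have h1 : prim f x - prim f 0 <= prim g x - prim g 0.
  by apply: prim_le => // y /andP[y0 _]; exact: le_trans (ler_norm _) (fg y y0).
have h2 : prim (fun y => - f y) x - prim (fun y => - f y) 0 <= prim g x - prim g 0.
  apply: prim_le => // y /andP[y0 _]; apply: le_trans (fg y y0).
  by rewrite -normrN ler_norm.
by move: h1 h2; rewrite !prim0// primN// ler_norml; lra.
Qed.

Lemma prim_opp f x : continuous f -> prim f (- x) = - prim (fun y => f (- y)) x.
Proof.
move=> cf; have cN := continuous_flip cf.
have D y : dv (fun y => - prim f (- y)) y (f (- y)).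
  apply: (dv_eq (dvN (dv_comp (dv_prim (- y) cf) (dvN (dv_id y))))); ring.
have := primEg 0 x cN D; rewrite oppr0 !prim0// oppr0 !addr0 => ->.
by rewrite subr0 opprK.
Qed.

Lemma prim2_opp f x : continuous f ->
  prim (prim f) (- x) = prim (prim (fun y => f (- y))) x.
Proof.
move=> cf; have cN := continuous_flip cf.
rewrite prim_opp; last exact: continuous_prim.
have -> : (fun y => prim f (- y)) = (fun y => - prim (fun z => f (- z)) y).
  by apply/funext => y; rewrite prim_opp.
by rewrite primN ?opprK//; exact: continuous_prim.
Qed.

(** The majorant exp(Kx) + exp(-Kx) of the iteration: integrating twice divides
it by K^2. *)
Definition ch K x : R := expR (K * x) + expR (- (K * x)).
Definition sh K x : R := expR (K * x) - expR (- (K * x)).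

Lemma dv_expK c x : dv (fun x => expR (c * x)) x (c * expR (c * x)).
Proof.
apply: (dv_eq (dv_comp (is_derive_expR (c * x)) (dvZ c (dv_id x)))).
by rewrite mulr1 mulrC.
Qed.

Lemma dv_expNK K x : dv (fun x => expR (- (K * x))) x (- K * expR (- (K * x))).
Proof.
have -> : (fun x => expR (- (K * x))) = (fun x => expR (- K * x)).
  by apply/funext => y; rewrite mulNr.
by apply: (dv_eq (dv_expK (- K) x)); rewrite (mulNr K x).
Qed.

Lemma dv_ch K x : dv (ch K) x (K * sh K x).
Proof. by apply: (dv_eq (dvD (dv_expK K x) (dv_expNK K x))); rewrite /sh; ring. Qed.

Lemma dv_sh K x : dv (sh K) x (K * ch K x).
Proof. by apply: (dv_eq (dvB (dv_expK K x) (dv_expNK K x))); rewrite /ch; ring. Qed.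

Lemma ch_ge1 K x : 1 <= ch K x.
Proof.
have e1 := expR_gt0 (K * x); have e2 := expR_gt0 (- (K * x)); rewrite /ch.
case: (leP 0 (K * x)) => h; first by have := expR_ge1Dx (K * x); lra.
by have := expR_ge1Dx (- (K * x)); lra.
Qed.

Lemma chN K x : ch K (- x) = ch K x.
Proof. by rewrite /ch mulrN opprK addrC. Qed.

Lemma continuous_ch K : continuous (ch K).
Proof. exact: dv_continuous (dv_ch K). Qed.

Lemma prim2_majorant f c K x : 0 < K -> 0 <= c -> continuous f ->
  (forall y, `|f y| <= c * K ^+ 2 * ch K y) -> `|prim (prim f) x| <= c * ch K x.
Proof.
move=> K0 c0 + +; wlog x0 : f x / 0 <= x.
  move=> W cf fB; case: (leP 0 x) => [x0|x0]; first exact: W.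
  rewrite -(opprK x) prim2_opp// chN; apply: W; first by lra.
    exact: continuous_flip.
  by move=> y; rewrite -(chN K y); exact: fB.
move=> cf fB; have cc := continuous_ch (K := K).
have csh : continuous (sh K) by exact: dv_continuous (dv_sh K).
have cpf := continuous_prim cf.
have cg : continuous (fun y => c * K ^+ 2 * ch K y) by cts.
have ch2 : continuous (fun y => c * K * sh K y) by cts.
have B1 y : 0 <= y -> `|prim f y| <= c * K * sh K y.
  move=> y0.
  have G : prim (fun y => c * K ^+ 2 * ch K y) y = c * K * sh K y.
    have D z : dv (fun y => c * K * sh K y) z (c * K ^+ 2 * ch K z).
      by apply: (dv_eq (dvZ (c * K) (dv_sh K z))); ring.
    have := primEg 0 y cg D; rewrite prim0// subr0 => ->.
    by rewrite /sh mulr0 oppr0 subrr mulr0 subr0.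
  by rewrite -G; apply: prim_norm_le => // z _; exact: fB.
have G : prim (fun y => c * K * sh K y) x = c * ch K x - c * 2.
  have D z : dv (fun y => c * ch K y) z (c * K * sh K z).
    by apply: (dv_eq (dvZ c (dv_ch K z))); ring.
  have := primEg 0 x ch2 D; rewrite prim0// subr0 => ->.
  by rewrite /ch mulr0 oppr0 expR0; ring.
have : `|prim (prim f) x| <= c * ch K x - c * 2.
  by rewrite -G; apply: prim_norm_le => // z z0; exact: B1.
lra.
Qed.

Fixpoint picard W n : R -> R :=
  if n is n'.+1 then fun x => 1 + prim (prim (fun y => W y * picard W n' y)) x
  else fun=> 0.

Lemma continuous_picard W n : continuous W -> continuous (picard W n).
Proof.
move=> cW; elim: n => [|n IH] /=; first by cts.
have c1 : continuous (prim (prim (fun y => W y * picard W n y))).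
  by do 2 apply: continuous_prim; cts.
by cts.
Qed.

Lemma picardN W n x : continuous W -> (forall y, W (- y) = W y) ->
  picard W n (- x) = picard W n x.
Proof.
move=> cW eW; elim: n x => [//|n IH] x /=.
have cp := continuous_picard (n := n) cW.
rewrite prim2_opp; last by cts.
by congr (1 + prim (prim _) x); apply/funext => y; rewrite eW IH.
Qed.

Lemma picard_step W M K n x : continuous W -> (forall y, `|W y| <= M) ->
  0 < K -> K ^+ 2 = 2 * M ->
  `|picard W n.+1 x - picard W n x| <= ch K x * 2^-1 ^+ n.
Proof.
move=> cW WM K0 KM; elim: n x => [|n IH] x.
  rewrite /= subr0 mulr1.
  have -> : (fun y => W y * 0) = (fun=> 0) by apply/funext => y; rewrite mulr0.
  have -> : prim (fun=> 0) = (fun=> 0) :> (R -> R).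
    by apply/funext => y; rewrite prim_cst mul0r.
  by rewrite prim_cst mul0r addr0 normr1 ch_ge1.
have c1 := continuous_picard (n := n.+1) cW; have c0 := continuous_picard (n := n) cW.
have E : picard W n.+2 x - picard W n.+1 x =
  prim (prim (fun y => W y * picard W n.+1 y - W y * picard W n y)) x.
  have -> : prim (fun y => W y * picard W n.+1 y - W y * picard W n y) =
    (fun y => prim (fun y => W y * picard W n.+1 y) y - prim (fun y => W y * picard W n y) y).
    by apply/funext => y; rewrite primB//; cts.
  rewrite primB; [|by apply: continuous_prim; cts..].
  by rewrite [picard W n.+2 x]/= [X in _ - X = _]/=; ring.
rewrite E mulrC; apply: prim2_majorant => //.
  by cts.
move=> y; rewrite -mulrBr normrM KM exprS.
have -> : 2^-1 * 2^-1 ^+ n * (2 * M) * ch K y = M * (ch K y * 2^-1 ^+ n) by field.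
by apply: ler_pM.
Qed.

Lemma eq_geometric c x y : (forall n, `|x - y| <= c * 2^-1 ^+ n) -> x = y.
Proof.
move=> H; apply/eqP; rewrite -subr_eq0 -normr_le0 leNgt; apply/negP => e0.
by have [n] := geometric_lt c e0; rewrite ltNge H.
Qed.

(** Picard iteration on the whole line. The iterates are even because W is, and
so is the solution. *)
Lemma linear_ode W M : continuous W -> (forall y, `|W y| <= M) -> 0 < M ->
  (forall y, W (- y) = W y) -> exists phi, exists dphi : R -> R,
  [/\ phi 0 = 1, dphi 0 = 0, (forall x, dv phi x (dphi x)),
     (forall x, dv dphi x (W x * phi x)) & forall x, phi (- x) = phi x].
Proof.
move=> cW WM M0 eW; pose K := Num.sqrt (2 * M).
have K0 : 0 < K by rewrite sqrtr_gt0 mulr_gt0.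
have KM : K ^+ 2 = 2 * M by rewrite sqr_sqrtr// mulr_ge0// ltW.
have chp x : 0 <= ch K x by exact: le_trans ler01 (ch_ge1 K x).
have lim x := geometric_limit (chp x) (fun n => picard_step n x cW WM K0 KM).
pose phi x := sval (cid (lim x)).
have phiP x n : `|phi x - picard W n x| <= 2 * ch K x * 2^-1 ^+ n.
  by rewrite /phi; case: (cid _).
have cphi : continuous phi.
  move=> x; apply/cvgrPdist_le => e e0.
  have le11 : x - 1 <= x + 1 by lra.
  have [B B0 chB] := continuous_bounded le11 (continuous_ch (K := K)).
  have e3 : 0 < e / 3 by rewrite divr_gt0.
  have [n nB] := geometric_lt (2 * B) e3.
  have cp := continuous_picard (n := n) cW.
  near=> y.
  have yx : x - 1 <= y <= x + 1.
    have : `|x - y| <= 1 by near: y; exact: cvgr_dist_le.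
    by rewrite ler_norml; lra.
  have est z : x - 1 <= z <= x + 1 -> `|phi z - picard W n z| <= e / 3.
    move=> /chB; rewrite ger0_norm// => zB; apply: (le_trans (phiP z n)).
    apply: le_trans (ltW nB); apply: ler_wpM2r; first by rewrite exprn_ge0.
    by rewrite ler_wpM2l.
  have : `|picard W n x - picard W n y| <= e / 3.
    by near: y; move/cvgrPdist_le: (cp x) => /(_ _ e3).
  have := est x (ltac:(lra)); have := est y yx.
  by rewrite !ler_norml; lra.
have cWphi : continuous (fun y => W y * phi y) by cts.
have cp1 := continuous_prim cWphi.
have phiE x : phi x = 1 + prim (prim (fun y => W y * phi y)) x.
  apply: (@eq_geometric (2 * ch K x)) => n.
  have cp := continuous_picard (n := n) cW.
  have -> : phi x - (1 + prim (prim (fun y => W y * phi y)) x) =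
    (phi x - picard W n.+1 x) +
    prim (prim (fun y => W y * picard W n y - W y * phi y)) x.
    have -> : prim (fun y => W y * picard W n y - W y * phi y) =
      (fun y => prim (fun y => W y * picard W n y) y - prim (fun y => W y * phi y) y).
      by apply/funext => y; rewrite primB//; cts.
    rewrite primB//; last by apply: continuous_prim; cts.
    by rewrite /=; ring.
  apply: (le_trans (ler_normD _ _)).
  have -> : 2 * ch K x * 2^-1 ^+ n =
    2 * ch K x * 2^-1 ^+ n.+1 + 2^-1 ^+ n * ch K x by rewrite exprS; field.
  apply: lerD; first exact: phiP.
  apply: prim2_majorant => //.
    by cts.
  move=> y; rewrite -mulrBr normrM KM.
  have -> : 2^-1 ^+ n * (2 * M) * ch K y = M * (2 * ch K y * 2^-1 ^+ n) by ring.
  by rewrite distrC; apply: ler_pM.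
exists phi, (prim (fun y => W y * phi y)); split.
- by rewrite phiE prim0// addr0.
- by rewrite prim0.
- move=> x; apply: (dv_ext (fun y => esym (phiE y))).
  by apply: (dv_eq (dvD (dv_cst 1 x) (dv_prim x cp1))); rewrite add0r.
- by move=> x; exact: dv_prim.
- move=> x; apply: (@eq_geometric (2 * (2 * ch K x))) => n.
  have -> : phi (- x) - phi x = (phi (- x) - picard W n (- x)) - (phi x - picard W n x).
    by rewrite picardN//; ring.
  apply: (le_trans (ler_normB _ _)).
  have := phiP (- x) n; rewrite chN => h1; have := phiP x n => h2.
  by apply: (le_trans (lerD h1 h2)); rewrite le_eqVlt; apply/orP; left; apply/eqP; ring.
Unshelve. all: by end_near. Qed.

(** Gronwall: the energy f^2 + f'^2 grows at most exponentially, forwards and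
backwards. *)
Lemma gronwall f g W r M eps : continuous f -> continuous g -> 0 <= M ->
  (forall x, 0 <= x <= 1 -> [/\ dv f x (g x), dv g x (W x * f x + r x),
     `|W x| <= M & `|r x| <= eps]) ->
  f 0 = 0 -> g 0 = 0 -> forall x, 0 <= x <= 1 ->
  f x ^+ 2 + g x ^+ 2 <= eps ^+ 2 * expR (M + 2).
Proof.
move=> cf cg M0 H f0 g0 x /andP[x0 x1].
pose N := M + 2.
pose F y := eps ^+ 2 * y - (f y ^+ 2 + g y ^+ 2) * expR (- (N * y)).
have cE : continuous (fun y => expR (- (N * y))).
  by apply: (@dv_continuous _ _ (fun y => - N * expR (- (N * y)))) => y; exact: dv_expNK.
have cF : continuous F by rewrite /F; cts.
pose F' y := eps ^+ 2 - ((2%:R * f y ^+ 1 * g y + 2%:R * g y ^+ 1 * (W y * f y + r y)) *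
   expR (- (N * y)) + (f y ^+ 2 + g y ^+ 2) * (- N * expR (- (N * y)))).
have : F 0 <= F x.
  apply: (@dv_ge0_le _ F F' 0 x x0); first exact/cont_within.
    move=> y /andP[y0 yx]; have [|d1 d2 _ _] := H y; first by lra.
    apply: (dv_eq (dvB (dvZ (eps ^+ 2) (dv_id y))
      (dvM (dvD (dvX 1 d1) (dvX 1 d2)) (dv_expNK N y)))).
    by rewrite /F' mulr1.
  move=> y /andP[y0 yx]; have [|_ _ Wy ry] := H y; first by lra.
  rewrite /F'; have e1 : expR (- (N * y)) <= 1.
    by rewrite -[leRHS]expR0 ler_expR oppr_le0 mulr_ge0// /N; lra.
  have e0 := expR_gt0 (- (N * y)).
  have r2 := sq_leM ry.
  move: Wy; rewrite ler_norml => /andP[W1 W2].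
  move: e1 e0 r2 W1 W2; rewrite /N !expr1; move: (expR _) (f y) (g y) (W y) (r y) => e a b w z.
  move=> e1 e0 z2 W1 W2.
  suff : 2 * a * b + 2 * b * (w * a + z) - (M + 2) * (a ^+ 2 + b ^+ 2) <= eps ^+ 2.
    have := sqr_ge0 eps; move: (eps ^+ 2) => E E0 S.
    set T := 2 * a * b + 2 * b * (w * a + z) - (M + 2) * (a ^+ 2 + b ^+ 2) in S.
    have -> : E - ((2 * a * b + 2 * b * (w * a + z)) * e +
      (a ^+ 2 + b ^+ 2) * (- (M + 2) * e)) = E - T * e by rewrite /T; ring.
    clear -S e1 e0 E0; nra.
  have : 2 * b * w * a <= M * (a ^+ 2 + b ^+ 2).
    have := mulr_ge0 (ltac:(lra) : 0 <= M + w) (sqr_ge0 (a - b)).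
    have := mulr_ge0 (ltac:(lra) : 0 <= M - w) (sqr_ge0 (a + b)).
    by rewrite !sqrrD; lra.
  have := sqr_ge0 (b - z); have := sqr_ge0 (a - b).
  clear -z2; nra.
rewrite /F f0 g0 !expr0n /= addr0 mul0r subr0 mulr0 subr_ge0 expRN => h.
have e0 := expR_gt0 (N * x); rewrite ler_pdivrMr// in h.
apply: (le_trans h); apply: ler_pM.
- by rewrite mulr_ge0// sqr_ge0.
- exact: ltW.
- by rewrite ler_piMr// sqr_ge0.
- by rewrite ler_expR /N -[leRHS]mulr1 ler_wpM2l//; lra.
Qed.

Lemma gronwall_backward f g W M : continuous f -> continuous g -> 0 <= M ->
  (forall x, 0 <= x <= 1 -> [/\ dv f x (g x), dv g x (W x * f x) & `|W x| <= M]) ->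
  f 0 = 1 -> forall x, 0 <= x <= 1 -> 0 < f x ^+ 2 + g x ^+ 2.
Proof.
move=> cf cg M0 H f0 x /andP[x0 x1].
pose N := M + 2.
pose F y := (f y ^+ 2 + g y ^+ 2) * expR (N * y).
have cE : continuous (fun y => expR (N * y)).
  by apply: (@dv_continuous _ _ (fun y => N * expR (N * y))) => y; exact: dv_expK.
have cF : continuous F by rewrite /F; cts.
pose F' y := (2%:R * f y ^+ 1 * g y + 2%:R * g y ^+ 1 * (W y * f y)) *
   expR (N * y) + (f y ^+ 2 + g y ^+ 2) * (N * expR (N * y)).
have : F 0 <= F x.
  apply: (@dv_ge0_le _ F F' 0 x x0); first exact/cont_within.
    move=> y /andP[y0 yx]; have [|d1 d2 _] := H y; first by lra.
    exact: (dvM (dvD (dvX 1 d1) (dvX 1 d2)) (dv_expK N y)).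
  move=> y /andP[y0 yx]; have [|_ _ Wy] := H y; first by lra.
  rewrite /F'; have e0 := expR_gt0 (N * y).
  move: Wy; rewrite ler_norml => /andP[W1 W2].
  move: e0 W1 W2; rewrite /N !expr1; move: (expR _) (f y) (g y) (W y) => e a b w.
  move=> e0 W1 W2.
  have -> : (2 * a * b + 2 * b * (w * a)) * e + (a ^+ 2 + b ^+ 2) * ((M + 2) * e) =
    (2 * a * b + 2 * b * (w * a) + (M + 2) * (a ^+ 2 + b ^+ 2)) * e by ring.
  apply: mulr_ge0; last exact: ltW.
  have := mulr_ge0 (ltac:(lra) : 0 <= M + w) (sqr_ge0 (a + b)).
  have := mulr_ge0 (ltac:(lra) : 0 <= M - w) (sqr_ge0 (a - b)).
  have := sqr_ge0 (a + b); have := sqr_ge0 a; have := sqr_ge0 b.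
  by rewrite !sqrrD; lra.
rewrite /F f0 expr1n mulr0 expR0 mulr1 => h.
have : 0 < F x by apply: lt_le_trans h; rewrite ltr_wpDr ?sqr_ge0.
by rewrite /F pmulr_lgt0// expR_gt0.
Qed.

End LinearEquation.

(** * Ground states *)

Section GroundState.
Context {R : realType}.
Implicit Types (f h k U V W phi dphi psi dpsi : R -> R).
Implicit Types (c s x y B E M eps del eta : R).

Definition even_sol W phi dphi := [/\ phi 0 = 1, dphi 0 = 0,
  (forall x, dv phi x (dphi x)), (forall x, dv dphi x (W x * phi x))
  & forall x, phi (- x) = phi x].

(** The lowest Dirichlet eigenvalue E of - d^2/dx^2 + U on (-1, 1), with its
positive eigenfunction; minimality is recorded as the variational inequality,
in which E can be compared for different potentials. *)
Definition ground U E phi dphi :=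
  [/\ even_sol (fun x => U x - E) phi dphi, phi 1 = 0,
      (forall x, -1 < x < 1 -> 0 < phi x)
    & forall h k, weak_derivative h k -> h (-1) = 0 -> h 1 = 0 ->
      E * itg (fun x => h x ^+ 2) <= itg (fun x => k x ^+ 2 + U x * h x ^+ 2)].

Lemma even_sol_cont W phi dphi : even_sol W phi dphi ->
  continuous phi /\ continuous dphi.
Proof.
by move=> [_ _ d1 d2 _]; split; [exact: dv_continuous d1|exact: dv_continuous d2].
Qed.

Lemma even_sol_close V W phi dphi psi dpsi M B eps : 0 <= M -> 0 <= eps ->
  even_sol V phi dphi -> even_sol W psi dpsi ->
  (forall x, 0 <= x <= 1 -> [/\ `|W x| <= M, `|W x - V x| <= eps & `|phi x| <= B]) ->
  forall x, 0 <= x <= 1 ->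
    (psi x - phi x) ^+ 2 + (dpsi x - dphi x) ^+ 2 <= (eps * B) ^+ 2 * expR (M + 2).
Proof.
move=> M0 e0 s1 s2 H.
have [c1 c1'] := even_sol_cont s1; have [c2 c2'] := even_sol_cont s2.
case: s1 s2 => [p0 p0' d1 d1' _] [u0 u0' d2 d2' _].
have cf : continuous (fun x => psi x - phi x) by cts.
have cg : continuous (fun x => dpsi x - dphi x) by cts.
apply: (@gronwall _ _ _ W (fun x => (W x - V x) * phi x) M (eps * B)) => //.
- move=> x x01; have [h1 h2 h3] := H x x01; split => //.
  + exact: dvB.
  + by apply: (dv_eq (dvB (d2' x) (d1' x))); ring.
  + by rewrite normrM; apply: ler_pM.
- by rewrite u0 p0 subrr.
- by rewrite u0' p0' subrr.
Qed.

Lemma itgb_quad h k U : weak_derivative h k -> continuous U ->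
  itgb (fun x => k x ^+ 2 + U x * h x ^+ 2).
Proof.
move=> w cU; have Lk : square_integrable k by case: w.
have chc := wd_clamp_continuous w; apply: itgbD; first exact: L2_sq.
have : continuous (fun x => U x * h (clamp x) ^+ 2) by cts.
by move=> /itgb_cont; apply: itgb_ext => x /clamp_id ->.
Qed.

(** A positive solution, not required to vanish at the end points, already
bounds the quadratic form from below. *)
Lemma rayleigh_of_positive U E phi dphi h k : continuous U ->
  even_sol (fun x => U x - E) phi dphi -> (forall x, 0 <= x <= 1 -> 0 < phi x) ->
  weak_derivative h k -> h (-1) = 0 -> h 1 = 0 ->
  E * itg (fun x => h x ^+ 2) <= itg (fun x => k x ^+ 2 + U x * h x ^+ 2).
Proof.
move=> cU es pos w hm hp; have [cp cd] := even_sol_cont es.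
case: es => [_ _ d1 d2 ev].
have posall x : -1 <= x <= 1 -> 0 < phi x.
  case: (leP 0 x) => x0 x11; first by apply: pos; lra.
  by rewrite -ev; apply: pos; lra.
have le11 : -1 <= (1 : R) by lra.
have [m m0 mP] := continuous_lbound le11 cp posall.
have [B B0 BP] := continuous_bounded le11 cp.
have cW : continuous (fun x => U x - E) by cts.
have mB x : -1 <= x <= 1 -> m <= phi x <= B.
  by move=> x11; rewrite mP//= (le_trans (ler_norm _))// BP.
have J := jacobi_lower_bound w hm hp cp cd cW (fun x _ => conj (d1 x) (d2 x)) m0 mB.
have : 0 <= itg (fun x => k x ^+ 2 + (U x - E) * h x ^+ 2).
  apply: le_trans J; apply: mulr_ge0.
    by apply: divr_ge0; [exact: sqr_ge0|apply: mulr_ge0 => //; exact: sqr_ge0].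
  by apply: itg_ge0 => x _; exact: sqr_ge0.
have I := itgb_quad w cU; have Ih := L2_sq (wdL2 w).
have -> : itg (fun x => k x ^+ 2 + (U x - E) * h x ^+ 2) =
  itg (fun x => (k x ^+ 2 + U x * h x ^+ 2) - E * h x ^+ 2).
  by apply: itg_ext => x _; ring.
by rewrite itgB//; [rewrite itgZ// subr_ge0|exact: itgbZ].
Qed.

Lemma pos_of_nonzero f : continuous f -> 0 < f 0 ->
  (forall x, 0 <= x <= 1 -> f x != 0) -> forall x, 0 <= x <= 1 -> 0 < f x.
Proof.
move=> cf f0 nz x /andP[x0 x1]; rewrite ltNge; apply/negP => fx.
have [||c] := @IVT _ f 0 x 0 x0; first exact/cont_within.
  by rewrite ge_min le_max fx (ltW f0) orbT.
rewrite in_itv /= => /andP[c0 cx] /eqP; apply/negP; apply: nz.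
by rewrite c0 (le_trans cx).
Qed.

(** Since (phi phi')' = phi'^2 + W phi^2 >= 0, phi^2 does not decrease. *)
Lemma even_sol_pos W phi dphi : continuous W -> even_sol W phi dphi ->
  (forall x, 0 <= x <= 1 -> 0 <= W x) -> forall x, 0 <= x <= 1 -> 0 < phi x.
Proof.
move=> cW es W0; have [cp cd] := even_sol_cont es; case: es => [p0 p0' d1 d2 _].
apply: pos_of_nonzero => //; first by rewrite p0.
have G x : 0 <= x <= 1 -> 0 <= phi x * dphi x.
  move=> /andP[x0 x1].
  have cG : continuous (fun y => phi y * dphi y) by cts.
  have -> : 0 = phi 0 * dphi 0 by rewrite p0' mulr0.
  apply: (@dv_ge0_le _ (fun y => phi y * dphi y)
    (fun y => dphi y * dphi y + phi y * (W y * phi y)) 0 x x0).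
  - exact/cont_within.
  - by move=> y _; exact: dvM.
  - move=> y y0; rewrite addr_ge0 ?sqr_ge0// mulrCA mulr_ge0 ?sqr_ge0//.
    by apply: W0; lra.
move=> x /andP[x0 x1]; have cS : continuous (fun y => phi y ^+ 2) by cts.
have : phi 0 ^+ 2 <= phi x ^+ 2.
  apply: (@dv_ge0_le _ (fun y => phi y ^+ 2)
    (fun y => 2%:R * phi y ^+ 1 * dphi y) 0 x x0).
  - exact/cont_within.
  - by move=> y _; exact: dvX.
  - by move=> y y0; rewrite expr1 -mulrA mulr_ge0// G//; lra.
rewrite p0 expr1n; case: eqVneq => // ->; by rewrite expr0n /=; lra.
Qed.

(** Shooting: E is the supremum of the values for which the even solution stays
positive on [0, 1]. At the supremum it vanishes somewhere, and it can do so
only at 1, since an interior zero would be a double one. *)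
Lemma ground_state U M : continuous U -> (forall x, `|U x| <= M) -> 0 < M ->
  (forall x, U (- x) = U x) -> exists E, exists phi, exists dphi, ground U E phi dphi.
Proof.
move=> cU UM M0 eU.
have ex E : exists pp : (R -> R) * (R -> R), even_sol (fun x => U x - E) pp.1 pp.2.
  have cW : continuous (fun x => U x - E) by cts.
  have [|||phi [dphi H]] := @linear_ode _ _ (M + `|E|) cW; last by exists (phi, dphi).
  - by move=> y; apply: (le_trans (ler_normB _ _)); rewrite lerD2r.
  - by rewrite ltr_wpDr.
  - by move=> y; rewrite eU.
pose ph E := (sval (cid (ex E))).1; pose dph E := (sval (cid (ex E))).2.
have es E : even_sol (fun x => U x - E) (ph E) (dph E).
  by rewrite /ph /dph; case: (cid _).
have cph E : continuous (ph E) by have [] := even_sol_cont (es E).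
have cdph E : continuous (dph E) by have [] := even_sol_cont (es E).
have le01 : 0 <= (1 : R) by [].
have close s eta : 0 < eta -> exists2 del : R, 0 < del & forall E, `|E - s| <= del ->
    forall x, 0 <= x <= 1 -> `|ph E x - ph s x| < eta.
  move=> e0; have [B B0 BP] := continuous_bounded le01 (cph s).
  pose C := expR ((M + `|s| + 1) + 2).
  have C1 : 1 <= C.
    by rewrite /C -[leLHS]expR0 ler_expR; have := normr_ge0 s; lra.
  pose del := Num.min 1 (eta / (B * C + 1)).
  have BC : 0 < B * C + 1 by rewrite ltr_wpDl// mulr_ge0//; lra.
  exists del; first by rewrite lt_min ltr01 divr_gt0.
  have del0 : 0 < del by rewrite lt_min ltr01 divr_gt0.
  have delB : del * (B * C + 1) <= eta.
    by rewrite -ler_pdivlMr// ge_min lexx orbT.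
  have del1 : del <= 1 by rewrite ge_min lexx.
  move=> E Es x x01.
  have M1 : 0 <= M + `|s| + 1 by have := normr_ge0 s; lra.
  have := even_sol_close M1 (ltW del0) (es s) (es E) _ x01.
  have {}H : forall y, 0 <= y <= 1 ->
    [/\ `|U y - E| <= M + `|s| + 1, `|U y - E - (U y - s)| <= del & `|ph s y| <= B].
    move=> y y01; split; last exact: BP.
      apply: (le_trans (ler_normB _ _)); rewrite -addrA lerD//.
      have -> : E = s + (E - s) by ring.
      by apply: (le_trans (ler_normD _ _)); rewrite lerD2l; exact: le_trans del1.
    have -> : U y - E - (U y - s) = - (E - s) by ring.
    by rewrite normrN.
  move=> /(_ _ H); rewrite -/C => h.
  have : (ph E x - ph s x) ^+ 2 <= (del * (B * C)) ^+ 2.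
    apply: le_trans (_ : (del * B) ^+ 2 * C <= _).
      by apply: le_trans h; rewrite lerDl sqr_ge0.
    rewrite mulrA [leRHS]exprMn; apply: ler_wpM2l; first exact: sqr_ge0.
    by rewrite expr2 ler_peMr//; lra.
  rewrite -real_normK ?num_real// ler_pXn2r ?nnegrE//; last first.
    by rewrite !mulr_ge0//; lra.
  by move=> /le_lt_trans; apply; apply: lt_le_trans delB; rewrite ltr_pM2l//; lra.
pose A := [set E | forall x, 0 <= x <= 1 -> 0 < ph E x].
have ray E : A E -> forall h k, weak_derivative h k -> h (-1) = 0 -> h 1 = 0 ->
    E * itg (fun x => h x ^+ 2) <= itg (fun x => k x ^+ 2 + U x * h x ^+ 2).
  by move=> AE h k; exact: rayleigh_of_positive cU (es E) AE.
have AM : A (- M).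
  have cW : continuous (fun x => U x - - M) by cts.
  apply: (even_sol_pos cW (es (- M))) => x _.
  by have := UM x; rewrite ler_norml; lra.
have supA : has_sup A.
  split; first by exists (- M).
  have [[k w] hm hp] := H10_bump (R := R).
  have N0 : 0 < itg (fun x : R => (1 - x ^+ 2) ^+ 2).
    by apply: (itg_sq_gt0 (x := 0) w); [lra|rewrite expr0n subr0 oner_neq0].
  exists (itg (fun x => k x ^+ 2 + U x * (1 - x ^+ 2) ^+ 2) / itg (fun x : R => (1 - x ^+ 2) ^+ 2)).
  by move=> E AE; rewrite ler_pdivlMr//; exact: ray AE _ _ w hm hp.
pose s := sup A.
have nonneg x : 0 <= x <= 1 -> 0 <= ph s x.
  move=> x01; rewrite leNgt; apply/negP => neg.
  have [|del del0 H] := close s (- ph s x); first by lra.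
  have [E AE Es] := sup_adherent del0 supA; rewrite -/s in Es.
  have sE : E <= s by exact: sup_upper_bound.
  have := H E _ x x01; have -> : `|E - s| <= del by rewrite ler_norml; lra.
  move=> /(_ isT); rewrite ltr_norml => /andP[_]; have := AE x x01; lra.
have notA : ~ A s.
  move=> As; have [m m0 mP] := continuous_lbound le01 (cph s) As.
  have [del del0 H] := close s m m0.
  have : A (s + del).
    move=> x x01; have := H (s + del) _ x x01.
    have -> : `|s + del - s| <= del by rewrite addrAC subrr add0r ger0_norm// ltW.
    by move=> /(_ isT); rewrite ltr_norml; have := mP x x01; lra.
  by move=> /(sup_upper_bound supA); rewrite -/s; lra.
have [p0 p0' d1 d2 ev] := es s.
have nz x : 0 <= x < 1 -> ph s x != 0.
  move=> /andP[x0 x1]; apply/eqP => px.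
  have x0' : 0 < x.
    rewrite lt_neqAle x0 andbT; apply/eqP => x00.
    by move: px; rewrite -x00 p0 => /eqP; rewrite oner_eq0.
  have dm : dv (ph s) x 0.
    apply: (@derive1_at_min _ (ph s) 0 1 x) => //.
    - by move=> t _; have [] := d1 t.
    - by rewrite in_itv /= x0'.
    - by move=> t; rewrite in_itv /= => /andP[t0 t1]; rewrite px nonneg// !ltW.
  have dx : dph s x = 0.
    have := d1 x; rewrite /dv in dm *; move=> [_ <-]; by case: dm.
  have M1 : 0 <= M + `|s| by have := normr_ge0 s; lra.
  have := gronwall_backward (cph s) (cdph s) M1 _ p0 (x := x).
  move=> /(_ (fun x => U x - s)); rewrite px dx expr0n addr0 ltxx => /(_ _ _) H.
  have x01 : 0 <= x <= 1 by rewrite x0 ltW.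
  suff : false by []; apply: H x01 => y y01; split => //.
  by apply: (le_trans (ler_normB _ _)); rewrite lerD2r.
have pos x : 0 <= x < 1 -> 0 < ph s x.
  by move=> x01; rewrite lt_neqAle eq_sym nz// nonneg//; lra.
exists s, (ph s), (dph s); split => //.
- apply/eqP; rewrite -[_ == _]negbK; apply/negP => p1; apply: notA => x /andP[x0 x1].
  have [xl|xl|->] := ltgtP x 1; [by apply: pos; rewrite x0|lra|].
  by rewrite lt_neqAle eq_sym p1 nonneg// lexx ler01.
- move=> x x11; case: (leP 0 x) => x0; first by apply: pos; lra.
  by rewrite -ev; apply: pos; lra.
- move=> h k w hm hp; rewrite leNgt; apply/negP => lt.
  have N0 : 0 <= itg (fun x => h x ^+ 2) by apply: itg_ge0 => x _; exact: sqr_ge0.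
  move: N0; rewrite le_eqVlt => /orP[/eqP N0|N0].
    by have := ray _ AM h k w hm hp; move: lt; rewrite -N0 !mulr0 ltNge => /negbTE ->.
  move: lt; rewrite -ltr_pdivrMr// => lt.
  have [E AE] := sup_adherent (ltac:(rewrite subr_gt0; exact: lt) :
     0 < s - itg (fun x => k x ^+ 2 + U x * h x ^+ 2) / itg (fun x => h x ^+ 2)) supA.
  rewrite -/s subKr ltr_pdivrMr// ltNge => /negP; apply; exact: ray AE h k w hm hp.
Qed.

Lemma ground_wd U E phi dphi : ground U E phi dphi -> weak_derivative phi dphi.
Proof.
move=> [es _ _ _]; have [cp cd] := even_sol_cont es; case: es => [_ _ d1 _ _].
by apply: wd_dv => // x _.
Qed.

Lemma ground_bc U E phi dphi : ground U E phi dphi -> phi (-1) = 0 /\ phi 1 = 0.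
Proof. by move=> [[_ _ _ _ ev] p1 _ _]; rewrite ev p1. Qed.

Lemma ground_norm_gt0 U E phi dphi : ground U E phi dphi ->
  0 < itg (fun x => phi x ^+ 2).
Proof.
move=> g; apply: (itg_sq_gt0 (x := 0) (ground_wd g)); first by lra.
by case: g => [[-> _ _ _ _] _ _ _]; exact: oner_neq0.
Qed.

Lemma ground_attained U E phi dphi : continuous U -> ground U E phi dphi ->
  itg (fun x => dphi x ^+ 2 + U x * phi x ^+ 2) = E * itg (fun x => phi x ^+ 2).
Proof.
move=> cU g; have w := ground_wd g; have [pm pp] := ground_bc g.
case: g => [es _ _ _]; have [cp cd] := even_sol_cont es; case: es => [_ _ d1 d2 _].
have I := itgb_quad w cU; have Ip := L2_sq (wdL2 w).
apply/eqP; rewrite -subr_eq0 -itgZ// -itgB//; last exact: itgbZ.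
have cG : continuous (fun y => dphi y * phi y) by cts.
have cG' : continuous (fun y => (U y - E) * phi y * phi y + dphi y * dphi y) by cts.
have wd := wd_dv cG' cG (fun x _ => dvM (d2 x) (d1 x)).
have := itg_deriv wd; rewrite pm pp !mulr0 subrr => D; apply/eqP; rewrite -[RHS]D.
by apply: itg_ext => x _; ring.
Qed.

End GroundState.

(** * Perturbation of the lowest eigenvalue *)

Section Perturbation.
Context {R : realType}.
Implicit Types (f g h k U V p d : R -> R).
Implicit Types (c s t x y l a B C E I K M N X : R).

Lemma itg_norm_le f c : continuous f -> (forall x, -1 <= x <= 1 -> `|f x| <= c) ->
  `|itg f| <= 2 * c.
Proof.
move=> cf H; have I := itgb_cont cf.
rewrite ler_norml mulrC -mulNr -!itg_cst; apply/andP; split.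
  apply: itg_le => //; first exact: itgb_cst.
  by move=> x /H; rewrite ler_norml => /andP[].
apply: itg_le => //; first exact: itgb_cst.
by move=> x /H; rewrite ler_norml => /andP[].
Qed.

Lemma itg_weight_le f g c : continuous f -> continuous g ->
  (forall x, -1 <= x <= 1 -> f x <= c) ->
  itg (fun x => f x * g x ^+ 2) <= c * itg (fun x => g x ^+ 2).
Proof.
move=> cf cg H; have I : continuous (fun x => g x ^+ 2) by cts.
rewrite -itgZ; last exact: itgb_cont.
apply: itg_le; [by apply: itgb_cont; cts|by apply: itgb_cont; cts|].
by move=> x /H; apply: ler_wpM2r; exact: sqr_ge0.
Qed.

(** The ground state of U is a test function for V. *)
Lemma ground_le U V E0 E1 p0 d0 p1 d1 : continuous U -> continuous V ->
  ground U E0 p0 d0 -> ground V E1 p1 d1 ->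
  (E1 - E0) * itg (fun x => p0 x ^+ 2) <= itg (fun x => (V x - U x) * p0 x ^+ 2).
Proof.
move=> cU cV g [_ _ _ V1]; have w := ground_wd g; have [gm gp] := ground_bc g.
have h := V1 _ _ w gm gp; have A := ground_attained cU g.
have -> : itg (fun x => (V x - U x) * p0 x ^+ 2) =
   itg (fun x => (d0 x ^+ 2 + V x * p0 x ^+ 2) - (d0 x ^+ 2 + U x * p0 x ^+ 2)).
  by apply: itg_ext => x _; ring.
rewrite itgB; [|exact: itgb_quad w cV|exact: itgb_quad w cU].
by rewrite A mulrBl lerD2r.
Qed.

Lemma ground_cont U E p d : ground U E p d -> continuous p.
Proof. by move=> [/even_sol_cont[]]. Qed.

Lemma ground_lip U V E0 E1 p0 d0 p1 d1 c : continuous U -> continuous V ->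
  ground U E0 p0 d0 -> ground V E1 p1 d1 ->
  (forall x, -1 <= x <= 1 -> `|V x - U x| <= c) -> `|E1 - E0| <= c.
Proof.
move=> cU cV g0 g1 H; have N0 := ground_norm_gt0 g0; have N1 := ground_norm_gt0 g1.
have cp0 := ground_cont g0; have cp1 := ground_cont g1.
have c1 : continuous (fun x => V x - U x) by cts.
have c2 : continuous (fun x => U x - V x) by cts.
have H1 x : -1 <= x <= 1 -> V x - U x <= c.
  by move=> /H; apply: le_trans; exact: ler_norm.
have H2 x : -1 <= x <= 1 -> U x - V x <= c.
  by move=> /H; apply: le_trans; rewrite distrC; exact: ler_norm.
have h1 := le_trans (ground_le cU cV g0 g1) (itg_weight_le c1 cp0 H1).
have h2 := le_trans (ground_le cV cU g1 g0) (itg_weight_le c2 cp1 H2).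
by move: h1 h2; rewrite !ler_pM2r// ler_norml; lra.
Qed.

(** The eigenvalue is Lipschitz in U, so the difference of the two ground states
solves a linear equation with a right-hand side of order K t. *)
Lemma ground_sq_close U E0 p0 d0 K : continuous U -> ground U E0 p0 d0 -> 0 <= K ->
  exists2 C : R, 0 <= C &
  forall V E1 p1 d1 t, continuous V -> ground V E1 p1 d1 -> 0 <= t <= 1 ->
  (forall x, -1 <= x <= 1 -> `|V x - U x| <= K * t) ->
  forall x, -1 <= x <= 1 -> `|p1 x ^+ 2 - p0 x ^+ 2| <= C * t.
Proof.
move=> cU g0 K0; have cp := ground_cont g0.
have le11 : -1 <= (1 : R) by lra.
have [B B0 BP] := continuous_bounded le11 cp.
have cUE : continuous (fun x => U x - E0) by cts.
have [M1 M10 M1P] := continuous_bounded le11 cUE.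
have [M ME] : exists M, M = M1 + 2 * K by eexists.
have M0 : 0 <= M by lra.
have [e ee] : exists e, e = expR (M + 2) by eexists.
have e1 : 1 <= e by rewrite ee -[leLHS]expR0 ler_expR; lra.
have [C CE] : exists C, C = 2 * K * B * e by eexists.
have C0 : 0 <= C by rewrite CE !mulr_ge0//; lra.
exists (C * (2 * B + C)); first by rewrite mulr_ge0// addr_ge0// mulr_ge0.
move=> V E1 p1 d1 t cV g1 /andP[t0 t1] H.
have HE := ground_lip cU cV g0 g1 H.
have [es _ _ _] := g0; have [es' _ _ _] := g1.
have K2 : 0 <= 2 * K * t by rewrite !mulr_ge0.
have HW x : 0 <= x <= 1 -> [/\ `|V x - E1| <= M,
    `|V x - E1 - (U x - E0)| <= 2 * K * t & `|p0 x| <= B].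
  move=> x01; have x11 : -1 <= x <= 1 by lra.
  have W2 : `|V x - E1 - (U x - E0)| <= 2 * K * t.
    have -> : V x - E1 - (U x - E0) = (V x - U x) - (E1 - E0) by ring.
    by apply: (le_trans (ler_normB _ _)); have := H x x11; lra.
  split=> //; last exact: BP.
  have -> : V x - E1 = (U x - E0) + (V x - E1 - (U x - E0)) by ring.
  rewrite ME; apply: (le_trans (ler_normD _ _)); apply: lerD; first exact: M1P.
  by apply: (le_trans W2); rewrite ler_piMr// mulr_ge0.
have pos x : 0 <= x <= 1 -> `|p1 x ^+ 2 - p0 x ^+ 2| <= C * (2 * B + C) * t.
  move=> x01; have := even_sol_close M0 K2 es es' HW x01; rewrite -ee => h.
  have {}h : `|p1 x - p0 x| <= C * t.
    have : (p1 x - p0 x) ^+ 2 <= (C * t) ^+ 2.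
      apply: le_trans (_ : (2 * K * t * B) ^+ 2 * e <= _).
        by apply: le_trans h; rewrite lerDl sqr_ge0.
      have -> : C * t = 2 * K * t * B * e by rewrite CE; ring.
      rewrite [leRHS]exprMn; apply: ler_wpM2l; first exact: sqr_ge0.
      by rewrite expr2 ler_peMr//; lra.
    by rewrite -real_normK ?num_real// ler_pXn2r ?nnegrE// mulr_ge0.
  have [_ _ gB] := HW x x01.
  have -> : p1 x ^+ 2 - p0 x ^+ 2 = (p1 x - p0 x) * ((p1 x - p0 x) + 2 * p0 x) by ring.
  rewrite normrM mulrAC; apply: ler_pM => //.
  apply: (le_trans (ler_normD _ _)); rewrite addrC normrM ger0_norm//.
  apply: lerD; first by rewrite ler_wpM2l.
  by apply: (le_trans h); rewrite ler_piMr.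
have [_ _ _ _ ev] := es; have [_ _ _ _ ev'] := es'.
move=> x x11; case: (leP 0 x) => x0; first by apply: pos; lra.
by rewrite -ev -ev'; apply: pos; lra.
Qed.

Lemma increment_arith X K C N N' t I1 I2 : 0 <= K -> 0 <= C -> 0 < N -> N / 2 <= N' ->
  I1 + I2 <= X * N' -> - (4 * K * C * t ^+ 2) <= I1 -> - (K * t ^+ 2 * N) <= I2 ->
  - ((K + 2 * (K * N + 4 * K * C) / N) * t ^+ 2) <= X.
Proof.
move=> K0 C0 N0 NN XE h1 h2; have t2 := sqr_ge0 t.
have KC : 0 <= K * C by rewrite mulr_ge0.
have KN : 0 <= K * N by rewrite mulr_ge0// ltW.
have [Y YE] : exists Y, Y = (K * N + 4 * K * C) * t ^+ 2 by eexists.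
have Y0 : 0 <= Y by rewrite YE mulr_ge0//; lra.
have E1 : - Y <= X * N' by apply: le_trans XE; rewrite YE; lra.
have -> : - ((K + 2 * (K * N + 4 * K * C) / N) * t ^+ 2) = - (K * t ^+ 2) - Y * 2 / N.
  by rewrite YE; field; rewrite gt_eqF.
have Kt : 0 <= K * t ^+ 2 by rewrite mulr_ge0.
have YN : 0 <= Y * 2 / N by rewrite divr_ge0 ?(ltW N0)// mulr_ge0.
case: (leP 0 X) => X0; first by lra.
suff : - (Y * 2 / N) <= X by lra.
have : X * N' <= X * (N / 2) by rewrite ler_nM2l.
rewrite -mulNr ler_pdivrMr//; lra.
Qed.

(** Hellmann-Feynman: the increment of the lowest eigenvalue is squeezed between
the Rayleigh quotients of the two ground states. *)
Lemma ground_increment U V f E0 E1 p0 d0 p1 d1 a K C t :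
  continuous U -> continuous V -> continuous f ->
  ground U E0 p0 d0 -> ground V E1 p1 d1 -> 0 <= K -> 0 <= C ->
  itg (fun x => f x * p0 x ^+ 2) = a * itg (fun x => p0 x ^+ 2) -> `|a| <= K ->
  (forall x, -1 <= x <= 1 -> `|V x - U x - t * f x| <= K * t ^+ 2) ->
  (forall x, -1 <= x <= 1 -> `|V x - U x| <= K * `|t|) ->
  (forall x, -1 <= x <= 1 -> `|p1 x ^+ 2 - p0 x ^+ 2| <= C * `|t|) ->
  4 * C * `|t| <= itg (fun x => p0 x ^+ 2) ->
  `|E1 - E0 - t * a| <= (K + 2 * (K * itg (fun x => p0 x ^+ 2) + 4 * K * C)
                           / itg (fun x => p0 x ^+ 2)) * t ^+ 2.
Proof.
move=> cU cV cf g0 g1 K0 C0 aN aK H1 H2 H3.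
have N0 := ground_norm_gt0 g0; have N1 := ground_norm_gt0 g1.
have cp0 := ground_cont g0; have cp1 := ground_cont g1.
have Ip : itgb (fun x => p0 x ^+ 2) by apply: itgb_cont; cts.
have Ip' : itgb (fun x => p1 x ^+ 2) by apply: itgb_cont; cts.
have If : itgb (fun x => f x * p0 x ^+ 2) by apply: itgb_cont; cts.
have L1 := ground_le cU cV g0 g1; have L2 := ground_le cV cU g1 g0.
have NN : `|itg (fun x => p1 x ^+ 2) - itg (fun x => p0 x ^+ 2)| <= 2 * (C * `|t|).
  by rewrite -itgB//; apply: itg_norm_le; [by cts|exact: H3].
have Ia : itgb (fun x => (V x - U x - t * a) * p0 x ^+ 2) by apply: itgb_cont; cts.
have c1 : continuous (fun x => V x - U x - t * f x) by cts.
have c2 : continuous (fun x => (V x - U x - t * a) * (p1 x ^+ 2 - p0 x ^+ 2)) by cts.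
have c3 : continuous (fun x => - (V x - U x - t * f x)) by cts.
have up : itg (fun x => (V x - U x) * p0 x ^+ 2) - t * (a * itg (fun x => p0 x ^+ 2)) <=
    K * t ^+ 2 * itg (fun x => p0 x ^+ 2).
  have H x : -1 <= x <= 1 -> V x - U x - t * f x <= K * t ^+ 2.
    by move=> /H1; apply: le_trans; exact: ler_norm.
  apply: le_trans (itg_weight_le c1 cp0 H).
  rewrite -aN -itgZ// -itgB; [|by apply: itgb_cont; cts|exact: itgbZ].
  by rewrite le_eqVlt; apply/orP; left; apply/eqP; apply: itg_ext => x _; ring.
have low : - (K * t ^+ 2 * itg (fun x => p0 x ^+ 2)) <=
    itg (fun x => (V x - U x - t * a) * p0 x ^+ 2).
  have H x : -1 <= x <= 1 -> - (V x - U x - t * f x) <= K * t ^+ 2.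
    by move=> /H1; apply: le_trans; rewrite -normrN; exact: ler_norm.
  rewrite lerNl; apply: le_trans (itg_weight_le c3 cp0 H).
  have -> : itg (fun x => - (V x - U x - t * f x) * p0 x ^+ 2) =
    itg (fun x => t * (f x * p0 x ^+ 2) -
        ((V x - U x - t * a) * p0 x ^+ 2 + t * a * p0 x ^+ 2)).
    by apply: itg_ext => x _; ring.
  rewrite itgB; [|exact: itgbZ|by apply: itgbD => //; exact: itgbZ].
  rewrite itgD//; last exact: itgbZ.
  rewrite itgZ// itgZ// aN; move: (itg _) (itg _) => z z'; lra.
have mid : - (4 * K * C * t ^+ 2) <=
    itg (fun x => (V x - U x - t * a) * (p1 x ^+ 2 - p0 x ^+ 2)).
  have : `|itg (fun x => (V x - U x - t * a) * (p1 x ^+ 2 - p0 x ^+ 2))| <=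
      2 * (2 * K * `|t| * (C * `|t|)).
    apply: itg_norm_le => // x x11; rewrite normrM; apply: ler_pM => //; last exact: H3.
    apply: (le_trans (ler_normB _ _)); rewrite normrM.
    have := H2 x x11; have : `|t| * `|a| <= `|t| * K by rewrite ler_wpM2l.
    by move: (`|t| * `|a|) `|_ - _| => z z'; lra.
  have <- : `|t| * `|t| = t ^+ 2 by rewrite -normrM -expr2 ger0_norm// sqr_ge0.
  by rewrite ler_norml => /andP[]; lra.
have E4 : itg (fun x => (U x - V x) * p1 x ^+ 2) =
  - itg (fun x => (V x - U x - t * a) * (p1 x ^+ 2 - p0 x ^+ 2))
  - itg (fun x => (V x - U x - t * a) * p0 x ^+ 2) - t * a * itg (fun x => p1 x ^+ 2).
  have I1 := itgb_cont c2; have I3 := itgbZ (t * a) Ip'.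
  rewrite -itgZ// -opprD -itgD// -opprD -itgD//; last exact: itgbD.
  rewrite -mulN1r -itgZ; last by apply: itgbD => //; exact: itgbD.
  by apply: itg_ext => x _; ring.
rewrite {}E4 in L2.
move: N0 N1 NN up low mid L1 L2 {aN Ip Ip' If Ia c1 c2 c3 H1 H2 H3}.
move: (itg _) (itg _) (itg _) (itg _) (itg _) => I1 I2 I N' N.
move=> N0 N1; rewrite ler_norml => /andP[NN _] up low mid L1 L2 CN.
have N2 : N / 2 <= N' by lra.
have XE : I1 + I2 <= (E1 - E0 - t * a) * N' by lra.
rewrite ler_norml (increment_arith K0 C0 N0 N2 XE mid low) /=.
apply: (@le_trans _ _ (K * t ^+ 2)); first by rewrite -(ler_pM2r N0); lra.
apply: ler_wpM2r; first exact: sqr_ge0.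
by rewrite lerDl divr_ge0 ?(ltW N0)// mulr_ge0// addr_ge0 ?mulr_ge0// ltW.
Qed.

End Perturbation.

Section LowestEigenvalue.
Context {R : realType}.
Implicit Types (f g h k phi dphi psi dpsi : R -> R) (Q : triple R).
Implicit Types (c s t x y l B E K M eps del eta : R).

(** The potential of the transversal second variation, multiplied by l^2 / 2. *)
Definition well_pot l x : R := - (l ^+ 2 * well (sol l x)).

Lemma continuous_well_pot l : 0 < l -> continuous (well_pot l).
Proof.
move=> l0; have cq := continuous_sol l0.
have cw : continuous (fun x => well (sol l x)).
  by apply: (continuous_comp' (@continuous_well R) cq).
by rewrite /well_pot; cts.
Qed.

Lemma well_pot_bound l x : `|well_pot l x| <= 4 * l ^+ 2.
Proof.
rewrite normrN normrM ger0_norm ?sqr_ge0// mulrC; apply: ler_wpM2r; first exact: sqr_ge0.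
by rewrite ger0_norm ?well_ge0 ?well_le4.
Qed.

Lemma well_potE l x : 0 < l -> -1 <= x <= 1 ->
  well_pot l x = l ^+ 2 * (sol l x ^+ 2 - 4).
Proof.
move=> l0 x11; rewrite /well_pot wellE; first by ring.
by apply: sol_le2 => //; rewrite ler_norml.
Qed.

Lemma well_potN l x : 0 < l -> well_pot l (- x) = well_pot l x.
Proof. by move=> l0; rewrite /well_pot solN// wellN. Qed.

Definition ground_triple l : R * (R -> R) * (R -> R) :=
  xget (0, fun=> 0, fun=> 0)
    [set t | ground (well_pot l) t.1.1 t.1.2 t.2].
Definition elow l : R := (ground_triple l).1.1.
Definition gst l : R -> R := (ground_triple l).1.2.
Definition dgst l : R -> R := (ground_triple l).2.

Lemma gstP l : 0 < l -> ground (well_pot l) (elow l) (gst l) (dgst l).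
Proof.
move=> l0; have p4 : 0 < 4 * l ^+ 2 by rewrite mulr_gt0// exprn_gt0.
have [E [phi [dphi H]]] := ground_state (continuous_well_pot l0)
  (well_pot_bound l) p4 (fun x => well_potN x l0).
rewrite /elow /gst /dgst /ground_triple; case: xgetP => [t _ //|].
by move=> /(_ (E, phi, dphi)).
Qed.

Lemma continuous_gst l : 0 < l -> continuous (gst l) /\ continuous (dgst l).
Proof. by move=> /gstP[/even_sol_cont]. Qed.

(** The eigenfunction is admissible in the Rayleigh quotient and attains it. *)
Lemma mu_elow l Q : 0 < l -> same_on Q (chi l) ->
  mu (-8) l Q = 2 / l ^+ 2 * elow l.
Proof.
move=> l0 QE; have g := gstP l0; have cU := continuous_well_pot l0.
have l2 : 0 < 2 / l ^+ 2 by rewrite divr_gt0// exprn_gt0.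
have PsiE h k : weak_derivative h k ->
  Psi (-8) l Q h = 2 / l ^+ 2 * itg (fun x => wder h x ^+ 2 + well_pot l x * h x ^+ 2).
  move=> w; have ww := wder_wd w; rewrite -itgZ; last exact: itgb_quad ww cU.
  apply: itg_ext => x x11; have [-> -> _] := QE x x11.
  have -> : q1 (chi l) x = 2 / 3 by [].
  have -> : q2 (chi l) x = sol l x by [].
  by rewrite well_potE//; field; rewrite gt_eqF.
rewrite /mu; set S := (X in inf X); have Sg : S (2 / l ^+ 2 * elow l).
  exists (gst l); have w := ground_wd g; have [gm gp] := ground_bc g.
  have N0 := ground_norm_gt0 g; split.
  - by split=> //; exists (dgst l).
  - by exists 0; [lra|case: g => [[-> _ _ _ _] _ _ _]; exact: oner_neq0].
  rewrite (PsiE _ _ w).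
  have := @itgb_quad _ _ _ _ (wder_wd w) cU; have := itgb_quad w cU.
  move=> i1 i2.
  pose F x y := y ^+ 2 + well_pot l x * gst l x ^+ 2.
  rewrite (@itg_wder1 _ F _ _ w i2 i1) /F (ground_attained cU g).
  by rewrite mulrA mulfK// gt_eqF.
have lbS : lbound S (2 / l ^+ 2 * elow l).
  move=> _ [h [[[k w] hm hp] [x x11 hx] ->]]; have ww := wder_wd w.
  rewrite ler_pdivlMr; last exact: itg_sq_gt0 w x11 hx.
  rewrite (PsiE _ _ w) -[leLHS]mulrA (ler_pM2l l2).
  by case: g => _ _ _; apply.
apply/eqP; rewrite eq_le; apply/andP; split.
  by apply: ge_inf => //; exists (2 / l ^+ 2 * elow l).
by apply: lb_le_inf => //; eexists; exact: Sg.
Qed.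

Definition dpar_well_pot l x : R :=
  2 * l * (sol l x ^+ 2 - 4) + l ^+ 2 * (2 * sol l x * dsol l x).

Lemma continuous_dpar_well_pot l : 0 < l -> continuous (dpar_well_pot l).
Proof.
move=> l0; have cq := continuous_sol l0.
have cd : continuous (dsol l) by exact: (smooth_var_cont (sm_dsol (R := R))).
by rewrite /dpar_well_pot; cts.
Qed.

Lemma qdiff_well_pot l : 0 < l -> qdiff (absle 1) well_pot (dpar_well_pot l) l.
Proof.
move=> l0; apply: (@qdiff_near _ _ (fun l x => l ^+ 2 * (sol l x ^+ 2 - 4))).
  exists l => // l' x l'l x1; rewrite well_potE//.
    by move: l'l; rewrite ltr_norml; lra.
  by rewrite -absle1.
have C4 : qdiff (absle 1) (fun _ _ => 4 : R) (fun=> 0) l.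
  by apply: (@qdiff_cst _ _ (fun=> 4)); exists 4 => x _; rewrite ger0_norm.
have := qdiffM (qdiffX 1 (qdiff_id (absle 1) l)) (qdiffB (qdiffX 1 (qdiff_sol l0)) C4).
apply: qdiff_ext => // x _; rewrite /dpar_well_pot !expr1 subr0.
by rewrite /=; ring.
Qed.

Definition delow l : R :=
  itg (fun x => dpar_well_pot l x * gst l x ^+ 2) / itg (fun x => gst l x ^+ 2).

Lemma dv_elow l : 0 < l -> dv elow l (delow l).
Proof.
move=> l0; have /qdiffP [K K0 [d /andP[d0 d1] H]] := qdiff_well_pot l0.
have g := gstP l0; have N0 := ground_norm_gt0 g; have cp := ground_cont g.
have cU := continuous_well_pot l0; have cf := continuous_dpar_well_pot l0.
have [C C0 HC] := ground_sq_close cU g K0.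
have aN : itg (fun x => dpar_well_pot l x * gst l x ^+ 2) =
    delow l * itg (fun x => gst l x ^+ 2).
  by rewrite /delow divfK// gt_eqF.
have fK x : -1 <= x <= 1 -> `|dpar_well_pot l x| <= K.
  by rewrite -absle1 => x1; have [|_ ? _ _] := H l x _ x1; rewrite ?subrr ?normr0.
have aK : `|delow l| <= K.
  have cN : continuous (fun x => - dpar_well_pot l x) by cts.
  have h1 : delow l * itg (fun x => gst l x ^+ 2) <= K * itg (fun x => gst l x ^+ 2).
    rewrite -aN; apply: itg_weight_le => // x /fK.
    by apply: le_trans; exact: ler_norm.
  have h2 : - delow l * itg (fun x => gst l x ^+ 2) <= K * itg (fun x => gst l x ^+ 2).
    rewrite mulNr -aN -mulN1r -[leLHS]itgZ; last by apply: itgb_cont; cts.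
    have -> : itg (fun x => -1 * (dpar_well_pot l x * gst l x ^+ 2)) =
      itg (fun x => - dpar_well_pot l x * gst l x ^+ 2) by apply: itg_ext => x _; ring.
    apply: itg_weight_le => // x /fK.
    by apply: le_trans; rewrite -normrN ler_norm.
  by move: h1 h2; rewrite !ler_pM2r// ler_norml; lra.
have C4 : 0 < 4 * C + 1 by lra.
have [N NE] : exists N, N = itg (fun x => gst l x ^+ 2) by eexists.
rewrite -NE in N0 aN.
have del0 : 0 < Num.min (Num.min d l) (N / (4 * C + 1)).
  by rewrite !lt_min d0 l0 divr_gt0.
apply: (@dv_quad _ _ _ _ (K + 2 * (K * N + 4 * K * C) / N) _ del0) => t.
rewrite !lt_min => /andP[/andP[td tl] tN].
have l'0 : 0 < l + t by move: tl; rewrite ltr_norml; lra.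
have l'l : l + t - l = t by ring.
rewrite NE; apply: (ground_increment (V := well_pot (l + t)) (f := dpar_well_pot l)
  cU _ cf g (gstP l'0) K0 C0 _ aK).
- exact: continuous_well_pot.
- by rewrite aN NE.
- by move=> x; rewrite -absle1 => x1; have [|_ _ + _] := H (l + t) x _ x1; rewrite l'l.
- by move=> x; rewrite -absle1 => x1; have [|_ _ _ +] := H (l + t) x _ x1; rewrite l'l.
- apply: (HC _ _ _ _ _ _ (gstP l'0)); first exact: continuous_well_pot.
    by rewrite normr_ge0/=; lra.
  by move=> x; rewrite -absle1 => x1; have [|_ _ _ +] := H (l + t) x _ x1; rewrite l'l.
- rewrite -NE; move: tN; rewrite ltr_pdivlMr//.
  by have := normr_ge0 t; move: `|t| => z; lra.
Qed.

End LowestEigenvalue.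

(** * Monotonicity and sign of the lowest eigenvalue *)

Section Monotonicity.
Context {R : realType}.
Implicit Types (f g h k phi dphi psi dpsi m : R -> R) (Q : triple R).
Implicit Types (c s t x y l B E K M eps del eta : R).

Lemma sol_Ik_ge0 l x : 0 < l -> 0 <= sol l x * Ik 1 l x.
Proof.
move=> l0; have c0 := Cof_gt0 l0; rewrite /Ik.
have := Gk_le 1 0 (sol l x) c0; have := Gk_le 1 (sol l x) 0 c0; rewrite Gk0//.
case: (leP 0 (sol l x)) => h e1 e2; first by rewrite mulr_ge0// e2.
by rewrite nmulr_rge0// e1 ltW.
Qed.

(** Pohozaev's identity: with E the eigenvalue, the function
F = x phi'^2 - x (U - E) phi^2 - phi phi' has derivative
- (2 (U - E) + x U') phi^2. *)
Lemma pohozaev l : 0 < l ->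
  itg (fun x => (2 * (well_pot l x - elow l) - 2 * l ^+ 3 * x * sol l x * slope l x)
                * gst l x ^+ 2) = - (dgst l 1 ^+ 2 + dgst l (-1) ^+ 2).
Proof.
move=> l0; have g := gstP l0; have [pm pp] := ground_bc g.
have [cp cd] := continuous_gst l0; have cq := continuous_sol l0.
have cs := continuous_slope l0; have cU := continuous_well_pot l0.
case: g => [[_ _ d1 d2 _] _ _ _].
pose U x := l ^+ 2 * (sol l x ^+ 2 - 4).
pose dU x := l ^+ 2 * (2%:R * sol l x ^+ 1 * (- l * slope l x) - 0).
have dUP x : dv U x (dU x) by apply: dvZ; apply: dvB (dv_cst 4 x); exact: dvX (dv_sol x l0).
have cU' : continuous U by rewrite /U; cts.
have cdU : continuous dU by rewrite /dU; cts.
pose F x := x * dgst l x ^+ 2 - x * (U x - elow l) * gst l x ^+ 2 - gst l x * dgst l x.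
pose G x := - ((2 * (well_pot l x - elow l) - 2 * l ^+ 3 * x * sol l x * slope l x)
                * gst l x ^+ 2).
have cF : continuous F by rewrite /F; cts.
have cG : continuous G by rewrite /G; cts.
have FG x : -1 < x < 1 -> dv F x (G x).
  move=> x11; have UE : well_pot l x = U x by rewrite well_potE//; lra.
  have DU := dvB (dUP x) (dv_cst (elow l) x).
  apply: (dv_eq (dvB (dvB (dvM (dv_id x) (dvX 1 (d2 x)))
    (dvM (dvM (dv_id x) DU) (dvX 1 (d1 x)))) (dvM (d1 x) (d2 x)))).
  rewrite /G UE /dU; move: (U x) (gst l x) (dgst l x) (sol l x) (slope l x) => u a b q w.
  by rewrite !expr1; ring.
have := itg_deriv (wd_dv cG cF FG).
rewrite /F pm pp !mul0r !expr0n /= !mulr0 !subr0 mul1r mulN1r opprK => E.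
rewrite -E -[RHS]mulN1r -(itgZ _ (itgb_cont cG)) /G.
by apply: itg_ext => x _; ring.
Qed.

(** The eigenfunction cannot have a double zero. *)
Lemma dgst1_neq0 l : 0 < l -> 0 < dgst l 1 ^+ 2.
Proof.
move=> l0; have [cp cd] := continuous_gst l0.
have [[p0 _ d1 d2 _] p1 _ _] := gstP l0; have cU := continuous_well_pot l0.
have le01 : 0 <= (1 : R) by [].
have cW : continuous (fun x => well_pot l x - elow l) by cts.
have [M M0 MP] := continuous_bounded le01 cW.
have := gronwall_backward cp cd M0
  (fun x x01 => And3 (d1 x) (d2 x) (MP x x01)) p0 (x := 1).
by rewrite p1 expr0n add0r; apply; rewrite le01 lexx.
Qed.

(** The parameter derivative of U = l^2 (q^2 - 4) consists of (2 U + x U') / l,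
which comes from rescaling the variable and yields the Pohozaev term, and of a
multiple of dCof l < 0, which comes from the change of the integration
constant. Both lower elow l / l^2. *)
Lemma delow_lt l : 0 < l -> l * delow l < 2 * elow l.
Proof.
move=> l0; have g := gstP l0; have N0 := ground_norm_gt0 g.
have [cp cd] := continuous_gst l0; have cq := continuous_sol l0.
have cs := continuous_slope l0; have cU := continuous_well_pot l0.
have cdw := continuous_dpar_well_pot l0.
have cI : continuous (Ik 1 l) by exact: (@smooth_var_cont _ (Ik 1) (sm_I _)).
rewrite -(ltr_pM2r N0) -mulrA {1}/delow divfK ?gt_eqF// -subr_lt0.
have i1 : itgb (fun x => dpar_well_pot l x * gst l x ^+ 2) by apply: itgb_cont; cts.
have i2 : itgb (fun x => gst l x ^+ 2) by apply: itgb_cont; cts.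
rewrite -itgZ// -itgZ// -itgB; [|exact: itgbZ|exact: itgbZ].
have -> : itg (fun x => l * (dpar_well_pot l x * gst l x ^+ 2) - 2 * elow l * gst l x ^+ 2) =
  itg (fun x => (2 * (well_pot l x - elow l) - 2 * l ^+ 3 * x * sol l x * slope l x)
                * gst l x ^+ 2
      + l ^+ 3 * dCof l * (sol l x * Ik 1 l x * (slope l x * gst l x ^+ 2))).
  apply: itg_ext => x x11; rewrite well_potE// /dpar_well_pot /dsol.
  move: (sol l x) (slope l x) (gst l x) (Ik 1 l x) (dCof l) (elow l) => q w a i c e.
  by field.
rewrite itgD; [|by apply: itgb_cont; cts|by apply: itgb_cont; cts].
rewrite pohozaev// itgZ; last by apply: itgb_cont; cts.
have I0 : 0 <= itg (fun x => sol l x * Ik 1 l x * (slope l x * gst l x ^+ 2)).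
  apply: itg_ge0 => x _; rewrite mulr_ge0//; first exact: sol_Ik_ge0.
  by rewrite mulr_ge0 ?sqr_ge0// ltW// slope_gt0.
have D0 : l ^+ 3 * dCof l * itg (fun x => sol l x * Ik 1 l x * (slope l x * gst l x ^+ 2)) <= 0.
  by rewrite mulr_le0_ge0// nmulr_lle0 ?exprn_ge0 ?(ltW l0)// dCof_lt0.
have := dgst1_neq0 l0; have := sqr_ge0 (dgst l (-1)).
move: D0; move: (_ * itg _) (dgst l 1 ^+ 2) (dgst l (-1) ^+ 2) => u v w; lra.
Qed.

Lemma elow_lower l : 0 < l -> 1 / 4 - 4 * l ^+ 2 <= elow l /\ - (4 * l ^+ 2) <= elow l.
Proof.
move=> l0; have g := gstP l0; have N0 := ground_norm_gt0 g; have w := ground_wd g.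
have [gm gp] := ground_bc g; have cU := continuous_well_pot l0.
have [cp cd] := continuous_gst l0; have A := ground_attained cU g.
have P := poincare w gm; have i1 : itgb (fun x => dgst l x ^+ 2) by apply: itgb_cont; cts.
have i2 : itgb (fun x => gst l x ^+ 2) by apply: itgb_cont; cts.
have D0 : 0 <= itg (fun x => dgst l x ^+ 2) by apply: itg_ge0 => x _; exact: sqr_ge0.
have i3 : itgb (fun x => well_pot l x * gst l x ^+ 2) by apply: itgb_cont; cts.
have : - (4 * l ^+ 2) * itg (fun x => gst l x ^+ 2) <= itg (fun x => well_pot l x * gst l x ^+ 2).
  rewrite -itgZ//; apply: itg_le => //; first exact: itgbZ.
  move=> x _; apply: ler_wpM2r; first exact: sqr_ge0.
  by have := well_pot_bound l x; rewrite ler_norml => /andP[].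
move: A; rewrite itgD// => A B; split; rewrite -(ler_pM2r N0) -A.
  by move: P B; move: (itg _) (itg _) (itg _) => a b c; lra.
by move: D0 B; move: (itg _) (itg _) (itg _) => a b c; lra.
Qed.

(** When C is small the test function 4 - q^2 has negative energy: the profile
spends most of its length near the zeros of q^2 - 4 without gaining there,
while its passage through 0 contributes a fixed amount divided by l. *)
Lemma elow_neg : exists2 l : R, 0 < l & elow l < 0.
Proof.
(* with this c the parameter l is at most 2 / sqrt c = 20 and the slope at
most 3, so that 8 c < (2048 / 105) / (3 l) *)
pose c : R := 1 / 100; have c0 : 0 < c by rewrite /c; lra.
pose l := halflength c; have l0 : 0 < l by exact: Gk_2_gt0.
exists l => //.
have cE : Cof l = c.
  have := CofE l0; rewrite -/(halflength _) => E.
  case: (ltgtP (Cof l) c) => // h.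
    by have := halflength_decr (Cof_gt0 l0) h; rewrite E ltxx.
  by have := halflength_decr c0 h; rewrite E ltxx.
have l20 : l <= 20.
  apply: (le_trans (halflength_le c0)).
  have -> : c = (1 / 10) ^+ 2 by rewrite /c; field.
  by rewrite sqrtr_sqr ger0_norm; lra.
have s3 x : slope l x <= 3.
  rewrite /slope cE; have /andP[_] := wgt_bounds (sol l x) c0; move=> /le_trans; apply.
  have -> : 3 = Num.sqrt (3 ^+ 2) :> R by rewrite sqrtr_sqr ger0_norm.
  by rewrite ler_sqrt ?exprn_ge0// /c; lra.
have cq := continuous_sol l0; have cs := continuous_slope l0.
have cU := continuous_well_pot l0.
pose h x := 4 - sol l x ^+ 2; pose k x := 2 * l * (sol l x * slope l x).
pose k' x := 2 * l ^+ 2 * (sol l x ^+ 2 * h x - slope l x ^+ 2).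
have ch : continuous h by rewrite /h; cts.
have ck : continuous k by rewrite /k; cts.
have ck' : continuous k' by rewrite /k'; cts.
have dh x : dv h x (k x).
  apply: (dv_eq (dvB (dv_cst 4 x) (dvX 1 (dv_sol x l0)))).
  by rewrite /k expr1; ring.
have sol2 x : -1 <= x <= 1 -> `|sol l x| <= 2.
  by move=> x11; apply: sol_le2 => //; rewrite ler_norml.
have hE x : -1 <= x <= 1 -> well (sol l x) = h x by move=> /sol2 /wellE.
have h0 x : -1 <= x <= 1 -> 0 <= h x by move=> /hE <-; exact: well_ge0.
have dk x : -1 < x < 1 -> dv k x (k' x).
  move=> x11; apply: (dv_eq (dvZ (2 * l) (dvM (dv_sol x l0) (dv_slope x l0)))).
  by rewrite /k' hE; [ring|lra].
have w : weak_derivative h k by apply: wd_dv => // x _.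
have hm : h (-1) = 0 by rewrite /h solN1//; ring.
have hp : h 1 = 0 by rewrite /h sol1//; ring.
have [_ _ _ V] := gstP l0.
have {}V := V _ _ w hm hp.
suff neg : itg (fun x => k x ^+ 2 + well_pot l x * h x ^+ 2) < 0.
  rewrite ltNge; apply/negP => e0; move: (le_lt_trans V neg); rewrite ltNge mulr_ge0//.
  by apply: itg_ge0 => x _; exact: sqr_ge0.
(* integration by parts, then q'' = - l^2 q (4 - q^2) and q'^2 = l^2 (h^2 / 2 + C) *)
have hk0 : itg (fun x => k' x * h x + k x * k x) = 0.
  have c1 : continuous (fun x => k x * h x) by cts.
  have c2 : continuous (fun x => k' x * h x + k x * k x) by cts.
  have dhk x : -1 < x < 1 -> dv (fun x => k x * h x) x (k' x * h x + k x * k x).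
    by move=> x11; apply: dvM; [exact: dk|exact: dh].
  rewrite (itg_deriv (wd_dv c2 c1 dhk)).
  by rewrite hm hp !mulr0 subrr.
have -> : itg (fun x => k x ^+ 2 + well_pot l x * h x ^+ 2) =
    2 * l ^+ 2 * itg (fun x => c * h x - sol l x ^+ 2 * h x ^+ 2).
  rewrite -[LHS]subr0 -hk0 -itgB; [|exact: itgb_quad w cU|by apply: itgb_cont; cts].
  rewrite -itgZ; last by apply: itgb_cont; cts.
  apply: itg_ext => x x11; rewrite well_potE// /k'.
  have S2 : slope l x ^+ 2 = h x ^+ 2 / 2 + c.
    by rewrite /slope wgt_sq cE// /dblwell hE.
  rewrite S2; have -> : l ^+ 2 * (sol l x ^+ 2 - 4) = - l ^+ 2 * h x by rewrite /h; ring.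
  by field.
rewrite pmulr_rlt0 ?mulr_gt0 ?exprn_gt0//.
rewrite itgB; [|by apply: itgb_cont; cts|by apply: itgb_cont; cts].
rewrite subr_lt0.
have up : itg (fun x => c * h x) <= 8 * c.
  have -> : 8 * c = c * 4 * 2 by ring.
  rewrite -itg_cst; apply: itg_le; [by apply: itgb_cont; cts|exact: itgb_cst|].
  by move=> x _; rewrite ler_pM2l// /h; have := sqr_ge0 (sol l x); lra.
have low : 2048 / 105 <= l * 3 * itg (fun x => sol l x ^+ 2 * h x ^+ 2).
  (* P is a primitive of y^2 (4 - y^2)^2: substitute y = sol l x *)
  pose P y : R := 16 / 3 * y ^+ 3 - 8 / 5 * y ^+ 5 + 1 / 7 * y ^+ 7.
  have dP x : dv (fun x => P (sol l x)) x (- l * (slope l x * (sol l x ^+ 2 * h x ^+ 2))).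
    have ds := dv_sol x l0.
    apply: (dv_eq (dvD (dvB (dvZ (16 / 3) (dvX 2 ds)) (dvZ (8 / 5) (dvX 4 ds)))
      (dvZ (1 / 7) (dvX 6 ds)))).
    by rewrite /h; move: (sol l x) (slope l x) => q s; field.
  have cP : continuous (fun x => P (sol l x)) by exact: dv_continuous dP.
  have cdP : continuous (fun x => - l * (slope l x * (sol l x ^+ 2 * h x ^+ 2))) by cts.
  have := itg_deriv (wd_dv cdP cP (fun x _ => dP x)).
  rewrite sol1// solN1// itgZ; last by apply: itgb_cont; cts.
  have -> : P (-2) - P 2 = - (2048 / 105) by rewrite /P; field.
  rewrite mulNr => /oppr_inj <-; rewrite -mulrA ler_pM2l// -itgZ; last by apply: itgb_cont; cts.
  apply: itg_le; [by apply: itgb_cont; cts|by apply: itgb_cont; cts|].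
  by move=> x _; apply: ler_wpM2r => //; rewrite mulr_ge0 ?sqr_ge0.
apply: (le_lt_trans up); rewrite /c.
have I0 : 0 <= itg (fun x => sol l x ^+ 2 * h x ^+ 2).
  by apply: itg_ge0 => x _; rewrite mulr_ge0 ?sqr_ge0.
have I60 : l * 3 * itg (fun x => sol l x ^+ 2 * h x ^+ 2) <=
    60 * itg (fun x => sol l x ^+ 2 * h x ^+ 2) by apply: ler_wpM2r => //; lra.
by move: (le_trans low I60); move: (itg _) => I; lra.
Qed.

Lemma dv_rayleigh l : 0 < l -> dv (fun l => 2 / l ^+ 2 * elow l) l
  (2 / l ^+ 3 * (l * delow l - 2 * elow l)).
Proof.
move=> l0; have l2 : l ^+ 2 != 0 by rewrite gt_eqF// exprn_gt0.
have d2 := @dvV _ (fun y => y ^+ 2) l _ l2 (dvX 1 (dv_id l)).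
apply: (dv_eq (dvM (dvZ 2 d2) (dv_elow l0))).
by field; rewrite gt_eqF.
Qed.

End Monotonicity.

Theorem theorem5p1 (R : realType) (kappa : R) (hkappa : kappa = 4 \/ kappa = 2) :
  (exists (lambda0 : R) (chi : R -> triple R),
     is_branch kappa (-8) lambda0 +oo%E chi) /\
  (forall (lambda0 : R) (lambdas : \bar R) (chi : R -> triple R),
     is_branch kappa (-8) lambda0 lambdas chi ->
     let m := fun lambda : R => mu (-8) lambda (chi lambda) in
     [/\ lambdas = +oo%E,
         (forall lambda : R, 0 < lambda ->
            0 < nu kappa (-8) lambda (chi lambda)),
         (exists lambdac : R,
            [/\ 0 < lambdac,
                (forall lambda : R, 0 < lambda < lambdac -> 0 < m lambda),
                m lambdac = 0
              & derivable m lambdac 1 /\ derive1 m lambdac < 0]),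
         (forall lambda : R, 0 < lambda ->
            derivable m lambda 1 /\ derive1 m lambda < 0)
       & (exists2 l : R, m lambda @[lambda --> +oo] --> l & l < 0)]).
Proof.
split; first by exists (1 / 30), (@chi R); exact: chi_is_branch.
move=> l0 ls X br m; have lsE := branch_infinite hkappa br.
have eqX (l : R) : 0 < l -> same_on (X l) (chi l).
  by move=> lp; apply: (branch_eq_chi br) => //; rewrite lsE ltry.
have mE (l : R) : 0 < l -> m l = 2 / l ^+ 2 * elow l.
  by move=> lp; apply: mu_elow => //; exact: eqX.
pose dm (l : R) := 2 / l ^+ 3 * (l * delow l - 2 * elow l).
have dmP (l : R) : 0 < l -> dv m l (dm l).
  move=> lp; apply: (dv_near _ (dv_rayleigh lp)); near=> y.
  by rewrite mE//; near: y; exact: lt_nbhsr.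
have dm0 (l : R) : 0 < l -> dm l < 0.
  move=> lp; rewrite /dm pmulr_rlt0 ?divr_gt0 ?exprn_gt0// subr_lt0.
  exact: delow_lt.
have dmm (l : R) : 0 < l -> derivable m l 1 /\ derive1 m l < 0.
  by move=> lp; have [d e] := dmP l lp; split => //; rewrite derive1E e; exact: dm0.
have cm (l l' : R) : 0 < l -> {within `[l, l'], continuous m}.
  move=> lp; apply: continuous_in_subspaceT => y; rewrite inE /= in_itv /= => /andP[ly _].
  exact: dv_cont (dmP y (lt_le_trans lp ly)).
have mlt (l l' : R) : 0 < l -> l < l' -> m l' < m l.
  move=> lp ll; have [|y /andP[ly _]] := mvt (ltW ll) (cm l l' lp) (g := dm).
    by move=> x /andP[lx _]; exact: dmP (lt_trans lp lx).
  have y0 := dm0 y (lt_le_trans lp ly); move=> E; rewrite -subr_lt0 E.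
  by rewrite nmulr_rlt0// subr_gt0.
have [L Lp] := @elow_neg R; rewrite -(pmulr_rlt0 _ (_ : 0 < 2 / L ^+ 2)); last first.
  by rewrite divr_gt0 ?exprn_gt0.
rewrite -mE// => mL.
have m8 : 0 < m (1 / 8).
  have p8 : 0 < (1 / 8 : R) by rewrite divr_gt0.
  rewrite mE// mulr_gt0 ?divr_gt0 ?exprn_gt0//.
  by have [+ _] := elow_lower p8; apply: lt_le_trans; lra.
have L8 : 1 / 8 < L.
  rewrite ltNge; apply/negP; rewrite le_eqVlt => /orP[/eqP E|/(mlt _ _ Lp)].
    by move: mL m8; rewrite E; lra.
  by move: mL m8; lra.
split=> //.
- by move=> l lp; apply: nu_chi_gt0 => //; exact: eqX.
- have p8 : 0 < (1 / 8 : R) by rewrite divr_gt0.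
  have [|c] := IVT (ltW L8) (cm _ _ p8) (v := 0).
    by rewrite ge_min le_max (ltW mL) (ltW m8) orbT.
  rewrite in_itv /= => /andP[c8 cL] mc; have cp : 0 < c by exact: lt_le_trans c8.
  exists c; split=> //; last exact: dmm.
  by move=> l /andP[lp lc]; rewrite -mc; exact: mlt.
(* m tends to its infimum because it decreases *)
- pose A : set R := [set y | exists2 l : R, 0 < l & y = m l].
  have lbA : lbound A (-8).
    move=> _ [l lp ->]; rewrite mE//.
    have [_ h] := elow_lower lp; have l2 : 0 < 2 / l ^+ 2 by rewrite divr_gt0 ?exprn_gt0.
    apply: le_trans (_ : 2 / l ^+ 2 * - (4 * l ^+ 2) <= _); last by rewrite ler_pM2l.
    by rewrite le_eqVlt; apply/orP; left; apply/eqP; field; rewrite gt_eqF.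
  have infA : has_inf A by split; [exists (m L), L|exists (-8)].
  exists (inf A); last by apply: le_lt_trans mL; apply: ge_inf; [case: infA|exists L].
  apply/cvgrPdist_le => e e0.
  have [_ [l lp ->] me] := inf_adherent e0 infA.
  near=> y; have ly : l < y by near: y; apply: nbhs_pinfty_gt; exact: num_real.
  have i1 : inf A <= m y.
    by apply: ge_inf; [case: infA|exists y => //; exact: lt_trans ly].
  have i2 := mlt _ _ lp ly.
  by rewrite ler_norml; lra.
Unshelve. all: by end_near. Qed.
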